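(* Let $\lambda\in\mathbb{C}$ with $|1-\lambda|\ne1$. (i) If $f\in L_2(\mathbb{R}_+)$ is a solution of the homogeneous integro-functional equation $$f(x)+\frac2\pi\,PV\int_0^\infty\frac{x f(t)}{x^2-t^2}\,dt=\frac{\lambda}{x}f\left(\frac1x\right),\quad x>0,\qquad(A)$$ then $f$ has the form of the mean square convergent integral $$f(x)=\frac{1}{2\pi i}\int_\sigma\frac{\varphi(s)\,x^{-s}}{\tan(\pi s/2)+1-\lambda}\,ds\qquad(B)$$ for some function $\varphi\in L_2(\sigma)$ satisfying $\varphi(s)=-\varphi(1-s)$, $s\in\sigma$. Conversely, if $\varphi\in L_2(\sigma)$ satisfies $\varphi(s)=-\varphi(1-s)$ on $\sigma$ and its inverse Mellin transform $\mu$ is a solution of the integral equation $$(2-\lambda^2)\mu(x)+\frac2\pi\int_0^\infty\frac{\mu(t)}{x+t}\,dt=0,\quad x\in\mathbb{R}_+,\qquad(C)$$ where the integral converges absolutely, then $f$ given by (B) is a solution of (A). (ii) If $f\in L_2(\mathbb{R}_+)$ is a solution of the homogeneous integro-functional equation $$f(x)+\frac2\pi\,PV\int_0^\infty\frac{t f(t)}{t^2-x^2}\,dt=\frac{\lambda}{x}f\left(\frac1x\right),\quad x>0,\qquad(A')$$ then $f$ has the form of the mean square convergent integral $$f(x)=\frac{1}{2\pi i}\int_\sigma\frac{\varphi(s)\,x^{-s}}{\cot(\pi s/2)+1-\lambda}\,ds\qquad(B')$$ for some function $\varphi\in L_2(\sigma)$ satisfying $\varphi(s)=-\varphi(1-s)$,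 $s\in\sigma$. Conversely, if $\varphi\in L_2(\sigma)$ satisfies $\varphi(s)=-\varphi(1-s)$ on $\sigma$ and its inverse Mellin transform $\mu$ is a solution of (C), then $f$ given by (B') is a solution of (A').
   Context: $\mathbb{R}_+=(0,\infty)$ and $\sigma=\{s\in\mathbb{C}:\ s=\tfrac12+i\tau,\ \tau\in\mathbb{R}\}$. The Mellin transform on $L_2(\mathbb{R}_+)$ is $f^*(s)=\int_0^\infty f(t)t^{s-1}\,dt$, $s\in\sigma$ (convergent in the norm of $L_2(\sigma)$), with inverse $f(x)=\frac{1}{2\pi i}\int_\sigma f^*(s)x^{-s}\,ds$, $x>0$; it is a bijection $L_2(\mathbb{R}_+)\to L_2(\sigma)$. Integrals $\frac{1}{2\pi i}\int_\sigma h(s)x^{-s}\,ds$ are understood in the mean square sense, i.e. as the $L_2(\mathbb{R}_+)$-limit as $N\to\infty$ of $\frac1{2\pi}\int_{-N}^N h(\tfrac12+i\tau)x^{-1/2-i\tau}\,d\tau$. $PV$ denotes the Cauchy principal value at $t=x$. Equalities between $L_2$ functions are understood almost everywhere. *)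

(* Defs.v *)
From HB Require Import structures.
From mathcomp Require Export all_boot all_order all_algebra.
From mathcomp Require Export all_classical all_reals all_analysis.
From mathcomp Require Export complex.

Set Implicit Arguments.
Unset Strict Implicit.
Unset Printing Implicit Defensive.

Import Order.TTheory GRing.Theory Num.Theory.
Import numFieldNormedType.Exports.
Import ComplexField.Normc.

Local Open Scope classical_set_scope.
Local Open Scope ring_scope.
Local Open Scope complex_scope.

Section ComplexFunctions.
Context {R : realType}.
Implicit Types z s : R[i].

Definition cexp z : R[i] :=
  (expR (complex.Re z))%:C * (cos (complex.Im z) +i* sin (complex.Im z)).

Definition iC : R[i] := 0 +i* 1.

Definition csin z : R[i] := (cexp (iC * z) - cexp (- (iC * z))) / (2 * iC).
Definition ccos z : R[i] := (cexp (iC * z) + cexp (- (iC * z))) / 2.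
Definition ctan z : R[i] := csin z / ccos z.
Definition ccot z : R[i] := ccos z / csin z.

(* x ^ s, meant for x > 0 only *)
Definition cpow (x : R) s : R[i] := cexp (s * (ln x)%:C).

End ComplexFunctions.

Section ComplexIntegral.
Context {R : realType}.
Implicit Types (D : set R) (g f : R -> R[i]).

(* Lebesgue integrals of complex-valued functions, componentwise; cintegrable
   is absolute convergence. *)
Definition cintegrable D g : Prop :=
  (@lebesgue_measure R).-integrable D (fun t => (complex.Re (g t))%:E) /\
  (@lebesgue_measure R).-integrable D (fun t => (complex.Im (g t))%:E).

Definition cintegral D g : R[i] :=
  Rintegral (@lebesgue_measure R) D (fun t => complex.Re (g t)) +i*
  Rintegral (@lebesgue_measure R) D (fun t => complex.Im (g t)).

Definition sqnorm D g : \bar R :=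
  (\int[@lebesgue_measure R]_(x in D) ((normc (g x) ^+ 2)%:E))%E.

(* Functions stand for their classes modulo equality almost everywhere. *)
Definition L2 D g : Prop :=
  [/\ measurable_fun D (fun t => complex.Re (g t)),
      measurable_fun D (fun t => complex.Im (g t)) &
      (sqnorm D g < +oo)%E].

Definition Rpos : set R := `]0, +oo[.

Definition is_PV g (x : R) (l : R[i]) : Prop :=
  let D (e : R) := Rpos `&` [set t | e < `|t - x|] in
  (forall e : R, 0 < e -> cintegrable (D e) g) /\
  normc (cintegral (D e) g - l) @[e --> 0^'+] --> (0 : R).

End ComplexIntegral.

Section Mellin.
Context {R : realType}.

Definition sigma_pt (tau : R) : R[i] := 2^-1 +i* tau.

(* Only the values of phi on the line sigma matter; sigma carries the
   Lebesgue measure d tau. *)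
Definition L2_sigma (phi : R[i] -> R[i]) : Prop := L2 setT (phi \o sigma_pt).

Definition antisymmetric_sigma (phi : R[i] -> R[i]) : Prop :=
  {ae (@lebesgue_measure R), forall tau : R,
     phi (sigma_pt tau) = - phi (1 - sigma_pt tau)}.

Definition mellin_trunc (h : R[i] -> R[i]) (N x : R) : R[i] :=
  ((2 * pi)^-1)%:C *
  cintegral `[- N, N] (fun tau => h (sigma_pt tau) * cpow x (- sigma_pt tau)).

(* f is (almost everywhere) the mean square convergent integral
   (2 pi i)^-1 \int_sigma h(s) x^(-s) ds. *)
Definition is_inv_mellin (h : R[i] -> R[i]) (f : R -> R[i]) : Prop :=
  L2 Rpos f /\
  sqnorm Rpos (fun x => f x - mellin_trunc h N x) @[N --> +oo%R] --> 0%E.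

End Mellin.

Section Equations.
Context {R : realType}.
Implicit Types (lam : R[i]) (f mu : R -> R[i]).

Definition sol_tan lam f : Prop :=
  {ae (@lebesgue_measure R), forall x : R, 0 < x ->
     exists2 p, is_PV (fun t => x%:C * f t / (x ^+ 2 - t ^+ 2)%:C) x p &
       f x + (2 / pi)%:C * p = lam / x%:C * f (1 / x)}.

Definition sol_cot lam f : Prop :=
  {ae (@lebesgue_measure R), forall x : R, 0 < x ->
     exists2 p, is_PV (fun t => t%:C * f t / (t ^+ 2 - x ^+ 2)%:C) x p &
       f x + (2 / pi)%:C * p = lam / x%:C * f (1 / x)}.

Definition stieltjes_integrand mu (x t : R) : R[i] := mu t / (x + t)%:C.

Definition sol_stieltjes lam mu : Prop :=
  {ae (@lebesgue_measure R), forall x : R, 0 < x ->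
     (2 - lam ^+ 2) * mu x +
     (2 / pi)%:C * cintegral Rpos (stieltjes_integrand mu x) = 0}.

Definition tan_quotient lam (phi : R[i] -> R[i]) (s : R[i]) : R[i] :=
  phi s / (ctan (pi%:C * s / 2) + 1 - lam).

Definition cot_quotient lam (phi : R[i] -> R[i]) (s : R[i]) : R[i] :=
  phi s / (ccot (pi%:C * s / 2) + 1 - lam).

End Equations.

(* Main.v *)
From HB Require Import structures.
Require Import Defs.
From mathcomp Require Import measurable_realfun lebesgue_integral_under.
From mathcomp Require Import ring lra.
Import Order.TTheory GRing.Theory Num.Theory.
Import numFieldNormedType.Exports.

(** Neither the two principal value equations nor the Stieltjes equation has a
    nonzero solution in L2 of the half-line; this is the reason behind all four
    conclusions.

    Put f(x) = x^(-1/2) F(ln x), an isometry of L2(R+) onto L2(R) that turns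
    Mellin transforms on the line Re s = 1/2 into Fourier transforms (to_log,
    of_log).  With t = e^z and x = e^y, the Stieltjes operator becomes the
    convolution with 1 / (2 cosh (y / 2)), whose Fourier multiplier is
    pi m(tau), m = sech (pi tau) (sech_transformE, Stieltjes_pair).  Twice the
    kernel of either principal value equation is s / (x - t) + 1 / (x + t) with
    s = 1 or s = -1.  The principal value part is the Hilbert transform; on
    t^(-1/2) cos (tau ln t + b) it acts as multiplication by pi n(tau),
    n = tanh (pi tau), together with a shift of the phase by -pi / 2
    (Hilbert_pair).  Finally f(1/x)/x corresponds to F(-y) (pair_invert).

    So, on the Fourier side, the equation reads
       (1 + m) F - s n Q F = lam F',
    where F' is the reflection of F and Q the quarter turn, which the reflection
    changes into its opposite.  Using the equation twice makes the terms in Q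
    cancel and leaves lam^2 F = ((1 + m)^2 + n^2) F = (2 + 2 m) F, because
    m^2 + n^2 = 1 (reflection_algebra).  The Stieltjes equation is
    (lam^2 - 2) F = 2 m F, the same relation.  As 2 m(tau) = lam^2 - 2 for at
    most two values of tau, F vanishes (symbol_injective, pairing_core).

    Consequently a solution f of a principal value equation is zero and has the
    required form with phi = 0.  Conversely, if mu solves the Stieltjes equation,
    then mu = 0, so phi = 0 almost everywhere because the Mellin transform is
    injective (inv_mellin_injective); the functions represented by the quotient
    are then exactly the null functions, and these solve the equation.

    The Fourier transform is only used in weak form.  The function F is paired
    with the cosine integrals y |-> Int v(tau) cos (tau y + gam(tau)), with v
    integrable and square integrable and the phase gam arbitrary (cosint,
    pairing).  Several estimates make this rigorous.  Bessel's inequality shows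
    that cosine integrals are square integrable (bessel).  Principal values are
    limits of conjugate Poisson integrals (PV_regularization), which are bounded
    on L2 by pi, uniformly in the regularization parameter (Hilbert_reg_bound);
    both bounds come from the same Schur test (schur_bound).  Bounded sequences
    that converge almost everywhere converge weakly (weak_cvg), so the operators
    can be computed on cosine integrals, and a square integrable function whose
    Poisson integrals vanish is zero (poisson_unique). *)

Set Implicit Arguments.
Unset Strict Implicit.
Unset Printing Implicit Defensive.
Local Open Scope classical_set_scope.
Local Open Scope ring_scope.

(** * Integration over the real line *)
Section Toolbox.
Context {R : realType}.
Local Notation mu := (@lebesgue_measure R).
Implicit Types f g h : R -> R.

(** Integrals of real functions over the whole line.  A domain D of integration
    is expressed by the factor \1_D, so that every integral is of this kind and
    the rules of calculation need no domain. *)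
Definition itg f : Prop := mu.-integrable setT (EFin \o f).
Definition Int f : R := Rintegral mu setT f.
Definition mfun f : Prop := measurable_fun setT f.

Lemma aeS (P Q : R -> Prop) : (forall x, P x -> Q x) ->
  {ae mu, forall x, P x} -> {ae mu, forall x, Q x}.
Proof.
move=> PQ [N [mN N0 h]]; exists N; split => // x /= nQ; apply: h => /= Px.
exact/nQ/PQ.
Qed.

Lemma aeI (P Q : R -> Prop) : {ae mu, forall x, P x} -> {ae mu, forall x, Q x} ->
  {ae mu, forall x, P x /\ Q x}.
Proof. by apply: filterI; exact: (ae_filter_ringOfSetsType mu). Qed.

Lemma ae_neq (c : R) : {ae mu, forall y, y != c}.
Proof.
exists [set c]; split => //; first by rewrite lebesgue_measure_set1.
by move=> y /= /negP; rewrite negbK => /eqP.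
Qed.

Lemma itg_m f : itg f -> mfun f.
Proof. by move=> /measurable_int/measurable_EFinP. Qed.

Lemma ind_ge0 T (D : set T) x : 0 <= \1_D x :> R.
Proof. by rewrite indicE. Qed.

Lemma measurable_inv : mfun (@GRing.inv R).
Proof.
rewrite /mfun -(setUv [set 0 : R]).
apply/measurable_funU => //; first exact: measurableC.
split.
  apply: (eq_measurable_fun (fun=> 0 : R)) => //.
  by move=> x; rewrite inE/= => ->; rewrite invr0.
apply: open_continuous_measurable_fun; first exact/closed_openC/closed_eq.
by move=> x; rewrite inE/= => /eqP x0; exact: inv_continuous.
Qed.

Lemma mfunV d (T : measurableType d) (f : T -> R) : measurable_fun setT f -> measurable_fun setT (fun x => (f x)^-1).
Proof. by move=> mf; exact: (measurableT_comp measurable_inv). Qed.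

Lemma mfun_cos d (T : measurableType d) (f : T -> R) : measurable_fun setT f -> measurable_fun setT (fun x => cos (f x)).
Proof.
by move=> mf; apply: (measurableT_comp _ mf); apply: continuous_measurable_fun; exact: continuous_cos.
Qed.

Lemma mfun_exp d (T : measurableType d) (f : T -> R) : measurable_fun setT f -> measurable_fun setT (fun x => expR (f x)).
Proof.
by move=> mf; apply: (measurableT_comp _ mf); exact: measurable_expR.
Qed.

Lemma eq_itg f g : f =1 g -> itg f -> itg g.
Proof. by move=> /funext ->. Qed.

Lemma eq_Int f g : f =1 g -> Int f = Int g.
Proof. by move=> /funext ->. Qed.

Lemma itgD f g : itg f -> itg g -> itg (fun x => f x + g x).
Proof. exact: integrableD. Qed.
Lemma itgB f g : itg f -> itg g -> itg (fun x => f x - g x).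
Proof. exact: integrableB. Qed.
Lemma itgZ c f : itg f -> itg (fun x => c * f x).
Proof. exact: integrableZl. Qed.
Lemma itg0 : itg (fun=> 0).
Proof. exact: integrable0. Qed.
Lemma itgN f : itg f -> itg (fun x => - f x).
Proof. exact: integrableN. Qed.
Lemma itg_norm f : itg f -> itg (fun x => `|f x|).
Proof. exact: integrable_norm. Qed.

Lemma IntD f g : itg f -> itg g -> Int (fun x => f x + g x) = Int f + Int g.
Proof. by move=> *; exact: RintegralD. Qed.
Lemma IntB f g : itg f -> itg g -> Int (fun x => f x - g x) = Int f - Int g.
Proof. by move=> *; exact: RintegralB. Qed.
Lemma IntZ c f : itg f -> Int (fun x => c * f x) = c * Int f.
Proof. by move=> *; exact: RintegralZl. Qed.
Lemma Int0 : Int (fun=> 0) = 0.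
Proof. by rewrite /Int /Rintegral integral0. Qed.
Lemma IntN f : itg f -> Int (fun x => - f x) = - Int f.
Proof. by move=> fi; rewrite -mulN1r -IntZ//; apply: eq_Int => x; rewrite mulN1r. Qed.

Lemma itg_le f g : mfun f -> itg g -> (forall x, `|f x| <= g x) -> itg f.
Proof.
move=> mf ig fg; apply: (le_integrable _ _ _ ig) => //; first exact/measurable_EFinP.
by move=> x _; rewrite /= lee_fin (le_trans (fg x))// ler_norm.
Qed.

Lemma Int_le f g : itg f -> itg g -> (forall x, f x <= g x) -> Int f <= Int g.
Proof. by move=> fi gi fg; apply: le_Rintegral => // x _. Qed.

Lemma Int_ge0 f : (forall x, 0 <= f x) -> 0 <= Int f.
Proof. by move=> f0; apply: Rintegral_ge0. Qed.

Lemma Int_abs f : itg f -> `|Int f| <= Int (fun x => `|f x|).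
Proof. by move=> fi; exact: le_normr_Rintegral. Qed.

Lemma Int_abs_le f g : itg f -> itg g -> (forall x, `|f x| <= g x) -> `|Int f| <= Int g.
Proof. by move=> fi gi fg; apply: (le_trans (Int_abs fi)); apply: Int_le => //; exact: itg_norm. Qed.

Lemma IntE f : itg f -> (Int f)%:E = (\int[mu]_x (f x)%:E)%E.
Proof. by move=> fi; rewrite /Int /Rintegral fineK//; exact: integrable_fin_num. Qed.

Lemma itg_ge0P f : mfun f -> (forall x, 0 <= f x) ->
  (\int[mu]_x (f x)%:E < +oo)%E -> itg f.
Proof.
move=> mf f0 fi; apply/integrableP; split; first exact/measurable_EFinP.
by under eq_integral do rewrite /= ger0_norm//.
Qed.

Lemma itg_lty f : itg f -> (\int[mu]_x (f x)%:E < +oo)%E.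
Proof. by move=> fi; rewrite -IntE// ltry. Qed.

Lemma ae_eq_Int f g : mfun f -> mfun g -> {ae mu, forall x, f x = g x} -> Int f = Int g.
Proof.
move=> mf mg fg; congr fine; apply: ae_eq_integral => //; try exact/measurable_EFinP.
by apply: aeS fg => x /= ->.
Qed.

Lemma ae_eq_itg f g : mfun f -> mfun g -> {ae mu, forall x, f x = g x} -> itg f -> itg g.
Proof.
move=> mf mg fg fi; apply/integrableP; split; first exact/measurable_EFinP.
rewrite (_ : (\int[mu]_(x in setT) _)%E = (\int[mu]_x `|(EFin \o f) x|)%E).
  by have /integrableP[] := fi.
apply: ae_eq_integral => //.
- by apply/measurable_EFinP; exact: measurableT_comp.
- by apply/measurable_EFinP; exact: measurableT_comp.
by apply: aeS fg => x /= ->.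
Qed.

Lemma dct (fn : nat -> R -> R) f g : (forall n, mfun (fn n)) -> mfun f -> itg g ->
  (forall n x, `|fn n x| <= g x) -> {ae mu, forall x, fn n x @[n --> \oo] --> f x} ->
  Int (fn n) @[n --> \oo] --> Int f.
Proof.
move=> mfn mf gi fg cv.
have [||//|||intf _ h] := @dominated_convergence _ _ R mu setT measurableT
  (fun n => EFin \o fn n) (EFin \o f) (EFin \o g).
- by move=> n; apply/measurable_EFinP; exact: mfn.
- exact/measurable_EFinP.
- apply: aeS cv => x cv _.
  by apply: cvg_EFin => //; exact: nearW.
- exact: gi.
- by apply: (aeW mu) => x n _ /=; rewrite lee_fin.
apply: fine_cvg; rewrite /= in h.
by rewrite (IntE intf).
Qed.

(** Fatou's lemma doubles as an integrability criterion: a pointwise limit of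
    nonnegative functions with bounded integrals is integrable. *)
Lemma fatou_Int (fn : nat -> R -> R) f C : (forall n, itg (fn n)) -> mfun f ->
  (forall n x, 0 <= fn n x) -> (forall x, 0 <= f x) -> (forall n, Int (fn n) <= C) ->
  {ae mu, forall x, fn n x @[n --> \oo] --> f x} ->
  itg f /\ Int f <= C.
Proof.
move=> ifn mf fn0 f0 fnC [N [mN N0 cv]].
(* Setting every function to zero on the exceptional set makes the
   convergence hold everywhere. *)
pose r (h : R -> R) x := h x * \1_(~` N) x.
have mr h : mfun h -> mfun (r h).
  by move=> mh; apply: measurable_funM => //; apply: measurable_indic; exact: measurableC.
have rE (h : R -> R) : {ae mu, forall x, r h x = h x}.
  exists N; split => // x /=; apply: contra_notP => xN.
  by rewrite /r indicE mem_set// mulr1.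
have r0 (h : R -> R) x : 0 <= h x -> 0 <= r h x by move=> h0; rewrite mulr_ge0.
have cvr x : r (fn n) x @[n --> \oo] --> r f x.
  have [xN|xN] := pselect (N x).
    rewrite (_ : r f x = 0); last by rewrite /r indicE memNset ?mulr0//; exact.
    rewrite (_ : (fun n => r (fn n) x) = fun=> 0); first exact: cvg_cst.
    by apply/funext => n; rewrite /r indicE memNset ?mulr0//; exact.
  rewrite /r indicE mem_set//= mulr1.
  rewrite (_ : (fun n => fn n x * _) = fun n => fn n x); last by apply/funext => n; rewrite mulr1.
  by apply: contrapT; move/cv.
have ir n : itg (r (fn n)).
  apply: ae_eq_itg (ifn n) => //; [exact: (itg_m (ifn n))|exact: (mr _ (itg_m (ifn n)))|].
  by apply: aeS (rE (fn n)) => x ->.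
have IntrE n : Int (r (fn n)) = Int (fn n).
  by apply: ae_eq_Int; [exact: (itg_m (ir n))|exact: (itg_m (ifn n))|exact: rE].
have key : (\int[mu]_x (r f x)%:E <= C%:E)%E.
  have := @fatou _ _ R mu setT measurableT (fun n => EFin \o r (fn n)).
  rewrite (_ : (\int[mu]_(x in _) _)%E = (\int[mu]_x (r f x)%:E)%E); last first.
    apply: eq_integral => x _.
    have cvx : (r (fn n) x)%:E @[n --> \oo] --> (r f x)%:E.
      by apply: cvg_EFin; [exact: nearW|exact: cvr].
    rewrite is_cvg_limn_einfE; last by apply/cvg_ex; eexists; exact: cvx.
    exact/cvg_lim.
  move=> /(_ _ _)/le_trans; apply.
  - by move=> n; apply/measurable_EFinP; exact: (itg_m (ir n)).
  - by move=> n x _; rewrite lee_fin r0.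
  rewrite limn_einf_lim; apply: lime_le; first exact: is_cvg_einfs.
  apply: nearW => n.
  apply: (@le_trans _ _ (\int[mu]_x (r (fn n) x)%:E)%E).
    by apply: ereal_inf_lbound; exists n => //=.
  by rewrite -IntE// lee_fin IntrE.
have irf : itg (r f).
  by apply: itg_ge0P; [exact: mr| move=> x; exact: r0|exact: le_lt_trans key (ltry _)].
have ifE : itg f by apply: ae_eq_itg irf => //; exact: mr.
split => //; rewrite -lee_fin (_ : Int f = Int (r f)); first by rewrite IntE.
by apply: ae_eq_Int => //; [exact: mr|apply: aeS (rE f) => x ->].
Qed.

End Toolbox.

Section Toolbox2.
Context {R : realType}.
Local Notation mu := (@lebesgue_measure R).
Implicit Types f g h : R -> R.
Implicit Types K : R -> R -> R.

Definition mfun2 K : Prop := measurable_fun [set: R * R] (fun p => K p.1 p.2).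

Lemma mfun2_fst f : mfun f -> mfun2 (fun x _ => f x).
Proof. by move=> mf; apply: (measurableT_comp mf); exact: measurable_fst. Qed.
Lemma mfun2_snd f : mfun f -> mfun2 (fun _ x => f x).
Proof. by move=> mf; apply: (measurableT_comp mf); exact: measurable_snd. Qed.
Lemma mfun2_row K x : mfun2 K -> mfun (K x).
Proof.
move=> mK; rewrite /mfun (_ : K x = (fun p => K p.1 p.2) \o (fun y => (x, y)))//.
apply: (measurableT_comp mK); exact: measurable_pair1.
Qed.
Lemma mfun2_col K y : mfun2 K -> mfun (fun x => K x y).
Proof.
move=> mK; rewrite /mfun (_ : (fun x => K x y) = (fun p => K p.1 p.2) \o (fun x => (x, y)))//.
apply: (measurableT_comp mK); exact: measurable_pair2.
Qed.
Lemma mfun2_swap K : mfun2 K -> mfun2 (fun x y => K y x).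
Proof.
move=> mK; rewrite /mfun2 (_ : (fun p : R * R => K p.2 p.1) = (fun p => K p.1 p.2) \o (fun p : R * R => (p.2, p.1)))//.
apply: (measurableT_comp mK); apply: measurable_fun_pair; [exact: measurable_snd|exact: measurable_fst].
Qed.

Lemma mfun_Int K : mfun2 K -> mfun (fun x => Int (K x)).
Proof.
move=> mK.
have mK' : measurable_fun [set: R * R] (fun p => (K p.1 p.2)%:E) by exact/measurable_EFinP.
rewrite /mfun (_ : (fun x => Int (K x)) = fine \o (fun x => \int[mu]_y (K x y)%:E)%E)//.
apply: measurableT_comp; first exact: fine_measurable.
have -> : (fun x => \int[mu]_y (K x y)%:E)%E =
   (fun x => \int[mu]_y ((fun p => (K p.1 p.2)%:E) ^\+ (x, y)) - \int[mu]_y ((fun p => (K p.1 p.2)%:E) ^\- (x, y)))%E.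
  by apply/funext => x; rewrite [LHS]integralE; congr (_ - _)%E; apply: eq_integral => y _; rewrite ?funeposE ?funenegE.
apply: emeasurable_funB.
  apply: (@measurable_fun_fubini_tonelli_F _ _ _ _ R mu ((fun p : R * R => (K p.1 p.2)%:E) ^\+)%E) => //.
  exact: measurable_funepos.
apply: (@measurable_fun_fubini_tonelli_F _ _ _ _ R mu ((fun p : R * R => (K p.1 p.2)%:E) ^\-)%E) => //.
exact: measurable_funeneg.
Qed.

Lemma Tonelli K : mfun2 K -> (forall x y, 0 <= K x y) ->
  (\int[mu]_x \int[mu]_y (K x y)%:E = \int[mu]_y \int[mu]_x (K x y)%:E)%E.
Proof.
move=> mK K0; apply: (@fubini_tonelli _ _ _ _ R mu mu (fun p => (K p.1 p.2)%:E)).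
  exact/measurable_EFinP.
by move=> p; rewrite lee_fin.
Qed.

Definition itg2 K : Prop := (mu \x mu)%E.-integrable setT (fun p : R * R => (K p.1 p.2)%:E).

(** Tonelli's criterion in the form that suits the interchanges below: only an
    upper bound G of the inner integrals has to be found. *)
Lemma itg2_bound K (G : R -> R) : mfun2 K -> (forall x, itg (K x)) -> itg G ->
  (forall x, Int (fun y => `|K x y|) <= G x) -> itg2 K.
Proof.
move=> mK iK iG KG; apply/integrable12ltyP; first exact/measurable_EFinP.
rewrite (_ : (\int[_]_x _)%E = (\int[mu]_x (Int (fun y => `|K x y|))%:E)%E); last first.
  by apply: eq_integral => x _ /=; rewrite IntE//; exact: itg_norm.
apply: (le_lt_trans _ (itg_lty iG)); apply: ge0_le_integral => //.
- by move=> x _; rewrite lee_fin; apply: Int_ge0.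
- apply/measurable_EFinP; apply: (mfun_Int (K := fun x y => `|K x y|)).
  exact: measurableT_comp.
- by apply/measurable_EFinP; exact: itg_m.
by move=> x _; rewrite lee_fin.
Qed.

Lemma itg2_swap K : itg2 K -> itg2 (fun x y => K y x).
Proof.
move=> iK; have mK : mfun2 K by apply/measurable_EFinP; exact: measurable_int iK.
apply/integrable21ltyP; first by apply/measurable_EFinP; exact: (mfun2_swap mK).
by move/integrable12ltyP : iK; apply; exact/measurable_EFinP.
Qed.

Lemma itg2_Int K : itg2 K -> itg (fun x => Int (K x)).
Proof.
move=> iK; have mK : mfun2 K by apply/measurable_EFinP; exact: measurable_int iK.
have iF := integrable_fubini_F iK.
have : mu.-integrable setT (EFin \o (fun x => Int (K x))).
  apply: (le_integrable _ _ _ iF) => //.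
    by apply/measurable_EFinP; exact: mfun_Int.
  move=> x _ /=; rewrite /fubini_F /Int /Rintegral /=.
  (* Infinite inner integrals become 0 under fine, so |Int (K x)| is at most
     the modulus of the extended real inner integral. *)
  by case: (\int[mu]_y _)%E => [r| |] //=; rewrite normr0 leey.
by [].
Qed.

Lemma itg2_ae K : itg2 K -> {ae mu, forall x, itg (K x)}.
Proof. exact: ae_integrable1. Qed.

Lemma Fubini_Int K : itg2 K ->
  Int (fun x => Int (K x)) = Int (fun y => Int (fun x => K x y)).
Proof.
move=> iK.
have E2 (L : R -> R -> R) : itg2 L -> (Int (fun x => Int (L x)))%:E = (\int[mu]_x \int[mu]_y (L x y)%:E)%E.
  move=> iL; have mL : mfun2 L by apply/measurable_EFinP; exact: measurable_int iL.
  rewrite IntE; last exact: itg2_Int.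
  apply: ae_eq_integral => //.
  - by apply/measurable_EFinP; exact: mfun_Int.
  - exact: (measurable_fubini_F iL).
  by apply: aeS (itg2_ae iL) => x ix _ /=; rewrite IntE.
apply/EFin_inj; rewrite E2// E2; last exact: itg2_swap.
exact: (Fubini iK).
Qed.
End Toolbox2.

(** * Primitives, reflection and exponential substitution *)
Section FTC.
Context {R : realType}.
Local Notation mu := (@lebesgue_measure R).
Implicit Types f g h F : R -> R.

Lemma patch_indic (D : set R) f : f \_ D = (fun x => f x * \1_D x).
Proof.
by apply/funext => x; rewrite patchE indicE; case: (x \in D); rewrite ?mulr1 ?mulr0.
Qed.

Lemma Rintegral_Int (D : set R) f : Rintegral mu D f = Int (fun x => f x * \1_D x).
Proof. by rewrite Rintegral_mkcond patch_indic. Qed.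

Lemma itg_indic_on (D : set R) f : measurable D ->
  mu.-integrable D (EFin \o f) <-> itg (fun x => f x * \1_D x).
Proof.
by move=> mD; have := integrable_mkcond (mu := mu) (EFin \o f) mD; rewrite restrict_EFin patch_indic.
Qed.

Lemma mfun_indic (D : set R) : measurable D -> mfun (\1_D : R -> R).
Proof. by move=> mD; exact: measurable_indic. Qed.

Lemma itg_indicM (D : set R) f : measurable D -> itg f -> itg (fun x => f x * \1_D x).
Proof.
move=> mD fi; apply: itg_le (itg_norm fi) _; first by apply: measurable_funM; [exact: itg_m|exact: mfun_indic].
by move=> x; rewrite normrM ler_piMr// indicE; case: (_ \in _); rewrite ?normr1 ?normr0.
Qed.

Lemma itvT_cvg f x : f x * \1_(`[- (n%:R : R), n%:R]%classic) x @[n --> \oo] --> f x.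
Proof.
apply: cvg_near_cst; near=> n; rewrite indicE mem_set ?mulr1//= in_itv/=.
rewrite -ler_norml; near: n; exact: nbhs_infty_ger.
Unshelve. all: by end_near. Qed.

Lemma Int_itv_cvg f : itg f -> Int (fun x => f x * \1_(`[- (n%:R : R), n%:R]%classic) x) @[n --> \oo] --> Int f.
Proof.
move=> fi; apply: (dct (g := fun x => `|f x|)).
- by move=> n; apply: itg_m; apply: itg_indicM.
- exact: itg_m.
- exact: itg_norm.
- move=> n x; rewrite normrM ler_piMr// indicE; case: (_ \in _); by rewrite ?normr1 ?normr0.
- by apply: (aeW mu) => x; exact: itvT_cvg.
Qed.

Lemma is_derive_continuous F (x d : R) : is_derive x (1:R) F d -> F y @[y --> x] --> F x.
Proof.
by move=> dF; apply: differentiable_continuous; apply/derivable1_diffP; exact: ex_derive.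
Qed.

Lemma derivable_continuous F : (forall x, derivable F x 1) -> continuous F.
Proof.
by move=> dF x; apply: differentiable_continuous; apply/derivable1_diffP; exact: dF.
Qed.

Lemma continuous_mul F g : continuous F -> continuous g -> continuous (fun x => F x * g x).
Proof. by move=> cF cg x; apply: continuousM; [exact: cF|exact: cg]. Qed.

Lemma continuous_inv F : continuous F -> (forall x, F x != 0) -> continuous (fun x => (F x)^-1).
Proof. by move=> cF F0 x; apply: continuousV => //; exact: cF. Qed.

Lemma FTC_itv F f a b : a <= b -> (forall x, is_derive x (1:R) F (f x)) -> continuous f ->
  Rintegral mu `[a, b] f = F b - F a.
Proof.
move=> ab dF cf; move: ab; rewrite le_eqVlt => /predU1P[->|ab].
  by rewrite set_itv1 Rintegral_set1 subrr.
rewrite /Rintegral (@continuous_FTC2 _ _ F)//.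
- by apply: continuous_subspaceT.
- have cF x : {for x, continuous F}.
    exact: is_derive_continuous (dF x).
  split.
  + by move=> x _; exact: ex_derive.
  + by apply: cvg_at_right_filter; exact: cF.
  + by apply: cvg_at_left_filter; exact: cF.
- by move=> x _; rewrite derive1E; exact: derive_val.
Qed.

(** Only the limits of the primitive along the integers are required: Int f is
    already known to be the limit of the integrals over [-n, n]. *)
Lemma FTC_T F f lp lm : (forall x, is_derive x (1:R) F (f x)) -> continuous f -> itg f ->
  F n%:R @[n --> \oo] --> lp -> F (- n%:R) @[n --> \oo] --> lm -> Int f = lp - lm.
Proof.
move=> dF cf fi cp cm.
have h1 := Int_itv_cvg fi.
have h2 : Int (fun x => f x * \1_(`[- (n%:R : R), n%:R]%classic) x) @[n --> \oo] --> lp - lm.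
  rewrite (_ : (fun n => _) = (fun n => F n%:R - F (- n%:R))); first exact: cvgB.
  apply/funext => n; rewrite -Rintegral_Int (FTC_itv _ dF)//.
  by rewrite (@le_trans _ _ 0)// oppr_le0.
by rewrite -(cvg_lim _ h1)//; exact: cvg_lim h2.
Qed.

(** A nonnegative function with a bounded primitive is integrable, by Fatou's
    lemma on the intervals [-n, n]. *)
Lemma FTC_ge0 F f B : (forall x, is_derive x (1:R) F (f x)) -> continuous f -> (forall x, 0 <= f x) ->
  (forall x, `|F x| <= B) -> itg f.
Proof.
move=> dF cf f0 FB.
have mf : mfun f by exact: continuous_measurable_fun.
apply: (proj1 (fatou_Int (fn := fun n x => f x * \1_(`[- (n%:R : R), n%:R]%classic) x) (f := f) (C := B + B) _ _ _ _ _ _)) => //.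
- move=> n; apply/(itg_indic_on f) => //.
  by apply: continuous_compact_integrable; [exact: segment_compact|exact: continuous_subspaceT].
- by move=> n x; rewrite mulr_ge0// indicE.
- move=> n; rewrite -Rintegral_Int (FTC_itv _ dF)//; last by rewrite (@le_trans _ _ 0)// oppr_le0.
  by rewrite (le_trans (ler_norm _))// (le_trans (ler_normB _ _))// lerD.
- by apply: (aeW mu) => x; exact: itvT_cvg.
Qed.

Lemma pushN_Int f : mfun f -> (forall x, 0 <= f x) -> (\int[mu]_x (f (- x))%:E = \int[mu]_x (f x)%:E)%E.
Proof.
move=> mf f0.
have -> : (\int[mu]_x (f x)%:E)%E = (\int[pushforward mu (-%R : _ -> measurableTypeR R)]_x (f x)%:E)%E.
  by apply: eq_measure_integral => A mA _; exact/esym/lebesgue_measureN.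
rewrite ge0_integral_pushforward//.
- exact/measurable_EFinP.
- by move=> x _; rewrite lee_fin.
Qed.

Lemma itg_opp f : itg f -> itg (fun x => f (- x)).
Proof.
move=> fi; apply/integrableP; split.
  by apply/measurable_EFinP; apply: (measurableT_comp (itg_m fi)).
have := pushN_Int (itg_m (itg_norm fi)) (fun x => normr_ge0 _) => /= ->.
exact: (itg_lty (itg_norm fi)).
Qed.

Lemma Int_opp f : itg f -> Int (fun x => f (- x)) = Int f.
Proof.
move=> fi.
have E x : f x = Num.max (f x) 0 - Num.max (- f x) 0.
  by rewrite /Num.max; case: ltP => ?; case: ltP => ?; lra.
have mp : itg (fun x => Num.max (f x) 0).
  apply: itg_le (itg_norm fi) _; first by apply: measurable_maxr => //; exact: itg_m.
  by move=> x; rewrite /Num.max; case: ltP => ?; rewrite ?normr0.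
have mn : itg (fun x => Num.max (- f x) 0).
  apply: itg_le (itg_norm fi) _; first by apply: measurable_maxr => //; apply: itg_m; exact: itgN.
  by move=> x; rewrite /Num.max; case: ltP => ?; rewrite ?normr0 ?normrN.
have P g : itg g -> (forall x, 0 <= g x) -> Int (fun x => g (- x)) = Int g.
  by move=> gi g0; rewrite /Int /Rintegral pushN_Int//; exact: itg_m.
rewrite (eq_Int E) (eq_Int (fun x => E (- x))) !IntB//; [|exact: itg_opp mp|exact: itg_opp mn].
by rewrite (P _ mp) ?(P _ mn)// => x; rewrite le_max lexx orbT.
Qed.

End FTC.

(** The substitution x = rho e^y for arbitrary integrable functions.  The measure
    nu below is the image of rho e^y dy; it agrees with Lebesgue measure on
    half-open intervals of the half-line, hence on all measurable sets, and a layer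
    cake decomposition passes from sets to nonnegative functions. *)
Section ExpSubstitution.
Context {R : realType}.
Local Notation mu := (@lebesgue_measure R).
Context (rho : R) (rho0 : 0 < rho).

Let phi (y : R) : R := rho * expR y.

Let mphi : mfun phi.
Proof. by apply: measurable_funM => //; exact: measurable_expR. Qed.

Let phi_gt0 y : 0 < phi y.
Proof. by rewrite mulr_gt0 ?expR_gt0. Qed.

Let cphi : continuous phi.
Proof. by move=> x; apply: continuousM; [exact: cst_continuous|exact: continuous_expR]. Qed.

Let nu (A : set (measurableTypeR R)) : \bar R := (\int[mu]_(y in phi @^-1` A) (phi y)%:E)%E.

Let mpre (A : set (measurableTypeR R)) : measurable A -> measurable (phi @^-1` A).
Proof. by move=> mA; rewrite -[X in measurable X]setTI; exact: mphi. Qed.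

Let nu0 : nu set0 = 0%E.
Proof. by rewrite /nu preimage_set0 integral_set0. Qed.
Let nu_ge0 A : (0 <= nu A)%E.
Proof. by apply: integral_ge0 => y _; rewrite lee_fin ltW. Qed.
Let nu_sigma_additive : semi_sigma_additive nu.
Proof.
move=> F mF tF mUF; rewrite /nu preimage_bigcup.
rewrite ge0_integral_bigcup//.
- by apply: is_cvg_ereal_nneg_natsum_cond => n _ _; exact: nu_ge0.
- by move=> n; exact: mpre.
- by apply/measurable_EFinP/measurable_funTS; exact: mphi.
- by move=> x _; rewrite lee_fin ltW.
- apply/trivIsetP => i j _ _ ij; rewrite -preimage_setI.
  by move/trivIsetP : tF => /(_ i j I I ij) ->; rewrite preimage_set0.
Qed.
HB.instance Definition _ := isMeasure.Build _ _ _ nu nu0 nu_ge0 nu_sigma_additive.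

Let nu_ray c : (\int[mu]_(y in `]-oo, c]) (phi y)%:E = (rho * expR c)%:E)%E.
Proof.
rewrite -[c]opprK ge0_integration_by_substitutionNy; last 2 first.
- by apply: continuous_subspaceT.
- by move=> x _; exact: ltW.
have dF (x : R) : is_derive x (1 : R) (fun x => - (rho * expR (- x))) (phi (- x)).
  by apply: is_derive_eq; rewrite /phi /GRing.scale/=; ring.
rewrite (@ge0_continuous_FTC2y _ _ (fun x => - (rho * expR (- x))) _ 0).
- by rewrite opprK sub0e EFinN oppeK.
- by move=> x _; apply: ltW; exact: phi_gt0.
- apply: continuous_subspaceT => x; apply: continuous_comp; [exact: opp_continuous|exact: cphi].
- rewrite -oppr0; apply: cvgN; rewrite -[X in _ --> X](mulr0 rho); apply: cvgMr.
  exact: cvgr_expR.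
- by move=> x _; exact: ex_derive.
- by apply: cvg_at_right_filter; exact: is_derive_continuous (dF _).
- by move=> x _; rewrite derive1E derive_val.
Qed.

Let nu_itv (a b : R) : a <= b -> nu `]a, b] = (Num.max b 0 - Num.max a 0)%:E.
Proof.
move=> ab; rewrite /nu.
have [b0|b0] := leP b 0.
  have -> : phi @^-1` `]a, b] = set0.
    rewrite -subset0 => y /=; rewrite in_itv/= => /andP[_ h].
    by have := lt_le_trans (phi_gt0 y) (le_trans h b0); rewrite ltxx.
  rewrite integral_set0 [Num.max a 0]max_r ?subrr//; exact: le_trans ab b0.
have phile y c : 0 < c -> (phi y <= c) = (y <= ln (c / rho)).
  move=> c0; rewrite /phi mulrC -ler_pdivlMr// -[X in _ <= X](@lnK _ (c / rho)) ?ler_expR//.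
  by rewrite posrE divr_gt0.
have rhoE c : 0 < c -> rho * expR (ln (c / rho)) = c.
  by move=> c0; rewrite lnK ?posrE ?divr_gt0// mulrC divfK// gt_eqF.
have [a0|a0] := leP a 0.
  have -> : phi @^-1` `]a, b] = `]-oo, ln (b / rho)]%classic.
    apply/seteqP; split=> y /=; rewrite !in_itv/= phile//; first by move=> /andP[].
    by move=> ->; rewrite andbT (le_lt_trans a0).
  by rewrite nu_ray rhoE// subr0.
have lab : ln (a / rho) <= ln (b / rho).
  by rewrite ler_ln ?posrE ?divr_gt0// ler_pM2r// invr_gt0.
have -> : phi @^-1` `]a, b] = `]ln (a / rho), ln (b / rho)]%classic.
  by apply/seteqP; split=> y /=; rewrite !in_itv/= phile// !ltNge phile.
have : (\int[mu]_(y in `]-oo, (ln (b / rho))%R]) (phi y)%:E =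
  \int[mu]_(y in `]-oo, (ln (a / rho))%R]) (phi y)%:E + \int[mu]_(y in `](ln (a / rho))%R, (ln (b / rho))%R]) (phi y)%:E)%E.
  rewrite -ge0_integral_setU//.
  - by rewrite -itv_bndbnd_setU// bnd_simp.
  - by apply/measurable_EFinP/measurable_funTS; exact: mphi.
  - by move=> x _; rewrite lee_fin ltW.
  - apply/disj_setPLR => x /=; rewrite !in_itv/= => xa /andP[+ _].
    by rewrite ltNge xa.
rewrite !nu_ray !rhoE// EFinB => ->.
by rewrite addeAC subee// add0e.
Qed.

Let nuE (A : set R) : measurable A -> nu A = mu (A `&` `]0, +oo[).
Proof.
move=> mA.
(* The uniqueness theorem speaks of measures on the whole line: nu is
   completed by Lebesgue measure on the half-line x <= 0. *)
pose D : set (measurableTypeR R) := `]-oo, 0]%classic.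
have mD : measurable D by exact: measurable_itv.
have E (X : set R) : measurable X -> mu X = (mu (X `&` D) + nu X)%E.
  have AE Y : measure_add (mrestr mu mD) nu Y = (mu (Y `&` D) + nu Y)%E by rewrite measure_addE.
  move=> mX; rewrite -AE.
  apply: lebesgue_measure_unique => //.
  move=> _ [[a b]] _ <-; apply: etrans (esym (AE _)).
  have [ab|ba] := leP a b; last first.
    rewrite set_itv_ge; last by rewrite bnd_simp -leNgt ltW.
    by rewrite set0I !measure0 add0e.
  rewrite nu_itv// lebesgue_measure_itv/= lte_fin.
  have -> : `]a, b]%classic `&` D = `]a, Num.min b 0]%classic.
    apply/seteqP; split=> x /=; rewrite /D /= !in_itv/= le_min.
      by move=> [/andP[-> ->] ->].
    by move=> /andP[-> /andP[-> ->]].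
  rewrite lebesgue_measure_itv/= lte_fin.
  have [b0|] := boolP (b <= 0).
    rewrite min_l// (max_r b0) (max_r (le_trans ab b0)) subrr adde0.
    move: ab; rewrite le_eqVlt => /predU1P[->|->//].
    by rewrite ltxx.
  rewrite -ltNge => b0; have [a0|] := boolP (a < 0).
    by rewrite (lt_trans a0 b0) (min_r (ltW b0)) a0 (max_l (ltW b0)) (max_r (ltW a0)) subr0 -EFinD; congr EFin; lra.
  rewrite -leNgt => a0; rewrite (min_r (ltW b0)) (ltNge a 0) a0/= (max_l (ltW b0)) (max_l a0) add0e.
  by move: ab; rewrite le_eqVlt => /predU1P[->|->//]; rewrite ltxx subrr.
have := E (A `&` `]0, +oo[) (measurableI _ _ mA (measurable_itv _)).
have -> : A `&` `]0, +oo[ `&` D = set0.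
  by rewrite -subset0 => x [[_ /=]]; rewrite /D/= !in_itv/= andbT leNgt => ->.
rewrite measure0 add0e => ->.
rewrite /nu; congr (integral _ _ _).
apply/seteqP; split => y /=; last by case.
by move=> ?; split => //; rewrite in_itv/= andbT.
Qed.

Lemma ge0_integral_expR (F : R -> R) : mfun F -> (forall x, 0 <= F x) ->
  (\int[mu]_x (F x * \1_(`]0%R, +oo[%classic) x)%:E =
   \int[mu]_y (F (rho * expR y) * (rho * expR y))%:E)%E.
Proof.
move=> mF F0.
(* Layer cake: F x is the measure of [0, F x), so both sides are double
   integrals whose inner integrals are nu and Lebesgue measure of
   {x | s < F x}. *)
have layer (c : R) : 0 <= c -> c%:E = (\int[mu]_s (\1_(`[0%R, c[%classic : set R) s)%:E)%E.
  move=> c0; rewrite integral_indic// setIT. rewrite [RHS]lebesgue_measure_itv/= lte_fin.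
  by move: c0; rewrite le_eqVlt => /predU1P[<-|->]; rewrite ?ltxx ?sube0.
have mIF d (T : measurableType d) (g : T -> R) : measurable_fun setT g -> 
   measurable_fun [set: T * R] (fun p => \1_(`[0%R, g p.1[%classic : set R) p.2 : R).
  move=> mg.
  rewrite (_ : (fun p => _) = (fun p : T * R => ((0 <= p.2) && (p.2 < g p.1))%:R)); last first.
    by apply/funext => p; rewrite indicE mem_setE in_itv.
  apply: (measurableT_comp (f := fun b : bool => b%:R : R)) => //.
  apply: measurable_and; first by apply: measurable_fun_ler => //; exact: measurable_snd.
  apply: measurable_fun_ltr; first exact: measurable_snd.
  by apply: (measurableT_comp mg); exact: measurable_fst.
have mFphi : mfun (F \o phi) by exact: measurableT_comp.
transitivity (\int[mu]_s \int[mu]_x (\1_(`[0%R, F x[%classic : set R) s * \1_(`]0%R, +oo[%classic : set R) x)%:E)%E.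
  transitivity (\int[mu]_x \int[mu]_s (\1_(`[0%R, F x[%classic : set R) s * \1_(`]0%R, +oo[%classic : set R) x)%:E)%E.
    apply: eq_integral => x _; rewrite EFinM (layer _ (F0 x)).
    rewrite -ge0_integralZr//.
    - by apply/measurable_EFinP; exact: mfun_indic.
  apply: Tonelli; last by move=> x s; rewrite mulr_ge0// indicE.
  apply: measurable_funM; first exact: mIF.
  by apply: mfun2_fst; exact: mfun_indic.
transitivity (\int[mu]_s \int[mu]_y (\1_(`[0%R, F (phi y)[%classic : set R) s * phi y)%:E)%E.
  apply: eq_integral => s _.
  pose A := [set x | 0 <= s < F x].
  have mA : measurable A.
    have [s0|s0] := boolP (0 <= s); last first.
      by rewrite (_ : A = set0)// -subset0 => x; rewrite /A/= (negbTE s0).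
    rewrite (_ : A = F @^-1` `]s, +oo[).
      by rewrite -[X in measurable X]setTI; apply: mF => //; exact: measurable_itv.
    by apply/seteqP; split=> x; rewrite /A/= s0/= in_itv/= andbT.
  have AE x : \1_(`[0%R, F x[%classic : set R) s = \1_A x :> R.
    by rewrite !indicE /A; congr (nat_of_bool _)%:R; apply/idP/idP; rewrite !inE/= in_itv.
  transitivity (mu (A `&` `]0, +oo[)).
    transitivity (\int[mu]_x (\1_(A `&` `]0%R, +oo[%classic) x)%:E)%E.
      by apply: eq_integral => x _; rewrite AE indicI.
    by rewrite integral_indic ?setIT//; exact: measurableI.
  rewrite -nuE// /nu integral_mkcond; apply: eq_integral => y _.
  rewrite patchE AE indicE; have [yA|yA] := boolP (y \in _).
    by rewrite mem_set ?mul1r//; move: yA; rewrite inE.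
  by rewrite memNset ?mul0r//; move: yA; rewrite notin_setE.
transitivity (\int[mu]_y \int[mu]_s (\1_(`[0%R, F (phi y)[%classic : set R) s * phi y)%:E)%E.
  apply/esym; apply: Tonelli; last by move=> x s; rewrite mulr_ge0 ?indicE// ltW.
  apply: measurable_funM; first exact: (mIF _ _ (F \o phi)).
  exact: mfun2_fst.
apply: eq_integral => y _; rewrite EFinM (layer _ (F0 _)).
rewrite -ge0_integralZr//.
- by apply/measurable_EFinP; exact: mfun_indic.
by rewrite lee_fin; exact: ltW (phi_gt0 y).
Qed.

Lemma itg_expR (F : R -> R) : mfun F ->
  itg (fun x => F x * \1_(`]0%R, +oo[%classic) x) <->
  itg (fun y => F (rho * expR y) * (rho * expR y)).
Proof.
move=> mF; have mnF : mfun (fun x => `|F x|) by exact: measurableT_comp.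
have := ge0_integral_expR mnF (fun x => normr_ge0 _) => E.
split=> fi.
  apply/integrableP; split.
    by apply/measurable_EFinP/measurable_funM => //; apply: (measurableT_comp mF mphi).
  rewrite (_ : (\int[mu]_(x in setT) _)%E = (\int[mu]_y (`|F (rho * expR y)| * (rho * expR y))%:E)%E); last first.
    by apply: eq_integral => y _; rewrite /= normrM (gtr0_norm (phi_gt0 y)).
  rewrite -E; apply: le_lt_trans (itg_lty (itg_norm fi)).
  by rewrite le_eqVlt; apply/orP; left; apply/eqP; apply: eq_integral => x _; rewrite normrM (ger0_norm (ind_ge0 _ _)).
apply/integrableP; split.
  by apply/measurable_EFinP/measurable_funM => //; exact: mfun_indic.
rewrite (_ : (\int[mu]_(x in setT) _)%E = (\int[mu]_x (`|F x| * \1_(`]0%R, +oo[%classic) x)%:E)%E); last first.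
  by apply: eq_integral => x _; rewrite /= normrM (ger0_norm (ind_ge0 _ _)).
rewrite E; apply: le_lt_trans (itg_lty (itg_norm fi)).
by rewrite le_eqVlt; apply/orP; left; apply/eqP; apply: eq_integral => x _; rewrite normrM (gtr0_norm (phi_gt0 _)).
Qed.

Lemma Int_expR (F : R -> R) : itg (fun x => F x * \1_(`]0%R, +oo[%classic) x) -> mfun F ->
  Int (fun x => F x * \1_(`]0%R, +oo[%classic) x) =
  Int (fun y => F (rho * expR y) * (rho * expR y)).
Proof.
move=> fi mF.
have E x : F x = Num.max (F x) 0 - Num.max (- F x) 0.
  by rewrite /Num.max; case: ltP => ?; case: ltP => ?; lra.
pose P x := Num.max (F x) 0; pose N x := Num.max (- F x) 0.
have P0 x : 0 <= P x by rewrite /P le_max lexx orbT.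
have N0 x : 0 <= N x by rewrite /N le_max lexx orbT.
have mP : mfun P by exact: measurable_maxr.
have mN : mfun N by apply: measurable_maxr => //; exact: measurableT_comp.
have i0 x : 0 <= \1_(`]0%R, +oo[%classic : set R) x :> R by rewrite indicE.
have iP : itg (fun x => P x * \1_(`]0%R, +oo[%classic) x).
  apply: itg_le (itg_norm fi) _; first by apply: measurable_funM => //; exact: mfun_indic.
  move=> x; rewrite !normrM ler_wpM2r// /P /Num.max; case: ltP => ?; by rewrite ?normr0.
have iN : itg (fun x => N x * \1_(`]0%R, +oo[%classic) x).
  apply: itg_le (itg_norm fi) _; first by apply: measurable_funM => //; exact: mfun_indic.
  move=> x; rewrite !normrM ler_wpM2r// /N /Num.max; case: ltP => ?; by rewrite ?normr0 ?normrN.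
transitivity (Int (fun x => P x * \1_(`]0%R, +oo[%classic) x - N x * \1_(`]0%R, +oo[%classic) x)).
  by apply: eq_Int => x; rewrite {1}E mulrBl.
transitivity (Int (fun y => P (rho * expR y) * (rho * expR y) - N (rho * expR y) * (rho * expR y))); last first.
  by apply: eq_Int => y; rewrite [in RHS]E mulrBl.
rewrite !IntB//; [|exact/itg_expR|exact/itg_expR].
by rewrite /Int /Rintegral !ge0_integral_expR.
Qed.

(** The substitution has a positive density, so it pulls null sets back to null
    sets. *)
Lemma ae_expR (Q : R -> Prop) : {ae mu, forall x, 0 < x -> Q x} -> {ae mu, forall y, Q (rho * expR y)}.
Proof.
move=> [N [mN N0 h]].
have := @ge0_integral_expR \1_N (mfun_indic mN) _.
have -> : (\int[mu]_x (\1_N x * \1_(`]0%R, +oo[%classic) x)%:E = 0)%E.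
  transitivity (mu (N `&` `]0, +oo[)).
    transitivity (\int[mu]_x (\1_(N `&` `]0%R, +oo[%classic) x)%:E)%E.
      by apply: eq_integral => x _; rewrite indicI.
    by rewrite integral_indic ?setIT//; exact: measurableI.
  by apply: (subset_measure0 (mu := mu)) N0 => //; exact: measurableI.
move=> /(_ (fun x => _))/esym h0.
have /ae_eq_integral_abs : (\int[mu]_y `|(\1_N (rho * expR y) * (rho * expR y))%:E| = 0)%E.
  rewrite -[RHS]h0; last by move=> x; rewrite indicE.
  by apply: eq_integral => y _; rewrite gee0_abs// lee_fin mulr_ge0 ?ind_ge0//; exact: ltW (phi_gt0 y).
move=> H; have {}H := H _ _.
have : ae_eq mu setT (fun y => (\1_N (rho * expR y) * (rho * expR y))%:E) (cst 0%E).
  apply: H => //; apply/measurable_EFinP/measurable_funM => //.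
  exact: (measurableT_comp (mfun_indic mN) mphi).
apply: aeS => y /(_ I) []; rewrite indicE => /eqP; rewrite mulf_eq0 (gt_eqF (phi_gt0 y)) orbF.
have [|yN _] := boolP (_ \in N); first by rewrite /= oner_eq0.
apply: contrapT => nQ; move: yN; rewrite notin_setE; apply; apply: h => /=; apply: contra_not nQ; apply.
exact: phi_gt0.
Qed.
End ExpSubstitution.

(** * Laplace integrals and the Poisson kernel *)
Section Kernels.
Context {R : realType}.
Local Notation mu := (@lebesgue_measure R).
Local Notation Rp := (`]0%R, +oo[%classic : set R).
Implicit Types f g h F : R -> R.

Lemma cvg_nat_pinfty : (n%:R : R) @[n --> \oo] --> +oo.
Proof. exact: cvgr_idn. Qed.

Lemma Rp_pos (x : R) : 0 < x -> \1_Rp x = 1 :> R.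
Proof. by move=> x0; rewrite indicE mem_set//= in_itv/= x0. Qed.

Lemma Rp_neg (x : R) : x <= 0 -> \1_Rp x = 0 :> R.
Proof. by move=> x0; rewrite indicE mem_setE in_itv/= andbT ltNge x0. Qed.

Lemma ind_itv0n (x : R) : \1_(`]0%R, n%:R]%classic : set R) x @[n --> \oo] --> (\1_Rp x : R).
Proof.
apply: cvg_near_cst; near=> n; rewrite !indicE; congr (nat_of_bool _)%:R.
apply/idP/idP; rewrite !inE/= !in_itv/= andbT; first by case/andP.
move=> x0; rewrite x0/= (le_trans (ler_norm _))//; near: n; exact: nbhs_infty_ger.
Unshelve. all: by end_near. Qed.

Lemma FTC_itvoc F f a b : a <= b -> (forall x, is_derive x (1:R) F (f x)) -> continuous f ->
  Rintegral mu `]a, b] f = F b - F a.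
Proof.
move=> ab dF cf; rewrite Rintegral_itv_obnd_cbnd ?(FTC_itv ab dF)//.
apply: (@integrableS _ _ _ mu `[a, b]%classic) => //; first exact: subset_itv_oc_cc.
by apply: continuous_compact_integrable; [exact: segment_compact|exact: continuous_subspaceT].
Qed.

Lemma FTC_Rp F f lp : (forall x, is_derive x (1:R) F (f x)) -> continuous f -> itg (fun x => f x * \1_Rp x) ->
  F n%:R @[n --> \oo] --> lp -> Int (fun x => f x * \1_Rp x) = lp - F 0.
Proof.
move=> dF cf fi cp.
have mf : mfun f by exact: continuous_measurable_fun.
have h1 : Int (fun x => f x * \1_(`]0%R, n%:R]%classic : set R) x) @[n --> \oo] --> Int (fun x => f x * \1_Rp x).
  apply: (dct (g := fun x => `|f x * \1_Rp x|)).
  - by move=> n; apply: measurable_funM => //; exact: mfun_indic.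
  - by apply: measurable_funM => //; exact: mfun_indic.
  - exact: itg_norm.
  - move=> n x; rewrite !normrM ler_wpM2l// !ger0_norm ?ind_ge0// !indicE ler_nat.
    by case: (boolP (x \in _)) => //; rewrite inE/= in_itv/= => /andP[x0 _]; rewrite mem_set//= in_itv/= x0.
  - by apply: (aeW mu) => x; apply: cvgM; [exact: cvg_cst|exact: ind_itv0n].
have h2 : Int (fun x => f x * \1_(`]0%R, n%:R]%classic : set R) x) @[n --> \oo] --> lp - F 0.
  rewrite (_ : (fun n => _) = (fun n => F n%:R - F 0)); first exact: cvgB cp (cvg_cst _).
  by apply/funext => n; rewrite -Rintegral_Int (FTC_itvoc _ dF).
by rewrite -(cvg_lim _ h1)//; exact: cvg_lim h2.
Qed.

Lemma FTC_Rp_ge0 F f B : (forall x, is_derive x (1:R) F (f x)) -> continuous f -> (forall x, 0 <= f x) ->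
  (forall x, 0 <= x -> F x - F 0 <= B) -> itg (fun x => f x * \1_Rp x).
Proof.
move=> dF cf f0 FB.
have mf : mfun f by exact: continuous_measurable_fun.
apply: (proj1 (fatou_Int (fn := fun n x => f x * \1_(`]0%R, n%:R]%classic : set R) x) (C := B) _ _ _ _ _ _)) => //.
- move=> n; apply/(itg_indic_on f) => //.
  apply: (@integrableS _ _ _ mu `[0, n%:R]%classic) => //; first exact: subset_itv_oc_cc.
  by apply: continuous_compact_integrable; [exact: segment_compact|exact: continuous_subspaceT].
- by apply: measurable_funM => //; exact: mfun_indic.
- by move=> n x; rewrite mulr_ge0// ind_ge0.
- by move=> x; rewrite mulr_ge0// ind_ge0.
- by move=> n; rewrite -Rintegral_Int (FTC_itvoc _ dF)// FB.
- by apply: (aeW mu) => x; apply: cvgM; [exact: cvg_cst|exact: ind_itv0n].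
Qed.

Lemma Rp_sym (x : R) : x != 0 -> \1_Rp x + \1_Rp (- x) = 1 :> R.
Proof.
rewrite neq_lt => /orP[x0|x0].
  by rewrite Rp_neg ?(ltW x0)// Rp_pos ?add0r// oppr_gt0.
by rewrite Rp_pos// Rp_neg ?addr0// oppr_le0 ltW.
Qed.

Lemma itg_halves f : mfun f -> itg (fun x => f x * \1_Rp x) -> itg (fun x => f (- x) * \1_Rp x) -> itg f.
Proof.
move=> mf ip im; have im' := itg_opp im.
have : itg (fun x => f x * \1_Rp x + f (- - x) * \1_Rp (- x)) by exact: itgD.
apply: ae_eq_itg => //.
  by apply: itg_m; exact: itgD.
by apply: aeS (ae_neq 0) => x x0; rewrite opprK -mulrDr Rp_sym// mulr1.
Qed.

Lemma Int_halves f : itg f -> Int f = Int (fun x => f x * \1_Rp x) + Int (fun x => f (- x) * \1_Rp x).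
Proof.
move=> fi.
have ip : itg (fun x => f x * \1_Rp x) by exact: itg_indicM.
have im : itg (fun x => f (- x) * \1_Rp x) by apply: itg_indicM => //; exact: itg_opp.
have im' := itg_opp im; rewrite -(Int_opp im) -IntD//.
apply: ae_eq_Int; first exact: itg_m.
  by apply: itg_m; exact: itgD.
by apply: aeS (ae_neq 0) => x x0; rewrite opprK -mulrDr Rp_sym// mulr1.
Qed.

Lemma cvg_affine_pinfty (e b : R) : 0 < e -> e * n%:R + b @[n --> \oo] --> +oo.
Proof.
move=> e0; apply/cvgryPge => A; near=> n; rewrite -lerBlDr -ler_pdivrMl//.
by near: n; exact: nbhs_infty_ger.
Unshelve. all: by end_near. Qed.

Lemma cvg_expRN (e : R) : 0 < e -> expR (- (e * n%:R)) @[n --> \oo] --> (0 : R).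
Proof.
move=> e0; have h := cvg_affine_pinfty 0 e0.
rewrite (_ : (fun n => _) = (fun x => expR (- x)) \o (fun n => e * n%:R + 0)); last by apply/funext => n /=; rewrite addr0.
exact: (cvg_comp _ _ h (@cvgr_expR R)).
Qed.

Lemma itg_laplace_half (e : R) : 0 < e -> itg (fun y => expR (- (e * y)) * \1_Rp y).
Proof.
move=> e0; apply: (FTC_Rp_ge0 (F := fun y => - expR (- (e * y)) / e) (B := e^-1)).
- move=> x; apply: is_derive_eq; rewrite /GRing.scale/=; field; exact: lt0r_neq0.
- by move=> x; apply: (@is_derive_continuous _ (fun y => expR (- (e * y))) x); exact: ex_derive.
- by move=> x; exact: expR_ge0.
- move=> x x0; rewrite mulr0 oppr0 expR0 !mulNr opprK mul1r gerDr oppr_le0 divr_ge0 ?expR_ge0//.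
  exact: ltW.
Qed.

(** The primitive is the real part of e^((ia - e) y + ig) / (ia - e). *)
Lemma laplace_cos (e a g : R) : 0 < e ->
  itg (fun y => expR (- (e * y)) * cos (a * y + g) * \1_Rp y) /\
  Int (fun y => expR (- (e * y)) * cos (a * y + g) * \1_Rp y) = (e * cos g - a * sin g) / (e ^+ 2 + a ^+ 2).
Proof.
move=> e0.
have d0 : e ^+ 2 + a ^+ 2 != 0 by rewrite gt_eqF// ltr_pwDl ?exprn_gt0 ?sqr_ge0.
have ih : itg (fun y => expR (- (e * y)) * cos (a * y + g) * \1_Rp y).
  apply: itg_le (itg_laplace_half e0) _.
    apply: measurable_funM; last exact: mfun_indic.
    apply: measurable_funM; first by apply: mfun_exp; apply: measurableT_comp => //; apply: measurable_funM.
    by apply: mfun_cos; apply: measurable_funD => //; exact: measurable_funM.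
  move=> y; rewrite !normrM (ger0_norm (expR_ge0 _)) (ger0_norm (ind_ge0 _ _)) ler_wpM2r ?ind_ge0//.
  by rewrite ler_piMr ?expR_ge0// cos_max.
split => //.
pose F y := expR (- (e * y)) * (a * sin (a * y + g) - e * cos (a * y + g)) / (e ^+ 2 + a ^+ 2).
have dF (x : R) : is_derive x (1 : R) F (expR (- (e * x)) * cos (a * x + g)).
  by apply: is_derive_eq; rewrite /GRing.scale/=; field.
rewrite (FTC_Rp (lp := 0) dF _ ih).
- by rewrite /F !mulr0 oppr0 expR0 !add0r mul1r -mulNr opprB.
- by move=> x; apply: (@is_derive_continuous _ (fun y => expR (- (e * y)) * cos (a * y + g)) x); exact: ex_derive.
- rewrite /F; apply: (@squeeze_cvgr _ _ _ _ (fun n => - (expR (- (e * n%:R)) * ((`|a| + e) / (e ^+ 2 + a ^+ 2)))) (fun n => expR (- (e * n%:R)) * ((`|a| + e) / (e ^+ 2 + a ^+ 2)))).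
  + apply: nearW => n; rewrite -ler_norml -mulrA !normrM (ger0_norm (expR_ge0 _)) ler_wpM2l ?expR_ge0//.
    rewrite normrV ?unitfE// (@ger0_norm _ (_ + a ^+ 2)) ?addr_ge0 ?sqr_ge0//.
    rewrite ler_wpM2r ?invr_ge0 ?addr_ge0 ?sqr_ge0// (le_trans (ler_normB _ _))// lerD// normrM.
      by rewrite ler_piMr// sin_max.
    by rewrite (gtr0_norm e0) ler_piMr ?(ltW e0)// cos_max.
  + rewrite -oppr0 -(mul0r ((`|a| + e) / (e ^+ 2 + a ^+ 2))); apply: cvgN; apply: cvgMl; exact: cvg_expRN.
  + rewrite -(mul0r ((`|a| + e) / (e ^+ 2 + a ^+ 2))); apply: cvgMl; exact: cvg_expRN.
Qed.

(** Up to the factor 2 cos g, the Fourier transform of e^(-e|y|) is the Poisson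
    kernel.  The phase g enters only through cos g, because the sine part is odd. *)
Lemma laplace_cosT (e a g : R) : 0 < e ->
  itg (fun y => expR (- (e * `|y|)) * cos (a * y + g)) /\
  Int (fun y => expR (- (e * `|y|)) * cos (a * y + g)) = 2 * e * cos g / (e ^+ 2 + a ^+ 2).
Proof.
move=> e0.
have d0 : e ^+ 2 + a ^+ 2 != 0 by rewrite gt_eqF// ltr_pwDl ?exprn_gt0 ?sqr_ge0.
have mf : mfun (fun y => expR (- (e * `|y|)) * cos (a * y + g)).
  apply: measurable_funM; first by apply: mfun_exp; apply: measurableT_comp => //; apply: measurable_funM.
  by apply: mfun_cos; apply: measurable_funD => //; exact: measurable_funM.
have E (s : R) y : `|s| = 1 -> expR (- (e * `|s * y|)) * cos (a * (s * y) + g) * \1_Rp y =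
    expR (- (e * y)) * cos (a * s * y + g) * \1_Rp y.
  move=> s1; rewrite indicE; have [|_] := boolP (y \in _); last by rewrite !mulr0.
  by rewrite inE/= in_itv/= andbT => y0; rewrite normrM s1 mul1r gtr0_norm// mulrA.
have E1 y : expR (- (e * `|y|)) * cos (a * y + g) * \1_Rp y = expR (- (e * y)) * cos (a * y + g) * \1_Rp y.
  by have := E 1 y (normr1 _); rewrite mul1r mulr1.
have E2 y : expR (- (e * `|- y|)) * cos (a * - y + g) * \1_Rp y = expR (- (e * y)) * cos ((- a) * y + g) * \1_Rp y.
  by have := E (-1) y (normrN1 _); rewrite mulN1r mulrN1.
have [i1 I1] := laplace_cos a g e0; have [i2 I2] := laplace_cos (- a) g e0.
have ih : itg (fun y => expR (- (e * `|y|)) * cos (a * y + g)).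
  by apply: itg_halves mf _ _; [exact: (eq_itg (fun y => esym (E1 y)) i1)|exact: (eq_itg (fun y => esym (E2 y)) i2)].
split => //; rewrite Int_halves// (eq_Int E1) (eq_Int E2) I1 I2; by field.
Qed.

Lemma itg_laplace (e : R) : 0 < e -> itg (fun y => expR (- (e * `|y|))).
Proof.
by move=> e0; apply: eq_itg (laplace_cosT 0 0 e0).1 => y; rewrite mul0r addr0 cos0 mulr1.
Qed.

Lemma cvg_atan_pinfty (u : nat -> R) : u n @[n --> \oo] --> +oo -> atan (u n) @[n --> \oo] --> pi / 2.
Proof. by move=> h; exact: (cvg_comp _ _ h (@cvgy_atan R)). Qed.

(** The Poisson kernel of the upper half-plane without its factor 1 / pi. *)
Definition poisson (e x : R) : R := e / (e ^+ 2 + x ^+ 2).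

Lemma poisson_ge0 (e x : R) : 0 < e -> 0 <= poisson e x.
Proof. by move=> e0; rewrite divr_ge0 ?addr_ge0 ?sqr_ge0// ltW. Qed.

Lemma is_derive_atan_div (e b x : R) : 0 < e ->
  is_derive x (1 : R) (fun y => atan ((y - b) / e)) (poisson e (x - b)).
Proof.
move=> e0; have e1 : e != 0 by rewrite gt_eqF.
apply: is_derive_eq; rewrite /GRing.scale/= /poisson.
have d0 : e ^+ 2 + (x - b) ^+ 2 != 0 by rewrite gt_eqF// ltr_pwDl ?exprn_gt0 ?sqr_ge0.
by field; rewrite e1 d0.
Qed.

(** The primitive is atan ((x - b) / e). *)
Lemma poisson_int (e b : R) : 0 < e -> itg (fun x => poisson e (x - b)) /\ Int (fun x => poisson e (x - b)) = pi.
Proof.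
move=> e0.
have c : continuous (fun x => poisson e (x - b)).
  apply: (continuous_mul (F := fun=> e)); first by move=> ?; exact: cst_continuous.
  apply: continuous_inv => [|y]; first by apply: derivable_continuous => y; exact: ex_derive.
  by rewrite gt_eqF// ltr_pwDl ?exprn_gt0 ?sqr_ge0.
have ip : itg (fun x => poisson e (x - b)).
  apply: (FTC_ge0 (F := fun y => atan ((y - b) / e)) (B := pi)) => //.
  - by move=> x; exact: is_derive_atan_div.
  - by move=> x; exact: poisson_ge0.
  - move=> x; have := atan_gtNpi2 ((x - b) / e); have := atan_ltpi2 ((x - b) / e).
    by rewrite ler_norml; have := pi_gt0 R => *; lra.
split => //.
rewrite (@FTC_T _ (fun y => atan ((y - b) / e)) (fun x => poisson e (x - b)) (pi / 2) (- (pi / 2)) (fun x => is_derive_atan_div b x e0))//.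
- by rewrite opprK -splitr.
- apply: cvg_atan_pinfty; rewrite (_ : (fun n => _) = (fun n => e^-1 * n%:R + (- b / e))).
    by apply: cvg_affine_pinfty; rewrite invr_gt0.
  by apply/funext => n; field; rewrite gt_eqF.
- rewrite (_ : (fun n => _) = (fun n : nat => - atan (e^-1 * n%:R + b / e))).
    by apply: cvgN; apply: cvg_atan_pinfty; apply: cvg_affine_pinfty; rewrite invr_gt0.
  by apply/funext => n; rewrite -atanN; congr atan; field; rewrite gt_eqF.
Qed.

End Kernels.

(** * Fourier transform of the hyperbolic secant *)
Section SechTransform.
Context {R : realType}.
Local Notation mu := (@lebesgue_measure R).
Implicit Types t y a b : R.

(** csum y = 2 cosh (y / 2) and cdif y = 2 sinh (y / 2).  For z = y + i t,
    2 cosh (z / 2) = cX t y + i cY t y, and cN t y is its squared modulus. *)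
Definition csum y : R := expR (y / 2) + expR (- (y / 2)).
Definition cdif y : R := expR (y / 2) - expR (- (y / 2)).
Definition cX t y := csum y * cos (t / 2).
Definition cY t y := cdif y * sin (t / 2).
Definition cN t y := cX t y ^+ 2 + cY t y ^+ 2.

Lemma csum_gt0 y : 0 < csum y.
Proof. by rewrite addr_gt0 ?expR_gt0. Qed.

Lemma csum2 y : csum y ^+ 2 = cdif y ^+ 2 + 4.
Proof.
have := expRxMexpNx_1 (y / 2); rewrite /csum /cdif.
set p := expR _; set q := expR _ => pq.
have -> : (p + q) ^+ 2 = (p - q) ^+ 2 + 4 * (p * q) by ring.
by rewrite pq mulr1.
Qed.

Lemma abs_cdif y : `|cdif y| <= csum y.
Proof.
rewrite /cdif /csum ler_norml; have := expR_gt0 (y / 2); have := expR_gt0 (- (y / 2)) => *.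
by apply/andP; split; lra.
Qed.

Lemma csumV y : (csum y)^-1 <= expR (- (2^-1 * `|y|)).
Proof.
rewrite -[leRHS]invrK -expRN opprK lef_pV2 ?posrE ?csum_gt0 ?expR_gt0//.
rewrite /csum; have := expR_gt0 (y / 2); have := expR_gt0 (- (y / 2)).
have [y0|y0] := leP 0 y; rewrite [2^-1 * _]mulrC.
  by rewrite (ger0_norm y0) => *; lra.
by rewrite (ltr0_norm y0) mulNr => *; lra.
Qed.

Lemma mfun_csum : mfun csum.
Proof. by apply: measurable_funD; apply: mfun_exp => //; [|apply: measurableT_comp => //]; exact: measurable_funM. Qed.

Lemma itg_csumV : itg (fun y => (csum y)^-1).
Proof.
apply: itg_le (itg_laplace (_ : 0 < 2^-1)) _ => //.
  by apply: mfunV; exact: mfun_csum.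
by move=> y; rewrite ger0_norm ?invr_ge0 ?(ltW (csum_gt0 _))// csumV.
Qed.

(** This lower bound makes 1 / (2 cosh (z / 2)) and its derivatives decay like
    e^(-|y|/2), uniformly for t in compact subsets of (-pi, pi). *)
Lemma cN_ge t y : cos (t / 2) ^+ 2 * csum y ^+ 2 <= cN t y.
Proof. by rewrite /cN /cX exprMn mulrC lerDl sqr_ge0. Qed.

Lemma cN_E t y : cN t y = cdif y ^+ 2 + 4 * cos (t / 2) ^+ 2.
Proof. by rewrite /cN /cX /cY !exprMn csum2 sin2cos2; ring. Qed.

Lemma cos_half_gt0 t : - pi < t < pi -> 0 < cos (t / 2).
Proof.
move=> /andP[t1 t2]; apply: cos_gt0_pihalf.
by apply/andP; split; lra.
Qed.

Lemma cN_gt0 t y : - pi < t < pi -> 0 < cN t y.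
Proof.
move=> tpi; apply: lt_le_trans (cN_ge t y).
by rewrite mulr_gt0 ?exprn_gt0 ?csum_gt0 ?cos_half_gt0.
Qed.

(** cRe and cIm are the real and imaginary parts of the holomorphic function
    exp (i (tau z + b)) / (2 cosh (z / 2)), z = y + i t, in the strip |t| < pi;
    cE1 and cE2 are those of its numerator.  cD is the t-derivative of cRe, in the
    form produced by the quotient rule. *)
Definition cE1 tau b t y := expR (- (tau * t)) * cos (tau * y + b).
Definition cE2 tau b t y := expR (- (tau * t)) * sin (tau * y + b).
Definition cRe tau b t y := (cE1 tau b t y * cX t y + cE2 tau b t y * cY t y) / cN t y.
Definition cIm tau b t y := (cE2 tau b t y * cX t y - cE1 tau b t y * cY t y) / cN t y.
Definition cD tau b t y :=
  let Xy := cdif y / 2 * cos (t / 2) in let Yy := csum y / 2 * sin (t / 2) in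
  ((- tau * (cE1 tau b t y * cX t y + cE2 tau b t y * cY t y) - cE1 tau b t y * Yy + cE2 tau b t y * Xy) * cN t y
  - (cE1 tau b t y * cX t y + cE2 tau b t y * cY t y) * (- (2 * cX t y * Yy) + 2 * cY t y * Xy)) / cN t y ^+ 2.

Lemma is_derive_cRe tau b t y : - pi < t < pi ->
  is_derive t (1 : R) (fun t => cRe tau b t y) (cD tau b t y).
Proof.
move=> tpi; have N0 : cN t y != 0 by rewrite gt_eqF// cN_gt0.
rewrite /cRe.
have dN : is_derive t (1 : R) (fun t => cN t y) (- (2 * cX t y * (csum y / 2 * sin (t / 2))) + 2 * cY t y * (cdif y / 2 * cos (t / 2))).
  by apply: is_derive_eq; rewrite /cX /cY /GRing.scale/=; field.
have dnum : is_derive t (1 : R) (fun t => cE1 tau b t y * cX t y + cE2 tau b t y * cY t y)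
  (- tau * (cE1 tau b t y * cX t y + cE2 tau b t y * cY t y) - cE1 tau b t y * (csum y / 2 * sin (t / 2)) + cE2 tau b t y * (cdif y / 2 * cos (t / 2))).
  by apply: is_derive_eq; rewrite /cE1 /cE2 /cX /cY /GRing.scale/=; field.
have dV := is_deriveV N0.
apply: is_derive_eq; rewrite /cD /GRing.scale/=.
by field.
Qed.

(** With is_derive_cRe, this is the Cauchy-Riemann equation
    d/dt Re = - d/dy Im. *)
Lemma is_derive_cIm tau b t y : - pi < t < pi ->
  is_derive y (1 : R) (fun y => cIm tau b t y) (- cD tau b t y).
Proof.
move=> tpi; have N0 : cN t y != 0 by rewrite gt_eqF// cN_gt0.
rewrite /cIm.
have dN : is_derive y (1 : R) (fun y => cN t y) (2 * cX t y * (cdif y / 2 * cos (t / 2)) + 2 * cY t y * (csum y / 2 * sin (t / 2))).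
  by apply: is_derive_eq; rewrite /cX /cY /csum /cdif /GRing.scale/=; field.
have dnum : is_derive y (1 : R) (fun y => cE2 tau b t y * cX t y - cE1 tau b t y * cY t y)
  (tau * (cE1 tau b t y * cX t y + cE2 tau b t y * cY t y) + cE2 tau b t y * (cdif y / 2 * cos (t / 2)) - cE1 tau b t y * (csum y / 2 * sin (t / 2))).
  by apply: is_derive_eq; rewrite /cE1 /cE2 /cX /cY /csum /cdif /GRing.scale/=; field.
have dV := is_deriveV N0.
apply: is_derive_eq; rewrite /cD /GRing.scale/=.
rewrite (_ : cN t y = cX t y ^+ 2 + cY t y ^+ 2) in N0 *; last by [].
by field.
Qed.

Lemma cX_le t y : `|cX t y| <= csum y.
Proof. by rewrite normrM (gtr0_norm (csum_gt0 _)) ler_piMr ?(ltW (csum_gt0 _))// cos_max. Qed.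

Lemma cY_le t y : `|cY t y| <= csum y.
Proof.
by rewrite normrM (le_trans _ (abs_cdif y))// ler_piMr// sin_max.
Qed.

Lemma cE1_le tau b t y : - pi < t < pi -> `|cE1 tau b t y| <= expR (`|tau| * pi).
Proof.
move=> tpi; rewrite normrM (ger0_norm (expR_ge0 _)) -[leRHS]mulr1 ler_pM ?expR_ge0 ?cos_max//.
rewrite ler_expR (le_trans (ler_norm _))// normrN normrM ler_wpM2l// ltW// ltr_norml//.
Qed.

Lemma cE2_le tau b t y : - pi < t < pi -> `|cE2 tau b t y| <= expR (`|tau| * pi).
Proof.
move=> tpi; rewrite normrM (ger0_norm (expR_ge0 _)) -[leRHS]mulr1 ler_pM ?expR_ge0 ?sin_max//.
rewrite ler_expR (le_trans (ler_norm _))// normrN normrM ler_wpM2l// ltW// ltr_norml//.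
Qed.

(** A numerator of order S over a denominator of order S^2 is of order 1 / S; it is
    applied with S = csum y and k = cos (t / 2)^2. *)
Lemma quotient_bound (n N S k A : R) : 0 < S -> 0 < k -> k * S ^+ 2 <= N -> `|n| <= A * S -> 0 <= A ->
  `|n / N| <= A / k * S^-1.
Proof.
move=> S0 k0 kN nA A0.
have kS : 0 < k * S ^+ 2 by rewrite mulr_gt0 ?exprn_gt0.
have N0 : 0 < N := lt_le_trans kS kN.
rewrite normrM normfV (gtr0_norm N0) ler_pdivrMr//.
apply: (le_trans nA); rewrite (_ : A * S = A / k * S^-1 * (k * S ^+ 2)); last by field; rewrite !gt_eqF.
by rewrite ler_wpM2l// mulr_ge0 ?invr_ge0 ?divr_ge0// ltW.
Qed.

Lemma num_bound (e1 e2 x y S M : R) : `|e1| <= M -> `|e2| <= M -> `|x| <= S -> `|y| <= S ->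
  `|e1 * x + e2 * y| <= 2 * M * S.
Proof.
move=> h1 h2 h3 h4; rewrite (le_trans (ler_normD _ _))// !normrM.
rewrite (_ : 2 * M * S = M * S + M * S); last by ring.
by rewrite lerD// ler_pM.
Qed.

Lemma cRe_bound tau b t y : - pi < t < pi ->
  `|cRe tau b t y| <= 2 * expR (`|tau| * pi) / cos (t / 2) ^+ 2 * (csum y)^-1.
Proof.
move=> tpi; apply: quotient_bound; rewrite ?csum_gt0 ?exprn_gt0 ?cos_half_gt0 ?cN_ge ?mulr_ge0 ?expR_ge0//.
by apply: num_bound; rewrite ?cE1_le ?cE2_le ?cX_le ?cY_le.
Qed.

Lemma cIm_bound tau b t y : - pi < t < pi ->
  `|cIm tau b t y| <= 2 * expR (`|tau| * pi) / cos (t / 2) ^+ 2 * (csum y)^-1.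
Proof.
move=> tpi; apply: quotient_bound; rewrite ?csum_gt0 ?exprn_gt0 ?cos_half_gt0 ?cN_ge ?mulr_ge0 ?expR_ge0//.
by rewrite -mulrN; apply: num_bound; rewrite ?normrN ?cE1_le ?cE2_le ?cX_le ?cY_le.
Qed.

Lemma cD_bound tau b t y : - pi < t < pi ->
  `|cD tau b t y| <= (2 * `|tau| + 5) * expR (`|tau| * pi) / cos (t / 2) ^+ 4 * (csum y)^-1.
Proof.
move=> tpi; rewrite /cD/=.
have k0 := cos_half_gt0 tpi; set k := cos (t / 2) in k0 *.
have S0 := csum_gt0 y; set S := csum y in S0 *; set w := cdif y.
have wS : `|w| <= S := abs_cdif y.
have k1 : k <= 1 by exact: cos_le1.
have N0 := cN_gt0 y tpi; have kN := cN_ge t y; set N := cN t y in N0 kN *.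
have e1 := cE1_le tau b y tpi; have e2 := cE2_le tau b y tpi.
have x := cX_le t y; have yy := cY_le t y.
move: e1 e2 x yy; set E1 := cE1 _ _ _ _; set E2 := cE2 _ _ _ _; set X := cX _ _; set Y := cY _ _; set M := expR _.
move=> e1 e2 xS yS.
have M0 : 0 <= M by exact: expR_ge0.
have Xy : `|w / 2 * k| <= S / 2.
  rewrite normrM (gtr0_norm k0) -[leRHS]mulr1 ler_pM// ?(ltW k0)// normrM [X in _ * X <= _]ger0_norm// ler_wpM2r//.
have Yy : `|S / 2 * sin (t / 2)| <= S / 2.
  by rewrite normrM [X in X * _ <= _]gtr0_norm ?divr_gt0// -[leRHS]mulr1 ler_pM ?sin_max// divr_ge0// ltW.
set Xy' := w / 2 * k in Xy *; set Yy' := S / 2 * sin (t / 2) in Yy *.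
set n1 := - tau * _ - _ + _; set n2 := E1 * X + E2 * Y; set n3 := - (2 * X * Yy') + _.
have N1 : `|n2| <= 2 * M * S by exact: num_bound.
have N2 : `|n1| <= (2 * `|tau| + 1) * M * S.
  rewrite /n1 -addrA (le_trans (ler_normD _ _))//.
  rewrite (_ : (2 * `|tau| + 1) * M * S = `|tau| * (2 * M * S) + 2 * M * (S / 2)); last by field.
  rewrite lerD//; first by rewrite normrM normrN ler_wpM2l.
  by rewrite -mulrN addrC; apply: num_bound; rewrite ?normrN.
have N3 : `|n3| <= 2 * S ^+ 2.
  rewrite /n3 (_ : _ + _ = 2 * (Y * Xy' + (- X) * Yy')); last by ring.
  rewrite normrM ger0_norm// ler_wpM2l//.
  rewrite (_ : S ^+ 2 = 2 * S * (S / 2)); last by field.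
  by apply: num_bound; rewrite ?normrN.
rewrite (_ : (n1 * N - n2 * n3) / N ^+ 2 = n1 / N - n2 * n3 / N ^+ 2); last by field; rewrite gt_eqF.
rewrite (le_trans (ler_normB _ _))//.
rewrite (_ : (2 * `|tau| + 5) * M / k ^+ 4 * S^-1 = (2 * `|tau| + 1) * M / k ^+ 4 * S^-1 + 4 * M / k ^+ 4 * S^-1); last by field; rewrite !gt_eqF.
apply: lerD.
  apply: le_trans (quotient_bound S0 (_ : 0 < k ^+ 2) kN N2 _) _; rewrite ?exprn_gt0 ?mulr_ge0 ?addr_ge0 ?mulr_ge0//.
  rewrite ler_wpM2r ?invr_ge0 ?(ltW S0)// ler_wpM2l ?mulr_ge0 ?addr_ge0 ?mulr_ge0//.
  by rewrite lef_pV2 ?posrE ?exprn_gt0// ler_wiXn2l// ltW.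
rewrite (_ : n2 * n3 / N ^+ 2 = (n2 / N) * (n3 / N)); last by field; rewrite gt_eqF.
rewrite normrM (_ : 4 * M / k ^+ 4 * S^-1 = (2 * M / k ^+ 2 * S^-1) * (2 / k ^+ 2)); last by field; rewrite !gt_eqF.
apply: ler_pM => //; first by apply: quotient_bound; rewrite ?exprn_gt0 ?mulr_ge0.
rewrite normrM normfV (gtr0_norm N0) ler_pdivrMr//; apply: (le_trans N3).
rewrite -mulrA ler_wpM2l// mulrC ler_pdivlMr ?exprn_gt0//.
by rewrite mulrC.
Qed.

Lemma continuous_cRe tau b t : - pi < t < pi -> continuous (cRe tau b t).
Proof.
move=> tpi; apply: (continuous_mul (F := fun y => cE1 tau b t y * cX t y + cE2 tau b t y * cY t y)).
  apply: derivable_continuous => y; rewrite /cE1 /cE2 /cX /cY /csum /cdif; exact: ex_derive.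
apply: continuous_inv => y; last by rewrite gt_eqF// cN_gt0.
by apply: derivable_continuous => z; rewrite /cN /cX /cY /csum /cdif; exact: ex_derive.
Qed.

Lemma continuous_cD tau b t : - pi < t < pi -> continuous (cD tau b t).
Proof.
move=> tpi; rewrite /cD/=; apply: (continuous_mul (F := fun y => _)).
  apply: derivable_continuous => y; rewrite /cN /cE1 /cE2 /cX /cY /csum /cdif; exact: ex_derive.
apply: continuous_inv => y; last by rewrite gt_eqF// exprn_gt0 ?cN_gt0.
by apply: derivable_continuous => z; rewrite /cN /cX /cY /csum /cdif; exact: ex_derive.
Qed.

Lemma itg_cRe tau b t : - pi < t < pi -> itg (cRe tau b t).
Proof.
move=> tpi; apply: itg_le (itgZ (2 * expR (`|tau| * pi) / cos (t / 2) ^+ 2) itg_csumV) _.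
  by apply: continuous_measurable_fun; exact: continuous_cRe.
by move=> y; exact: cRe_bound.
Qed.

Lemma itg_cD tau b t : - pi < t < pi -> itg (cD tau b t).
Proof.
move=> tpi; apply: itg_le (itgZ ((2 * `|tau| + 5) * expR (`|tau| * pi) / cos (t / 2) ^+ 4) itg_csumV) _.
  by apply: continuous_measurable_fun; exact: continuous_cD.
by move=> y; exact: cD_bound.
Qed.

Lemma cvg_csumV (s : R) : `|s| = 1 -> (csum (s * n%:R))^-1 @[n --> \oo] --> (0 : R).
Proof.
move=> s1; apply: (@squeeze_cvgr _ _ _ _ (fun=> 0) (fun n => expR (- (2^-1 * n%:R)))).
- apply: nearW => n; rewrite invr_ge0 (ltW (csum_gt0 _))/= (le_trans (csumV _))//.
  by rewrite normrM s1 mul1r ger0_norm.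
- exact: cvg_cst.
- exact: cvg_expRN.
Qed.

Lemma cvg_cIm tau b t (s : R) : - pi < t < pi -> `|s| = 1 -> cIm tau b t (s * n%:R) @[n --> \oo] --> (0 : R).
Proof.
move=> tpi s1; apply/norm_cvg0P.
set K := 2 * expR (`|tau| * pi) / cos (t / 2) ^+ 2.
apply: (@squeeze_cvgr _ _ _ _ (fun=> 0) (fun n => K * (csum (s * n%:R))^-1)).
- by apply: nearW => n; rewrite normr_ge0 cIm_bound.
- exact: cvg_cst.
- by rewrite -(mulr0 K); apply: cvgMr; exact: cvg_csumV.
Qed.

(** The integrand is minus the y-derivative of cIm, which vanishes at infinity. *)
Lemma Int_cD tau b t : - pi < t < pi -> Int (cD tau b t) = 0.
Proof.
move=> tpi; rewrite -[LHS]opprK -IntN; last exact: itg_cD.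
rewrite (@FTC_T _ (cIm tau b t) _ 0 0 (fun y => is_derive_cIm tau b y tpi)) ?subr0 ?oppr0//.
- by move=> y; apply: continuousN; exact: continuous_cD.
- by apply: itgN; exact: itg_cD.
- by rewrite (_ : (fun n => _) = (fun n => cIm tau b t (1 * n%:R))); [exact: cvg_cIm (normr1 _)|apply/funext => n; rewrite mul1r].
- rewrite (_ : (fun n => _) = (fun n => cIm tau b t (-1 * n%:R))); last by apply/funext => n; rewrite mulN1r.
  by apply: cvg_cIm => //; exact: normrN1.
Qed.

Lemma cos_half_le (x t : R) : `|x| <= t -> t < pi -> cos (t / 2) <= cos (x / 2).
Proof.
wlog x0 : x / 0 <= x => [H|].
  have [|x0] := leP 0 x; first exact: H.
  by rewrite -(cosN (x / 2)) -mulNr -normrN; apply: H; rewrite oppr_ge0 ltW.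
rewrite ger0_norm// => xt tpi; have p0 := pi_gt0 R.
rewrite leNgt ltr_cos ?in_itv/=; first (rewrite -leNgt; lra).
- by apply/andP; split; lra.
- by apply/andP; split; lra.
Qed.

(** Cauchy's theorem on a strip, without contour integrals: differentiating under
    the integral sign and using the Cauchy-Riemann equation, the t-derivative is
    Int cD = 0. *)
Lemma Int_cRe_const tau b t : 0 <= t < pi -> Int (cRe tau b t) = Int (cRe tau b 0).
Proof.
move=> /andP[t0 tpi]; move: t0; rewrite le_eqVlt => /predU1P[<-//|t0].
(* Domination is uniform on the symmetric interval (-t1, t1) with
   |s| < t1 < pi. *)
pose F s := Int (cRe tau b s).
have dF s : - pi < s < pi -> is_derive s (1 : R) F 0.
  move=> spi; pose t1 := (`|s| + pi) / 2.
  have [st1 t1pi] : `|s| < t1 /\ t1 < pi.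
    by have : `|s| < pi by [rewrite ltr_norml]; rewrite /t1 => *; split; lra.
  have I1 x : x \in `]- t1, t1[ -> - pi < x < pi.
    by rewrite in_itv/= => /andP[x1 x2]; apply/andP; split; lra.
  have t10 : 0 < cos (t1 / 2) by apply: cos_half_gt0; have := normr_ge0 s => *; apply/andP; split; lra.
  have Is : s \in `]- t1, t1[ by rewrite in_itv/= -ltr_norml.
  have d1 y x : x \in `]- t1, t1[ -> partial1of2 (cRe tau b) x y = cD tau b x y.
    by move=> xI; rewrite partial1of2E; have := is_derive_cRe tau b y (I1 _ xI) => H; rewrite derive_val.
  pose G y := (2 * `|tau| + 5) * expR (`|tau| * pi) / cos (t1 / 2) ^+ 4 * (csum y)^-1.
  have h1 x : [set` `]- t1, t1[] x -> mu.-integrable setT (EFin \o cRe tau b x) by move=> xI; apply: itg_cRe; exact: I1.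
  have h2 x y : [set` `]- t1, t1[] x -> [set: R] y -> derivable (cRe tau b ^~ y) x 1.
    by move=> /= xI _; have := is_derive_cRe tau b y (I1 _ xI) => H; exact: ex_derive.
  have h3 y : 0 <= G y.
    rewrite mulr_ge0 ?invr_ge0 ?(ltW (csum_gt0 _))// divr_ge0 ?exprn_ge0 ?(ltW t10)//.
  have h4 : mu.-integrable setT (EFin \o G) by apply: itgZ; exact: itg_csumV.
  have h5 x y : [set` `]- t1, t1[] x -> [set: R] y -> `|partial1of2 (cRe tau b) x y| <= G y.
    move=> /= xI _; rewrite d1//; apply: le_trans (cD_bound _ _ _ (I1 _ xI)) _.
    rewrite /G ler_wpM2r ?invr_ge0 ?(ltW (csum_gt0 _))//.
    rewrite ler_wpM2l//.
    rewrite lef_pV2 ?posrE ?exprn_gt0// ?cos_half_gt0 ?I1//.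
    rewrite lerXn2r ?nnegrE ?(ltW t10) ?(ltW (cos_half_gt0 _)) ?I1//.
    by apply: cos_half_le => //; move: xI; rewrite in_itv/= -ltr_norml => /ltW.
  have := derivable_under_integral measurableT Is h1 h2 h3 h4 h5 => dF.
  have := differentiation_under_integral measurableT Is h1 h2 h3 h4 h5; rewrite derive1E => FE.
  apply: DeriveDef => //; rewrite FE -[RHS](Int_cD tau b spi).
  by apply: eq_Int => y; rewrite d1.
have cF : {within `[0, t], continuous F}.
  apply: derivable_within_continuous => x; rewrite in_itv/= => /andP[x0 xt].
  by have := dF x; rewrite (lt_le_trans _ x0) ?oppr_lt0 ?pi_gt0// (le_lt_trans xt)// => /(_ isT) H; exact: ex_derive.
have [|c _] := @MVT _ F (fun=> 0) 0 t t0 _ cF.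
  by move=> x; rewrite in_itv/= => /andP[x0 xt]; apply: dF; rewrite (lt_trans _ x0) ?oppr_lt0 ?pi_gt0// (lt_trans xt).
by rewrite mul0r => /eqP; rewrite subr_eq0 => /eqP.
Qed.

End SechTransform.

Section SechTransform2.
Context {R : realType}.
Local Notation mu := (@lebesgue_measure R).
Implicit Types t y a b tau : R.

Definition cosh a : R := (expR a + expR (- a)) / 2.
Definition sinh a : R := (expR a - expR (- a)) / 2.
(** The Fourier transform of 1 / (2 cosh (y / 2)), with a phase b. *)
Definition sech_transform tau b : R := Int (fun y => cos (tau * y + b) / csum y).

Lemma mfun_cos_affine tau b : mfun (fun y => cos (tau * y + b)).
Proof. by apply: mfun_cos; apply: measurable_funD => //; exact: measurable_funM. Qed.
Lemma mfun_sin d (T : measurableType d) (f : T -> R) : measurable_fun setT f -> measurable_fun setT (fun x => sin (f x)).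
Proof.
by move=> mf; apply: (measurableT_comp _ mf); apply: continuous_measurable_fun; exact: continuous_sin.
Qed.
Lemma mfun_sin_affine tau b : mfun (fun y => sin (tau * y + b)).
Proof. by apply: mfun_sin; apply: measurable_funD => //; exact: measurable_funM. Qed.

Lemma mfun_cdif : mfun (@cdif R).
Proof. by apply: measurable_funB; apply: mfun_exp => //; [|apply: measurableT_comp => //]; exact: measurable_funM. Qed.
Lemma mfun_cX t : mfun (cX t).
Proof. by apply: measurable_funM => //; exact: mfun_csum. Qed.
Lemma mfun_cY t : mfun (cY t).
Proof. by apply: measurable_funM => //; exact: mfun_cdif. Qed.
Lemma mfun_cN t : mfun (cN t).
Proof. by apply: measurable_funD; apply: measurable_funX; [exact: mfun_cX|exact: mfun_cY]. Qed.

Lemma cXN_le t y : - pi < t < pi -> `|cX t y / cN t y| <= (cos (t / 2) ^+ 2)^-1 * (csum y)^-1.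
Proof.
move=> tpi; have k0 : 0 < cos (t / 2) ^+ 2 by rewrite exprn_gt0 ?cos_half_gt0.
have h : `|cX t y| <= 1 * csum y by rewrite mul1r cX_le.
by have := quotient_bound (csum_gt0 y) k0 (cN_ge t y) h ler01; rewrite mul1r.
Qed.

Lemma cYN_le t y : - pi < t < pi -> `|cY t y / cN t y| <= (cos (t / 2) ^+ 2)^-1 * (csum y)^-1.
Proof.
move=> tpi; have k0 : 0 < cos (t / 2) ^+ 2 by rewrite exprn_gt0 ?cos_half_gt0.
have h : `|cY t y| <= 1 * csum y by rewrite mul1r cY_le.
by have := quotient_bound (csum_gt0 y) k0 (cN_ge t y) h ler01; rewrite mul1r.
Qed.

Lemma itg_bM (f g : R -> R) : itg g -> mfun f -> (forall x, `|f x| <= 1) -> itg (fun x => f x * g x).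
Proof.
move=> gi mf f1; apply: itg_le (itg_norm gi) _; first by apply: measurable_funM => //; exact: itg_m.
by move=> x; rewrite normrM ler_piMl.
Qed.

Lemma itg_cXN t : - pi < t < pi -> itg (fun y => cX t y / cN t y).
Proof.
move=> tpi; apply: itg_le (itgZ _ itg_csumV) (fun y => cXN_le y tpi).
by apply: measurable_funM; [exact: mfun_cX|apply: mfunV; exact: mfun_cN].
Qed.

Lemma itg_cYN t : - pi < t < pi -> itg (fun y => cY t y / cN t y).
Proof.
move=> tpi; apply: itg_le (itgZ _ itg_csumV) (fun y => cYN_le y tpi).
by apply: measurable_funM; [exact: mfun_cY|apply: mfunV; exact: mfun_cN].
Qed.

Lemma itg_cosXN tau b t : - pi < t < pi -> itg (fun y => cos (tau * y + b) * (cX t y / cN t y)).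
Proof. by move=> tpi; apply: itg_bM; [exact: itg_cXN|exact: mfun_cos_affine|move=> x; exact: cos_max]. Qed.
Lemma itg_sinYN tau b t : - pi < t < pi -> itg (fun y => sin (tau * y + b) * (cY t y / cN t y)).
Proof. by move=> tpi; apply: itg_bM; [exact: itg_cYN|exact: mfun_sin_affine|move=> x; exact: sin_max]. Qed.

Lemma cX0 y : cX 0 y = csum y.
Proof. by rewrite /cX mul0r cos0 mulr1. Qed.
Lemma cY0 y : cY 0 y = 0.
Proof. by rewrite /cY mul0r sin0 mulr0. Qed.
Lemma cN0 y : cN 0 y = csum y ^+ 2.
Proof. by rewrite /cN cX0 cY0 expr0n addr0. Qed.

Lemma cosh_gt0 a : 0 < cosh a.
Proof. by rewrite divr_gt0// addr_gt0 ?expR_gt0. Qed.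

Lemma Int_cRe tau b t : 0 <= t < pi ->
  expR (- (tau * t)) * (Int (fun y => cos (tau * y + b) * (cX t y / cN t y)) + Int (fun y => sin (tau * y + b) * (cY t y / cN t y))) = sech_transform tau b.
Proof.
move=> tpi; have /andP[t0 t1] := tpi; have p0 := pi_gt0 R.
have tpi' : - pi < t < pi by apply/andP; split => //; lra.
have := Int_cRe_const tau b tpi.
have -> : Int (cRe tau b 0) = sech_transform tau b.
  apply: eq_Int => y; rewrite /cRe cX0 cY0 cN0 /cE1 mulr0 oppr0 expR0 mul1r mulr0 addr0.
  by field; rewrite gt_eqF ?csum_gt0.
move=> <-; rewrite -IntD; [|exact: itg_cosXN|exact: itg_sinYN].
rewrite -IntZ; last by apply: itgD; [exact: itg_cosXN|exact: itg_sinYN].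
by apply: eq_Int => y; rewrite /cRe /cE1 /cE2; field; rewrite gt_eqF ?cN_gt0.
Qed.

Lemma sech_transformN tau b : sech_transform (- tau) (- b) = sech_transform tau b.
Proof. by apply: eq_Int => y; rewrite -[in LHS]cosN opprD mulNr !opprK. Qed.

(** The shifted integral splits into the cosine and the sine part below, with sum
    S e^(tau t), where S is the transform.  The signs of tau and b can be changed
    together without changing S, which gives the difference S e^(- tau t). *)
Lemma Int_cos_sin tau b t : 0 <= t < pi ->
  Int (fun y => cos (tau * y + b) * (cX t y / cN t y)) = sech_transform tau b * cosh (tau * t) /\
  Int (fun y => sin (tau * y + b) * (cY t y / cN t y)) = sech_transform tau b * sinh (tau * t).
Proof.
move=> tpi.
have tpi' : - pi < t < pi by move: tpi => /andP[? ?]; have p0 := pi_gt0 R; apply/andP; split => //; lra.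
have h1 := Int_cRe tau b tpi; have := Int_cRe (- tau) (- b) tpi.
have -> : Int (fun y => cos (- tau * y + - b) * (cX t y / cN t y)) = Int (fun y => cos (tau * y + b) * (cX t y / cN t y)).
  by apply: eq_Int => y; rewrite -[in LHS]cosN opprD mulNr !opprK.
have -> : Int (fun y => sin (- tau * y + - b) * (cY t y / cN t y)) = - Int (fun y => sin (tau * y + b) * (cY t y / cN t y)).
  rewrite -IntN; last exact: itg_sinYN.
  by apply: eq_Int => y; rewrite mulNr -opprD sinN mulNr.
rewrite sech_transformN mulNr opprK; move: h1.
set U := Int _; set V := Int _; set S := sech_transform _ _; rewrite /cosh /sinh.
have := expRxMexpNx_1 (tau * t); set p := expR _; set q := expR _ => pq h1 h2.
have e1 : U + V = S * p by rewrite -h1 mulrAC [q * p]mulrC pq mul1r.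
have e2 : U - V = S * q by rewrite -h2 mulrAC pq mul1r.
by split; lra.
Qed.

Lemma Int_odd (f : R -> R) : itg f -> (forall y, f (- y) = - f y) -> Int f = 0.
Proof.
move=> fi fo; have := Int_opp fi; rewrite (eq_Int fo) IntN//.
by move=> h; lra.
Qed.

Lemma csum_even y : csum (- y) = csum y.
Proof. by rewrite /csum mulNr opprK addrC. Qed.
Lemma cdif_odd y : cdif (- y) = - cdif y :> R.
Proof. by rewrite /cdif mulNr opprK opprB. Qed.

(** The sine part of cos (tau y + b) is odd and csum is even. *)
Lemma sech_transform_phase tau b : sech_transform tau b = cos b * sech_transform tau 0.
Proof.
have i1 : itg (fun y => cos (tau * y + 0) * (csum y)^-1).
  by apply: itg_bM; [exact: itg_csumV|exact: mfun_cos_affine|move=> x; exact: cos_max].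
have i2 : itg (fun y => sin (tau * y) * (csum y)^-1).
  apply: itg_bM; [exact: itg_csumV| |move=> x; exact: sin_max].
  by apply: mfun_sin; exact: measurable_funM.
transitivity (Int (fun y => cos b * (cos (tau * y + 0) * (csum y)^-1) - sin b * (sin (tau * y) * (csum y)^-1))).
  by apply: eq_Int => y; rewrite cosD addr0; ring.
rewrite IntB; [|exact: itgZ|exact: itgZ].
rewrite !IntZ// (_ : Int (fun y => sin (tau * y) * _) = 0) ?mulr0 ?subr0//.
by apply: Int_odd => // y; rewrite mulrN sinN csum_even mulNr.
Qed.

Lemma is_derive_atan_cdif t y : - pi < t < pi ->
  is_derive y (1 : R) (fun y => atan (cdif y / (2 * cos (t / 2)))) (cX t y / cN t y).
Proof.
move=> tpi; have k0 := cos_half_gt0 tpi; have N0 := cN_gt0 y tpi.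
have dd : is_derive y (1 : R) (@cdif R) (csum y / 2).
  by apply: is_derive_eq; rewrite /csum /GRing.scale/=; field.
apply: is_derive_eq; rewrite /GRing.scale/= /cX.
move: N0; rewrite cN_E => N0.
by field; rewrite !gt_eqF//= [X in 0 < X](_ : _ = cdif y ^+ 2 + 4 * cos (t / 2) ^+ 2)//; ring.
Qed.

Lemma abs_cdif_ge y : `|y| / 2 <= `|cdif y|.
Proof.
wlog y0 : y / 0 <= y => [H|].
  have [|y0] := leP 0 y; first exact: H.
  by rewrite -normrN -(normrN (cdif y)) -cdif_odd; apply: H; rewrite oppr_ge0 ltW.
rewrite ger0_norm// (le_trans _ (ler_norm _))// /cdif.
have := expR_ge1Dx (y / 2); have : expR (- (y / 2)) <= 1 by rewrite -expR0 ler_expR oppr_le0 divr_ge0.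
by move=> *; lra.
Qed.

Lemma cvg_cdif : cdif n%:R @[n --> \oo] --> (+oo : set_system R).
Proof.
apply/cvgryPge => A; near=> n.
have : `|n%:R : R| / 2 <= `|cdif n%:R| := abs_cdif_ge _.
rewrite ger0_norm// [X in _ <= X]ger0_norm; last first.
  by rewrite /cdif subr_ge0 ler_expR ge0_cp// ?divr_ge0//.
apply: le_trans; rewrite ler_pdivlMr//; near: n; exact: nbhs_infty_ger.
Unshelve. all: by end_near. Qed.

(** The primitive is atan (sinh (y / 2) / cos (t / 2)), so the mass is pi for every
    t; as t tends to pi the mass concentrates at y = 0. *)
Lemma Int_cXN t : - pi < t < pi -> Int (fun y => cX t y / cN t y) = pi.
Proof.
move=> tpi; have k0 := cos_half_gt0 tpi.
have cv : atan (cdif n%:R / (2 * cos (t / 2))) @[n --> \oo] --> (pi / 2 : R).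
  apply: cvg_atan_pinfty; apply/cvgryPge => A.
  have /cvgryPge/(_ (A * (2 * cos (t / 2)))) := cvg_cdif.
  by apply: filterS => n; rewrite ler_pdivlMr// mulr_gt0.
rewrite (@FTC_T _ (fun y => atan (cdif y / (2 * cos (t / 2)))) (fun y => cX t y / cN t y) (pi / 2) (- (pi / 2)) (fun y => is_derive_atan_cdif y tpi))//.
- by rewrite opprK -splitr.
- apply: (continuous_mul (F := cX t)); first by apply: derivable_continuous => y; rewrite /cX /csum; exact: ex_derive.
  apply: continuous_inv => y; last by rewrite gt_eqF// cN_gt0.
  by apply: derivable_continuous => z; rewrite /cN /cX /cY /csum /cdif; exact: ex_derive.
- exact: itg_cXN.
- rewrite (_ : (fun n => _) = (fun n : nat => - atan (cdif n%:R / (2 * cos (t / 2))))); first exact: cvgN.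
  by apply/funext => n; rewrite cdif_odd mulNr atanN.
Qed.

Lemma abs_sin_le (x : R) : `|sin x| <= `|x|.
Proof.
wlog x0 : x / 0 <= x => [H|].
  have [|x0] := leP 0 x; first exact: H.
  by rewrite -normrN -(normrN x) -sinN; apply: H; rewrite oppr_ge0 ltW.
move: x0; rewrite le_eqVlt => /predU1P[<-|x0]; first by rewrite sin0.
have [|c _] := @MVT _ (@sin R) (@cos R) 0 x x0 (fun y _ => is_derive_sin y).
  by apply: continuous_subspaceT; exact: continuous_sin.
by rewrite sin0 !subr0 => ->; rewrite normrM ler_piMl// cos_max.
Qed.

Lemma onem_cos_le (a : R) : `|1 - cos a| <= a ^+ 2 / 2.
Proof.
rewrite ger0_norm ?subr_ge0 ?cos_le1// [a in cos a](splitr a).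
have -> : 1 - cos (a / 2 + a / 2) = 2 * sin (a / 2) ^+ 2.
  by rewrite cosD -!expr2 sin2cos2; ring.
rewrite -[sin _ ^+ 2]real_normK ?num_real//.
have : `|sin (a / 2)| ^+ 2 <= `|a / 2| ^+ 2 by rewrite lerXn2r ?nnegrE// abs_sin_le.
by rewrite [X in _ <= X]real_normK ?num_real// => h; lra.
Qed.

(** Near 0 the left side is of order tau^2 y^2 and the right side of order y^2;
    away from 0 both are bounded.  The constant covers the cases cdif y ^ 2 <= 4 and
    cdif y ^ 2 > 4 together. *)
Lemma onem_cos_le_cdif tau y : `|1 - cos (tau * y)| <= (16 * tau ^+ 2 + 4) * (cdif y ^+ 2 / csum y ^+ 2).
Proof.
have S0 : 0 < csum y ^+ 2 by rewrite exprn_gt0 ?csum_gt0.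
rewrite mulrA ler_pdivlMr// csum2; set w := cdif y ^+ 2.
have w0 : 0 <= w by exact: sqr_ge0.
have t0 : 0 <= tau ^+ 2 by exact: sqr_ge0.
have h1 : `|1 - cos (tau * y)| <= 2.
  by rewrite ger0_norm ?subr_ge0 ?cos_le1//; have := cos_geN1 (tau * y) => *; lra.
have h2 : `|1 - cos (tau * y)| <= 2 * tau ^+ 2 * w.
  apply: (le_trans (onem_cos_le _)); rewrite exprMn.
  have yw : y ^+ 2 <= 4 * w.
    have : (`|y| / 2) ^+ 2 <= `|cdif y| ^+ 2 by rewrite lerXn2r ?nnegrE ?divr_ge0// abs_cdif_ge.
    by rewrite exprMn !real_normK ?num_real// -/w => h; lra.
  by have := ler_wpM2l t0 yw; lra.
have [w4|w4] := leP w 4.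
  have : `|1 - cos (tau * y)| * (w + 4) <= 2 * tau ^+ 2 * w * 8.
    by apply: ler_pM => //; lra.
  have := mulr_ge0 t0 w0; lra.
have : `|1 - cos (tau * y)| * (w + 4) <= 2 * (w + 4) by rewrite ler_wpM2r//; lra.
have := mulr_ge0 t0 w0; lra.
Qed.

(** By Int_cos_sin and Int_cXN the left side is the integral of
    (1 - cos (tau y)) cX / cN.  The zero of 1 - cos at y = 0 compensates the
    concentration of cX / cN there, and a factor cos (t / 2) remains. *)
Lemma sech_transform_limit tau t : 0 <= t < pi ->
  `|sech_transform tau 0 * cosh (tau * t) - pi| <= (16 * tau ^+ 2 + 4) * Int (fun y => (csum y)^-1) * cos (t / 2).
Proof.
move=> tpi.
have tpi' : - pi < t < pi by move: tpi => /andP[? ?]; have p0 := pi_gt0 R; apply/andP; split => //; lra.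
rewrite -(Int_cos_sin tau 0 tpi).1 -[X in _ - X](Int_cXN tpi') -IntB; [|exact: itg_cosXN|exact: itg_cXN].
have k0 := cos_half_gt0 tpi'.
rewrite mulrAC -IntZ; last exact: itg_csumV.
apply: Int_abs_le; [by apply: itgB; [exact: itg_cosXN|exact: itg_cXN]|by apply: itgZ; exact: itg_csumV|].
move=> y; rewrite addr0 -[X in _ - X]mul1r -mulrBl normrM distrC.
have S0 := csum_gt0 y; have N0 := cN_gt0 y tpi'.
have XN : `|cX t y / cN t y| = csum y * cos (t / 2) / cN t y.
  by rewrite ger0_norm// divr_ge0 ?(ltW N0)// mulr_ge0// ltW.
rewrite XN; apply: le_trans (ler_wpM2r _ (onem_cos_le_cdif tau y)) _.
  by rewrite divr_ge0 ?(ltW N0)// mulr_ge0// ltW.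
rewrite (_ : _ * _ * (_ / _) = (16 * tau ^+ 2 + 4) * cos (t / 2) * (csum y)^-1 * (cdif y ^+ 2 / cN t y)); last by field; rewrite !gt_eqF.
rewrite ler_piMr//.
  by rewrite mulr_ge0 ?invr_ge0 ?(ltW S0)// mulr_ge0 ?(ltW k0)// addr_ge0// mulr_ge0// sqr_ge0.
by rewrite ler_pdivrMr// mul1r cN_E lerDl mulr_ge0// sqr_ge0.
Qed.

Lemma sech_transform0 tau : sech_transform tau 0 = pi / cosh (tau * pi).
Proof.
(* Let t tend to pi in sech_transform_limit. *)
suff : sech_transform tau 0 * cosh (tau * pi) = pi.
  by move=> h; rewrite -[LHS](mulfK (lt0r_neq0 (cosh_gt0 (tau * pi)))) h.
apply/eqP; rewrite -subr_eq0 -normr_le0.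
pose u n : R := pi * (1 - n.+1%:R^-1).
have p0 := pi_gt0 R.
have uI n : 0 <= u n < pi.
  have h : 0 < (n.+1%:R : R)^-1 <= 1 by rewrite invr_gt0 ltr0n/= invf_le1 ?ltr0n// ler1n.
  move: h => /andP[h1 h2]; rewrite /u; apply/andP; split; first by rewrite mulr_ge0 ?subr_ge0// ltW.
  by rewrite gtr_pMr// ltrBlDr ltrDl.
have cu : u n @[n --> \oo] --> (pi : R).
  rewrite -[X in _ --> X]mulr1 -[X in _ * X]subr0; apply: cvgMr; apply: cvgB; first exact: cvg_cst.
  exact: cvg_harmonic.
have cont (F : R -> R) : (forall x, derivable F x 1) -> F (u n) @[n --> \oo] --> F pi.
  move=> dF; apply: (cvg_comp _ F cu); exact: derivable_continuous.
have c1 := cont (fun t => sech_transform tau 0 * cosh (tau * t) - pi).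
have {}c1 : `|sech_transform tau 0 * cosh (tau * u n) - pi| @[n --> \oo] --> `|sech_transform tau 0 * cosh (tau * pi) - pi|.
  by apply: cvg_norm; apply: c1 => x; rewrite /cosh; exact: ex_derive.
set C := (16 * tau ^+ 2 + 4) * Int (fun y => (csum y)^-1).
have c2 : C * cos (u n / 2) @[n --> \oo] --> 0.
  rewrite -[X in _ --> X](mulr0 C) -(cos_pihalf R).
  apply: (cont (fun t => C * cos (t / 2))) => x; exact: ex_derive.
by apply: ler_cvg_to c1 c2 _; apply: nearW => n; exact: sech_transform_limit.
Qed.

Lemma sech_transformE tau b : sech_transform tau b = pi * cos b / cosh (tau * pi).
Proof. by rewrite sech_transform_phase sech_transform0; ring. Qed.

End SechTransform2.

(** * Weak convergence and a Schur test *)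
Section L2tools.
Context {R : realType}.
Local Notation mu := (@lebesgue_measure R).
Implicit Types f g h F : R -> R.

(** The space L2(R), with measurability included. *)
Definition sq f : Prop := mfun f /\ itg (fun x => f x ^+ 2).

Lemma normM_le (a b : R) : `|a * b| <= a ^+ 2 + b ^+ 2.
Proof.
rewrite normrM -[a ^+ 2]real_normK ?num_real// -[b ^+ 2]real_normK ?num_real//.
by have := sqr_ge0 (`|a| - `|b|); have := sqr_ge0 (`|a| + `|b|); rewrite sqrrB sqrrD => *; lra.
Qed.

Lemma sq_mul f g : sq f -> sq g -> itg (fun x => f x * g x).
Proof.
move=> [mf f2] [mg g2]; apply: itg_le (itgD f2 g2) _; first exact: measurable_funM.
by move=> x; exact: normM_le.
Qed.

Lemma sqZ c f : sq f -> sq (fun x => c * f x).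
Proof.
move=> [mf f2]; split; first exact: measurable_funM.
by apply: eq_itg (itgZ (c ^+ 2) f2) => x; rewrite exprMn.
Qed.

Lemma sqD f g : sq f -> sq g -> sq (fun x => f x + g x).
Proof.
move=> sf sg; split; first by apply: measurable_funD; [exact: sf.1|exact: sg.1].
apply: eq_itg (itgD (itgD sf.2 (itgZ 2 (sq_mul sf sg))) sg.2) => x; ring.
Qed.

Lemma sqN f : sq f -> sq (fun x => - f x).
Proof. by move=> sf; rewrite (_ : (fun x => _) = (fun x => -1 * f x)); [exact: sqZ|apply/funext => x; rewrite mulN1r]. Qed.

Lemma sqB f g : sq f -> sq g -> sq (fun x => f x - g x).
Proof.
by move=> sf sg; exact: sqD sf (sqN sg).
Qed.

Lemma sq_le f g : mfun f -> sq g -> (forall x, `|f x| <= `|g x|) -> sq f.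
Proof.
move=> mf [mg g2] fg; split => //; apply: itg_le g2 _; first exact: measurable_funX.
move=> x; rewrite ger0_norm ?sqr_ge0// -[f x ^+ 2]real_normK ?num_real// -[g x ^+ 2]real_normK ?num_real//.
by rewrite lerXn2r ?nnegrE.
Qed.

(** This replaces the Cauchy-Schwarz inequality below: the free parameter a plays
    the part of the square root. *)
Lemma young_ineq (p q a : R) : 0 < a -> p * q <= a * p ^+ 2 + a^-1 * q ^+ 2.
Proof.
move=> a0; have h1 : 0 <= a * (p - a^-1 * q / 2) ^+ 2 by rewrite mulr_ge0 ?sqr_ge0// ltW.
have h2 : 0 <= a^-1 * q ^+ 2 by rewrite mulr_ge0 ?sqr_ge0// invr_ge0 ltW.
have : a * (p - a^-1 * q / 2) ^+ 2 = a * p ^+ 2 - p * q + a^-1 * q ^+ 2 / 4 by field; rewrite gt_eqF.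
by move=> E; rewrite E in h1; lra.
Qed.

Lemma Int_young_ineq f g (a : R) : 0 < a -> sq f -> sq g ->
  `|Int (fun x => f x * g x)| <= a * Int (fun x => f x ^+ 2) + a^-1 * Int (fun x => g x ^+ 2).
Proof.
move=> a0 sf sg; rewrite -!IntZ ?sf.2 ?sg.2//; [|exact: sg.2|exact: sf.2].
rewrite -IntD; [|exact: itgZ sf.2|exact: itgZ sg.2].
apply: Int_abs_le; [exact: sq_mul|apply: itgD; [exact: itgZ sf.2|exact: itgZ sg.2]|].
move=> x; rewrite normrM -[f x ^+ 2]real_normK ?num_real// -[g x ^+ 2]real_normK ?num_real//.
exact: young_ineq.
Qed.

(** The remainder is dominated by d^-1 h^2 and tends to 0 with a, which is what
    dominated convergence asks for in weak_cvg. *)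
Lemma split_young_ineq (a h d : R) : 0 <= a -> 0 < d -> a * `|h| <= d * a ^+ 2 + Num.min (a * `|h|) (d^-1 * h ^+ 2).
Proof.
move=> a0 d0; have h1 := young_ineq a `|h| d0; rewrite real_normK ?num_real// in h1.
have h2 : 0 <= d * a ^+ 2 by rewrite mulr_ge0 ?sqr_ge0// ltW.
by case: (leP (a * `|h|) (d^-1 * h ^+ 2)) => _; lra.
Qed.

(** Bounded in L2 and convergent almost everywhere implies weakly convergent.  The
    integral of |gn - g| |h| is split by split_young_ineq: one part is at most d
    times the bound for the norms, and the other tends to 0 by dominated convergence
    for fixed d. *)
Lemma weak_cvg (gn : nat -> R -> R) g h C : (forall n, sq (gn n)) ->
  (forall n, Int (fun x => gn n x ^+ 2) <= C) -> mfun g -> sq h ->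
  {ae mu, forall x, gn n x @[n --> \oo] --> g x} ->
  [/\ sq g, Int (fun x => g x ^+ 2) <= C & Int (fun x => gn n x * h x) @[n --> \oo] --> Int (fun x => g x * h x)].
Proof.
move=> sgn gnC mg sqh cv.
have [g2 gC] : itg (fun x => g x ^+ 2) /\ Int (fun x => g x ^+ 2) <= C.
  apply: (fatou_Int (fn := fun n x => gn n x ^+ 2)) => //.
  - by move=> n; exact: (sgn n).2.
  - exact: measurable_funX.
  - by move=> n x; exact: sqr_ge0.
  - by move=> x; exact: sqr_ge0.
  - by apply: aeS cv => x cx; rewrite expr2; under eq_cvg do rewrite expr2; exact: cvgM.
have sg : sq g by [].
split => //.
have C0 : 0 <= C by apply: le_trans gC; apply: Int_ge0 => x; exact: sqr_ge0.
apply/cvgrPdist_le => e e0.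
pose d := e / (8 * (C + 1)).
have d0 : 0 < d by rewrite divr_gt0// mulr_gt0// ltr_wpDl.
pose mn n x := Num.min (`|gn n x - g x| * `|h x|) (d^-1 * h x ^+ 2).
have mn0 n x : 0 <= mn n x.
  by rewrite le_min mulr_ge0//= mulr_ge0 ?sqr_ge0// invr_ge0 ltW.
have hd : itg (fun x => d^-1 * h x ^+ 2) by apply: itgZ; exact: sqh.2.
have mmn n : mfun (mn n).
  apply: measurable_minr; last exact: itg_m hd.
  apply: measurable_funM; apply: measurableT_comp => //; last exact: sqh.1.
  by apply: measurable_funB => //; exact: (sgn n).1.
have mnle n x : `|mn n x| <= d^-1 * h x ^+ 2 by rewrite ger0_norm// ge_min lexx orbT.
have imn n : itg (mn n) by exact: itg_le hd (mnle n).
have cmn : Int (mn n) @[n --> \oo] --> Int (fun=> 0 : R).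
  apply: (dct (g := fun x => d^-1 * h x ^+ 2)) => //; first exact: itg_m itg0.
  apply: aeS cv => x cx.
  apply: (@squeeze_cvgr _ _ _ _ (fun=> 0) (fun n => `|gn n x - g x| * `|h x|)).
  - by apply: nearW => n; rewrite mn0 ge_min lexx.
  - exact: cvg_cst.
  - rewrite -(mul0r `|h x|); apply: cvgMl; apply/norm_cvg0P; exact/subr_cvg0.
rewrite Int0 in cmn; move/cvgrPdist_le : cmn => /(_ (e / 2)).
move=> /(_ (divr_gt0 e0 (ltr0Sn _ 1))).
apply: filterS => n; rewrite sub0r normrN => hn.
have smn : sq (fun x => gn n x - g x) by exact: sqB.
rewrite distrC -IntB; [|exact: sq_mul (sgn n) sqh|exact: sq_mul].
have dC : Int (fun x => (gn n x - g x) ^+ 2) <= 4 * C.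
  have i1 := (sgn n).2.
  apply: (@le_trans _ _ (Int (fun x => 2 * gn n x ^+ 2 + 2 * g x ^+ 2))).
    apply: Int_le; [exact: smn.2|by apply: itgD; exact: itgZ|].
    by move=> x; have := sqr_ge0 (gn n x + g x); rewrite sqrrD sqrrB => *; lra.
  rewrite IntD ?IntZ//; [|exact: itgZ|exact: itgZ].
  have := gnC n; lra.
have i3 : itg (fun x => d * (gn n x - g x) ^+ 2) by apply: itgZ; exact: smn.2.
apply: (@le_trans _ _ (Int (fun x => d * (gn n x - g x) ^+ 2 + mn n x))).
  apply: Int_abs_le.
  - by apply: itgB; [exact: sq_mul (sgn n) sqh|exact: sq_mul].
  - exact: itgD.
  - move=> x; rewrite -mulrBl normrM -[(_ - _) ^+ 2]real_normK ?num_real//; exact: split_young_ineq.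
rewrite IntD// IntZ; last exact: smn.2.
have -> : e = d * (4 * (C + 1)) + e / 2 by rewrite /d; field; rewrite gt_eqF// ltr_wpDl.
rewrite lerD ?(le_trans (ler_norm _) hn)// ler_wpM2l// ?(ltW d0)//; lra.
Qed.

(** The Schur test applied to the autocorrelation of the kernel, that is to A^T A
    for the operator A with kernel K.  If Int K x t * K x s dx is dominated by a
    symmetric P with Int P t <= C, then the squared norm of A g is at most C times
    that of g.  The bounds B, M and Bp justify the interchanges of integrals. *)
Section Schur.
Context (K : R -> R -> R) (P : R -> R -> R) (B M C Bp : R) (g : R -> R).
Context (mK : mfun2 K).
Context (KB : forall x t, `|K x t| <= B).
Context (iK2 : forall t, itg (fun x => K x t ^+ 2)).
Context (KM : forall t, Int (fun x => K x t ^+ 2) <= M).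
Context (mP : mfun2 P).
Context (Psym : forall t s, P t s = P s t).
Context (P0 : forall t s, 0 <= P t s).
Context (PB : forall t s, P t s <= Bp).
Context (iP : forall t, itg (P t)).
Context (PC : forall t, Int (P t) <= C).
Context (KP : forall t s, `|Int (fun x => K x t * K x s)| <= P t s).
Context (ig : itg g).
Context (sg : sq g).

Let sK t : sq (fun x => K x t).
Proof. by split; [exact: (mfun2_col t mK)|exact: iK2]. Qed.

Let schur_G (h : R -> R) : itg h -> forall L, mfun2 L -> (forall x t, `|L x t| = `|K x t|) -> forall t,
  itg2 (fun s x => L x s * h s * L x t).
Proof.
move=> ih L mL LK t.
have mL2 : mfun2 (fun s x => L x s * h s * L x t).
  apply: measurable_funM; first apply: measurable_funM.
  - exact: (mfun2_swap mL).
  - by apply: mfun2_fst; exact: itg_m.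
  - exact: (mfun2_snd (mfun2_col t mL)).
have sL s : sq (fun x => L x s).
  by apply: sq_le (sK s) _; [exact: (mfun2_col s mL)|move=> x; rewrite LK].
have iL s : itg (fun x => L x s * h s * L x t).
  by apply: eq_itg (itgZ (h s) (sq_mul (sL s) (sL t))) => x; ring.
apply: (itg2_bound (G := fun s => 2 * M * `|h s|)) => //.
  by apply: itgZ; exact: itg_norm.
move=> s; apply: (@le_trans _ _ (Int (fun x => `|h s| * (K x s ^+ 2 + K x t ^+ 2)))).
  apply: Int_le; first exact: itg_norm.
    by apply: itgZ; apply: itgD; exact: iK2.
  by move=> x; rewrite !normrM !LK [_ * `|h s|]mulrC -mulrA ler_wpM2l// -normrM normM_le.
rewrite IntZ; last by apply: itgD; exact: iK2.
rewrite IntD; [|exact: iK2|exact: iK2].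
rewrite [leRHS]mulrC ler_wpM2l//; have := KM s; have := KM t; lra.
Qed.

Let G x := Int (fun t => K x t * g t).

Lemma schur_bound : sq G /\ Int (fun x => G x ^+ 2) <= C * Int (fun t => g t ^+ 2).
Proof.
have mg := itg_m ig.
have mG : mfun G.
  by apply: mfun_Int; apply: measurable_funM => //; apply: mfun2_snd.
have iKg x : itg (fun t => K x t * g t).
  apply: itg_le (itgZ B (itg_norm ig)) _.
    by apply: measurable_funM => //; exact: (mfun2_row x mK).
  by move=> t; rewrite normrM ler_wpM2r.
have c1 t := schur_G ig mK (fun x t => erefl) t.
have c2 t := schur_G (itg_norm ig) (L := fun x t => `|K x t|) (measurableT_comp (@normr_measurable _ _) mK) (fun x t => normr_id _) t.
have GK t x : Int (fun s => K x s * g s * K x t) = G x * K x t.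
  rewrite /G mulrC -IntZ//; by apply: eq_Int => s; rewrite mulrC.
have GK' t x : Int (fun s => `|K x s| * `|g s| * `|K x t|) = Int (fun s => `|K x s * g s|) * `|K x t|.
  rewrite [RHS]mulrC -IntZ; last exact: itg_norm.
  by apply: eq_Int => s; rewrite normrM mulrC.
(* A^T A g is the integral of g against the autocorrelation. *)
have cE t : Int (fun x => G x * K x t) = Int (fun s => g s * Int (fun x => K x s * K x t)).
  rewrite -(eq_Int (GK t)) -(Fubini_Int (c1 t)).
  apply: eq_Int => s; rewrite -IntZ; last exact: sq_mul.
  by apply: eq_Int => x; ring.
have M0 : 0 <= M by apply: le_trans (KM 0); apply: Int_ge0 => x; exact: sqr_ge0.
have iGK t : itg (fun x => G x * K x t).
  exact: (eq_itg (GK t) (itg2_Int (itg2_swap (c1 t)))).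
have GKle t : Int (fun x => `|G x * K x t|) <= 2 * M * Int (fun s => `|g s|).
  have i1 : itg (fun x => Int (fun s => `|K x s * g s|) * `|K x t|).
    exact: (eq_itg (GK' t) (itg2_Int (itg2_swap (c2 t)))).
  apply: (@le_trans _ _ (Int (fun x => Int (fun s => `|K x s * g s|) * `|K x t|))).
    apply: Int_le => //; first exact: itg_norm.
    by move=> x; rewrite normrM ler_wpM2r//; exact: Int_abs.
  rewrite -(eq_Int (GK' t)) -(Fubini_Int (c2 t)) -IntZ; last exact: itg_norm.
  apply: Int_le; first exact: (itg2_Int (c2 t)).
    by apply: itgZ; exact: itg_norm.
  move=> s; apply: (@le_trans _ _ (Int (fun x => `|g s| * (K x s ^+ 2 + K x t ^+ 2)))).
    apply: Int_le.
    - have := sq_mul (sq_le (measurableT_comp (@normr_measurable _ _) (sK s).1) (sK s) (fun x => _)) (sq_le (measurableT_comp (@normr_measurable _ _) (sK t).1) (sK t) (fun x => _)).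
      move=> h; apply: eq_itg (itgZ `|g s| (h _ _)) => x /=; rewrite ?normr_id//; ring.
    - by apply: itgZ; apply: itgD; exact: iK2.
    by move=> x; rewrite [_ * `|g s|]mulrC -mulrA ler_wpM2l// -normrM normM_le.
  rewrite IntZ; last by apply: itgD; exact: iK2.
  rewrite IntD; [|exact: iK2|exact: iK2].
  rewrite [leRHS]mulrC ler_wpM2l//; have := KM s; have := KM t; lra.
have i3 : itg2 (fun t x => G x * K x t * g t).
  apply: (itg2_bound (G := fun t => 2 * M * Int (fun s => `|g s|) * `|g t|)).
  - apply: measurable_funM; last exact: mfun2_fst.
    by apply: measurable_funM; [exact: mfun2_snd|exact: (mfun2_swap mK)].
  - by move=> t; apply: eq_itg (itgZ (g t) (iGK t)) => x; rewrite mulrC.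
  - by apply: itgZ; exact: itg_norm.
  - move=> t; rewrite (eq_Int (g := fun x => `|g t| * `|G x * K x t|)); last by move=> x; rewrite normrM mulrC.
    by rewrite IntZ; [rewrite mulrC ler_wpM2r|exact: itg_norm].
have GGE x : Int (fun t => G x * K x t * g t) = G x ^+ 2.
  rewrite expr2 {2}/G -IntZ//; by apply: eq_Int => t; rewrite mulrA.
have iG2 : itg (fun x => G x ^+ 2) := eq_itg GGE (itg2_Int (itg2_swap i3)).
split; first by [].
rewrite -(eq_Int GGE) -(Fubini_Int i3).
have ic t : itg (fun s => g s * Int (fun x => K x s * K x t)).
  apply: eq_itg (itg2_Int (c1 t)) => s; rewrite -IntZ; last exact: sq_mul.
  by apply: eq_Int => x; ring.
have C0 : 0 <= C by apply: le_trans (PC 0); exact: Int_ge0.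
(* |g t g s| P t s <= F t s + F s t, by the inequality of the arithmetic
   and geometric means and the symmetry of P. *)
pose F t s := 2^-1 * g t ^+ 2 * P t s.
have iF : itg2 F.
  apply: (itg2_bound (G := fun t => 2^-1 * C * g t ^+ 2)).
  - apply: measurable_funM => //; apply: (mfun2_fst (f := fun t => 2^-1 * g t ^+ 2)).
    by apply: measurable_funM => //; exact: measurable_funX.
  - by move=> t; exact: itgZ.
  - by apply: itgZ; exact: sg.2.
  - move=> t; rewrite (eq_Int (g := fun s => 2^-1 * g t ^+ 2 * P t s)); last first.
      by move=> s; rewrite ger0_norm// mulr_ge0// mulr_ge0// sqr_ge0.
    by rewrite IntZ// [leRHS]mulrAC ler_wpM2l// mulr_ge0// sqr_ge0.
have iF1 t : itg (F t) by apply: itgZ.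
have iF2 t : itg (fun s => F s t).
  apply: itg_le (itgZ (2^-1 * Bp) sg.2) _.
    apply: measurable_funM; first by apply: measurable_funM => //; exact: measurable_funX.
    exact: (mfun2_col t mP).
  move=> s; rewrite ger0_norm; last by rewrite /F mulr_ge0// mulr_ge0// sqr_ge0.
  by rewrite /F mulrAC ler_wpM2r ?sqr_ge0// ler_wpM2l.
have iFF : itg (fun t => Int (fun s => F t s) + Int (fun s => F s t)).
  by apply: itgD; [exact: (itg2_Int iF)|exact: (itg2_Int (itg2_swap iF))].
apply: (@le_trans _ _ (Int (fun t => Int (fun s => F t s) + Int (fun s => F s t)))).
  apply: Int_le => //; first exact: (itg2_Int i3).
  move=> t; rewrite (eq_Int (g := fun x => g t * (G x * K x t))); last by move=> x; rewrite mulrC.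
  rewrite IntZ// cE -IntD//.
  rewrite -IntZ//; apply: Int_le => //; [exact: itgZ|exact: itgD|].
  move=> s; rewrite (le_trans (ler_norm _))// !normrM.
  have KPs : `|Int (fun x => K x s * K x t)| <= P t s by rewrite Psym.
  apply: (@le_trans _ _ (`|g t| * `|g s| * P t s)).
    by rewrite mulrA ler_wpM2l// mulr_ge0.
  rewrite /F [P s t]Psym -mulrDl ler_wpM2r// -mulrDr.
  have := sqr_ge0 (`|g t| - `|g s|); rewrite sqrrB !real_normK ?num_real// => *; lra.
rewrite IntD; [|exact: (itg2_Int iF)|exact: (itg2_Int (itg2_swap iF))].
rewrite -(Fubini_Int iF).
have : Int (fun t => Int (F t)) <= Int (fun t => 2^-1 * C * g t ^+ 2).
  apply: Int_le; [exact: (itg2_Int iF)|by apply: itgZ; exact: sg.2|].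
  by move=> t; rewrite /F IntZ// [leRHS]mulrAC ler_wpM2l// mulr_ge0// sqr_ge0.
rewrite IntZ; last exact: sg.2.
set I1 := Int (fun t => Int (F t)); set I2 := Int _; lra.
Qed.
End Schur.
End L2tools.

(** * The conjugate Poisson kernel and Bessel's inequality *)
Section L2bounds.
Context {R : realType}.
Local Notation mu := (@lebesgue_measure R).
Implicit Types f g h F : R -> R.

Lemma cvg_invn : (n%:R : R)^-1 @[n --> \oo] --> (0 : R).
Proof.
apply/gtr0_cvgV0; last exact: cvg_nat_pinfty.
by near=> n; rewrite ltr0n; near: n; exact: nbhs_infty_gt.
Unshelve. all: by end_near. Qed.

(** The two logarithms of a primitive by partial fractions diverge at infinity; the
    difference to 2 ln n makes their cancellation visible. *)
Lemma cvg_ln_quad (e t s : R) : s ^+ 2 = 1 ->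
  ln ((s * n%:R - t) ^+ 2 + e ^+ 2) - 2 * ln n%:R @[n --> \oo] --> (0 : R).
Proof.
move=> s1.
pose a (r : R) := (s - t * r) ^+ 2 + (e * r) ^+ 2.
have ca : a (n%:R^-1) @[n --> \oo] --> (1 : R).
  have a1 : a 0 = 1 by rewrite /a !mulr0 subr0 s1 expr0n addr0.
  rewrite -[X in _ --> X]a1; apply: (cvg_comp _ a cvg_invn); apply: derivable_continuous => r; rewrite /a; exact: ex_derive.
have cl : ln (a (n%:R^-1)) @[n --> \oo] --> (0 : R).
  by rewrite -(ln1 R); apply: continuous_cvg ca; exact: continuous_ln.
apply: cvg_trans cl; apply: near_eq_cvg; near=> n.
have n0 : (0 : R) < n%:R by rewrite ltr0n; near: n; exact: nbhs_infty_gt.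
have an0 : 0 < a n%:R^-1.
  by near: n; apply: (cvgr_gt _ ca); rewrite ltr01.
rewrite (_ : (s * n%:R - t) ^+ 2 + e ^+ 2 = n%:R ^+ 2 * a n%:R^-1); last by rewrite /a; field; rewrite gt_eqF.
rewrite lnM ?posrE ?exprn_gt0// lnXn// -mulr_natl; ring.
Unshelve. all: by end_near. Qed.

(** The conjugate Poisson kernel without its factor 1 / pi: the real part of
    1 / (x + i e), a regularization of 1 / x. *)
Definition conjP (e x : R) : R := x / (x ^+ 2 + e ^+ 2).

Lemma Qden_gt0 (e x : R) : 0 < e -> 0 < x ^+ 2 + e ^+ 2.
Proof. by move=> e0; rewrite ltr_wpDl ?sqr_ge0 ?exprn_gt0. Qed.

Lemma conjP_le (e x : R) : 0 < e -> `|conjP e x| <= e^-1.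
Proof.
move=> e0; have d0 := Qden_gt0 x e0.
rewrite normrM normfV (gtr0_norm d0) ler_pdivrMr// mulrC ler_pdivlMr//.
rewrite -[x ^+ 2]real_normK ?num_real//.
by have := sqr_ge0 (`|x| - e); have := sqr_ge0 (`|x| + e); rewrite sqrrB sqrrD => *; lra.
Qed.

Lemma mfun_conjP e : mfun (conjP e).
Proof.
by apply: measurable_funM => //; apply: mfunV; apply: measurable_funD => //; exact: measurable_funX.
Qed.

Lemma mfun2_sub : mfun2 (fun x t : R => x - t).
Proof. by apply: measurable_funB; [exact: measurable_fst|exact: measurable_snd]. Qed.

Lemma mfun2_conjP e : mfun2 (fun x t => conjP e (x - t)).
Proof. exact: (measurableT_comp (mfun_conjP e) mfun2_sub). Qed.

Lemma conjP2_le (e x : R) : 0 < e -> conjP e x ^+ 2 <= e^-1 * poisson e x.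
Proof.
move=> e0; have d0 := Qden_gt0 x e0.
rewrite /conjP /poisson expr_div_n (_ : e^-1 * _ = (e ^+ 2 + x ^+ 2) / (x ^+ 2 + e ^+ 2) ^+ 2).
  by rewrite ler_pM2r ?invr_gt0 ?exprn_gt0// lerDr sqr_ge0.
by field; rewrite !gt_eqF// addrC.
Qed.

Lemma conjP2_int (e t : R) : 0 < e -> itg (fun x => conjP e (x - t) ^+ 2) /\ Int (fun x => conjP e (x - t) ^+ 2) <= e^-1 * pi.
Proof.
move=> e0; have [ip Ip] := poisson_int t e0.
have iQ : itg (fun x => conjP e (x - t) ^+ 2).
  apply: itg_le (itgZ e^-1 ip) _.
    by apply: measurable_funX; exact: (mfun2_col t (mfun2_conjP e)).
  by move=> x; rewrite ger0_norm ?sqr_ge0// conjP2_le.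
split => //; rewrite -Ip -IntZ//; apply: Int_le => //; first exact: itgZ.
by move=> x; rewrite conjP2_le.
Qed.

Lemma sq_conjP (e t : R) : 0 < e -> sq (fun x => conjP e (x - t)).
Proof. by move=> e0; split; [exact: (mfun2_col t (mfun2_conjP e))|exact: (conjP2_int t e0).1]. Qed.

Lemma conjP_odd (e x : R) : conjP e (- x) = - conjP e x.
Proof. by rewrite /conjP sqrrN mulNr. Qed.

Lemma sq_conjP_row (e x : R) : 0 < e -> sq (fun t => conjP e (x - t)).
Proof.
move=> e0; apply: sq_le (sq_conjP x e0) _; first exact: (mfun2_row x (mfun2_conjP e)).
by move=> t; rewrite -opprB conjP_odd normrN.
Qed.

Lemma continuous_conjP e t : 0 < e -> continuous (fun x => conjP e (x - t)).
Proof.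
move=> e0; apply: (continuous_mul (F := fun x => x - t)); first by apply: derivable_continuous => x; exact: ex_derive.
apply: continuous_inv => x; last by rewrite gt_eqF// Qden_gt0.
by apply: derivable_continuous => y; exact: ex_derive.
Qed.

Lemma cvg_atan_shift (e t s : R) : 0 < e -> (s = 1) \/ (s = -1) -> 
  atan ((s * n%:R - t) / e) @[n --> \oo] --> s * (pi / 2).
Proof.
move=> e0 [->|->].
  rewrite mul1r; apply: cvg_atan_pinfty.
  rewrite (_ : (fun n => _) = (fun n => e^-1 * n%:R + (- t / e))).
    by apply: cvg_affine_pinfty; rewrite invr_gt0.
  by apply/funext => n; field; rewrite gt_eqF.
rewrite mulN1r (_ : (fun n => _) = (fun n : nat => - atan (e^-1 * n%:R + t / e))).
  by apply: cvgN; apply: cvg_atan_pinfty; apply: cvg_affine_pinfty; rewrite invr_gt0.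
by apply/funext => n; rewrite -atanN; congr atan; field; rewrite gt_eqF.
Qed.

Lemma is_derive_ln_quad (e t x : R) : 0 < e ->
  is_derive x (1 : R) (fun x => ln ((x - t) ^+ 2 + e ^+ 2)) (2 * (x - t) / ((x - t) ^+ 2 + e ^+ 2)).
Proof.
move=> e0; have d0 := Qden_gt0 (x - t) e0.
have dl := @is_derive1_ln R _ d0.
apply: is_derive_eq; rewrite /GRing.scale/=; field; by rewrite gt_eqF.
Qed.

Lemma cvg_conjP_shift (e t s : R) : s ^+ 2 = 1 -> conjP e (s * n%:R - t) @[n --> \oo] --> (0 : R).
Proof.
move=> s1.
pose a (r : R) := (s - t * r) ^+ 2 + (e * r) ^+ 2; pose b (r : R) := r * (s - t * r).
have ca : a (n%:R^-1) @[n --> \oo] --> (1 : R).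
  have a1 : a 0 = 1 by rewrite /a !mulr0 subr0 s1 expr0n addr0.
  rewrite -[X in _ --> X]a1; apply: (cvg_comp _ a cvg_invn); apply: derivable_continuous => r; rewrite /a; exact: ex_derive.
have cb : b (n%:R^-1) @[n --> \oo] --> (0 : R).
  have b0 : b 0 = 0 by rewrite /b mul0r.
  rewrite -[X in _ --> X]b0; apply: (cvg_comp _ b cvg_invn); apply: derivable_continuous => r; rewrite /b; exact: ex_derive.
have : b (n%:R^-1) * (a (n%:R^-1))^-1 @[n --> \oo] --> (0 * 1^-1 : R).
  by apply: cvgM => //; apply: cvgV => //; exact: oner_neq0.
rewrite mul0r; apply: cvg_trans; apply: near_eq_cvg; near=> n.
have n0 : (0 : R) < n%:R by rewrite ltr0n; near: n; exact: nbhs_infty_gt.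
have an0 : 0 < a n%:R^-1.
  by near: n; apply: (cvgr_gt _ ca); rewrite ltr01.
rewrite /conjP (_ : (s * n%:R - t) ^+ 2 + e ^+ 2 = n%:R ^+ 2 * a n%:R^-1); last by rewrite /a; field; rewrite gt_eqF.
by rewrite /b; field; rewrite !gt_eqF.
Unshelve. all: by end_near. Qed.

(** The conjugate Poisson kernel has the same autocorrelation as the Poisson kernel:
    its Fourier transform has the same modulus.  Here the integral is evaluated by
    partial fractions, separately for s = t, where the poles are double. *)
Lemma conjP_autocorrelation (e t s : R) : 0 < e ->
  Int (fun x => conjP e (x - t) * conjP e (x - s)) = pi * poisson (2 * e) (t - s).
Proof.
move=> e0; have [->|ts] := eqVneq s t.
  pose F x := - (x - t) / (2 * ((x - t) ^+ 2 + e ^+ 2)) + (2 * e)^-1 * atan ((x - t) / e).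
  have dF (x : R) : is_derive x (1 : R) F (conjP e (x - t) * conjP e (x - t)).
    have d0 : 2 * ((x - t) ^+ 2 + e ^+ 2) != 0 by rewrite gt_eqF// mulr_gt0// Qden_gt0.
    have dV := is_deriveV d0.
    have da := is_derive_atan_div t x e0.
    apply: is_derive_eq; rewrite /GRing.scale/= /conjP /poisson.
    have d1 := Qden_gt0 (x - t) e0.
    by field; rewrite !gt_eqF// addrC.
  have lim (s' : R) : s' = 1 \/ s' = -1 -> F (s' * n%:R) @[n --> \oo] --> 0 + (2 * e)^-1 * (s' * (pi / 2)).
    move=> s1; apply: cvgD; last by apply: cvgMr; exact: cvg_atan_shift.
    have s2 : s' ^+ 2 = 1 by case: s1 => ->; rewrite ?sqrrN expr1n.
    rewrite -(mulr0 (- 2^-1 : R)).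
    rewrite (_ : (fun n => _) = (fun n : nat => (- 2^-1) * conjP e (s' * n%:R - t))); last first.
      by apply/funext => n; rewrite /conjP; field; rewrite gt_eqF// Qden_gt0.
    by apply: cvgMr; exact: cvg_conjP_shift.
  rewrite (FTC_T (lp := 0 + (2 * e)^-1 * (1 * (pi / 2))) (lm := 0 + (2 * e)^-1 * (-1 * (pi / 2))) dF).
  - by rewrite subrr /poisson; field; rewrite ?gt_eqF.
  - by apply: continuous_mul; exact: continuous_conjP.
  - exact: (sq_mul (sq_conjP t e0) (sq_conjP t e0)).
  - by under eq_fun do rewrite -[n in F n]mul1r; apply: lim; left.
  - by under eq_fun do rewrite -mulN1r; apply: lim; right.
(* al and be are the coefficients of the partial fraction decomposition,
   that of the logarithms being opposite for t and s. *)
pose u := s - t; have u0 : u != 0 by rewrite subr_eq0.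
pose be := e ^+ 2 / (u ^+ 2 + 4 * e ^+ 2).
pose al := - (u ^+ 2 + 2 * e ^+ 2) / (u * (u ^+ 2 + 4 * e ^+ 2)).
have D0 : u ^+ 2 + 4 * e ^+ 2 != 0 by rewrite gt_eqF// ltr_wpDl ?sqr_ge0// mulr_gt0// exprn_gt0.
pose F x := al / 2 * (ln ((x - t) ^+ 2 + e ^+ 2) - ln ((x - s) ^+ 2 + e ^+ 2)) + be / e * (atan ((x - t) / e) + atan ((x - s) / e)).
have dF (x : R) : is_derive x (1 : R) F (conjP e (x - t) * conjP e (x - s)).
  have da := is_derive_atan_div t x e0; have da' := is_derive_atan_div s x e0.
  have dl := is_derive_ln_quad t x e0; have dl' := is_derive_ln_quad s x e0.
  apply: is_derive_eq; rewrite /GRing.scale/= /conjP /poisson /al /be.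
  have d1 := Qden_gt0 (x - t) e0; have d2 := Qden_gt0 (x - s) e0.
  rewrite ![e ^+ 2 + (_ - _) ^+ 2]addrC.
  have -> : x - s = x - t - u by rewrite /u; ring.
  have d2' : (x - t - u) ^+ 2 + e ^+ 2 != 0.
    by rewrite (_ : x - t - u = x - s) ?gt_eqF//; rewrite /u; ring.
  set z := x - t in d1 d2' *.
  by field; rewrite d2' u0 D0 !gt_eqF.
have lim (s' : R) : s' = 1 \/ s' = -1 -> F (s' * n%:R) @[n --> \oo] --> al / 2 * (0 - 0) + be / e * (s' * (pi / 2) + s' * (pi / 2)).
  move=> s1; have s2 : s' ^+ 2 = 1 by case: s1 => ->; rewrite ?sqrrN expr1n.
  apply: cvgD; last by apply: cvgMr; apply: cvgD; exact: cvg_atan_shift.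
  apply: cvgMr; rewrite (_ : (fun n => _) = (fun n : nat => (ln ((s' * n%:R - t) ^+ 2 + e ^+ 2) - 2 * ln n%:R) - (ln ((s' * n%:R - s) ^+ 2 + e ^+ 2) - 2 * ln n%:R))).
    by apply: cvgB; exact: cvg_ln_quad.
  by apply/funext => n; ring.
rewrite (FTC_T (lp := al / 2 * (0 - 0) + be / e * (1 * (pi / 2) + 1 * (pi / 2))) (lm := al / 2 * (0 - 0) + be / e * (-1 * (pi / 2) + -1 * (pi / 2))) dF).
- rewrite /poisson -[t - s]opprB -/u sqrrN /be; field.
  by rewrite gt_eqF ?gt_eqF//= ltr_wpDr ?sqr_ge0// exprn_gt0// mulr_gt0.
- by apply: continuous_mul; exact: continuous_conjP.
- exact: (sq_mul (sq_conjP t e0) (sq_conjP s e0)).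
- by under eq_fun do rewrite -[n in F n]mul1r; apply: lim; left.
- by under eq_fun do rewrite -mulN1r; apply: lim; right.
Qed.

Lemma poisson_sym (e x : R) : poisson e (- x) = poisson e x.
Proof. by rewrite /poisson sqrrN. Qed.

Lemma poisson_le (e x : R) : 0 < e -> poisson e x <= e^-1.
Proof.
move=> e0; rewrite /poisson ler_pdivrMr ?ltr_wpDr ?sqr_ge0 ?exprn_gt0//.
rewrite mulrDr expr2 mulKf ?gt_eqF// lerDl mulr_ge0 ?sqr_ge0// invr_ge0 ltW//.
Qed.

Lemma mfun_poisson (e : R) : mfun (poisson e).
Proof. by apply: measurable_funM => //; apply: mfunV; apply: measurable_funD => //; exact: measurable_funX. Qed.

Lemma mfun2_poisson (e : R) : mfun2 (fun x t => poisson e (x - t)).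
Proof. exact: (measurableT_comp (mfun_poisson e) mfun2_sub). Qed.

Lemma sq_poisson (e b : R) : 0 < e -> sq (fun y => poisson e (y - b)).
Proof.
move=> e0; split; first exact: (mfun2_col b (mfun2_poisson e)).
apply: itg_le (itgZ e^-1 (poisson_int b e0).1) _.
  by apply: measurable_funX; exact: (mfun2_col b (mfun2_poisson e)).
by move=> y; rewrite ger0_norm ?sqr_ge0// expr2 ler_wpM2r ?poisson_ge0// poisson_le.
Qed.

(** The regularized Hilbert transform, not divided by pi. *)
Definition Hilbert_reg (e : R) (g : R -> R) (x : R) : R := Int (fun t => conjP e (x - t) * g t).

Lemma mfun_Hilbert_reg e g : mfun g -> mfun (Hilbert_reg e g).
Proof.
by move=> mg; apply: mfun_Int; apply: measurable_funM; [exact: mfun2_conjP|exact: (mfun2_snd mg)].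
Qed.

(** The Schur test with the autocorrelation pi * poisson (2 e), of mass pi^2: the
    bound does not depend on e. *)
Lemma Hilbert_reg_bound1 (e : R) g : 0 < e -> itg g -> sq g ->
  sq (Hilbert_reg e g) /\ Int (fun x => Hilbert_reg e g x ^+ 2) <= pi ^+ 2 * Int (fun t => g t ^+ 2).
Proof.
move=> e0 ig sg; have p0 := pi_ge0 R; have e20 : 0 < 2 * e by rewrite mulr_gt0.
apply: (@schur_bound R (fun x t => conjP e (x - t)) (fun t s => pi * poisson (2 * e) (t - s))
  e^-1 (e^-1 * pi) (pi ^+ 2) (pi * (2 * e)^-1) g) => //.
- exact: mfun2_conjP.
- by move=> x t; exact: conjP_le.
- by move=> t; exact: (conjP2_int t e0).1.
- by move=> t; exact: (conjP2_int t e0).2.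
- by apply: measurable_funM => //; exact: mfun2_poisson.
- by move=> t s; rewrite -opprB poisson_sym.
- by move=> t s; rewrite mulr_ge0 ?poisson_ge0.
- by move=> t s; rewrite ler_wpM2l// poisson_le.
- move=> t; apply: itgZ; apply: eq_itg (poisson_int t e20).1 => s.
  by rewrite -[in LHS]opprB poisson_sym.
- move=> t; rewrite IntZ; last by apply: eq_itg (poisson_int t e20).1 => s; rewrite -[in LHS]opprB poisson_sym.
  rewrite expr2 (eq_Int (g := fun s => poisson (2 * e) (s - t))); last by move=> s; rewrite -[in LHS]opprB poisson_sym.
  by rewrite (poisson_int t e20).2.
- by move=> t s; rewrite conjP_autocorrelation// ger0_norm// mulr_ge0 ?poisson_ge0.
Qed.

Definition trunc (n : nat) (g : R -> R) (x : R) : R := g x * \1_(`[- (n%:R : R), n%:R]%classic) x.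

Lemma trunc_le n g x : `|trunc n g x| <= `|g x|.
Proof. by rewrite normrM ler_piMr// indicE; case: (_ \in _); rewrite ?normr1 ?normr0. Qed.

Lemma sq_trunc n g : sq g -> sq (trunc n g).
Proof.
move=> sg; have mg := sg.1; apply: (sq_le _ sg (trunc_le n g)).
by apply: measurable_funM => //; exact: mfun_indic.
Qed.

Lemma itg_indic_itv n : itg (\1_(`[- (n%:R : R), n%:R]%classic) : R -> R).
Proof. exact: integrable_indic_itv. Qed.

Lemma itg_trunc n g : sq g -> itg (trunc n g).
Proof.
move=> sg; apply: sq_mul => //; split; first exact: mfun_indic.
by apply: eq_itg (itg_indic_itv n) => x; rewrite indicE; case: (_ \in _); rewrite ?expr1n ?expr0n.
Qed.

Lemma Int_trunc2_le n g : sq g -> Int (fun x => trunc n g x ^+ 2) <= Int (fun x => g x ^+ 2).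
Proof.
move=> sg; apply: Int_le; [exact: (sq_trunc n sg).2|exact: sg.2|].
move=> x; rewrite -[leRHS]real_normK ?num_real// -[leLHS]real_normK ?num_real//.
by rewrite lerXn2r ?nnegrE// trunc_le.
Qed.

Lemma cvg_trunc g x : trunc n g x @[n --> \oo] --> g x.
Proof. exact: itvT_cvg. Qed.

(** From the truncations of g to [-n, n], which are integrable, by Fatou's lemma. *)
Lemma Hilbert_reg_bound (e : R) g : 0 < e -> sq g ->
  sq (Hilbert_reg e g) /\ Int (fun x => Hilbert_reg e g x ^+ 2) <= pi ^+ 2 * Int (fun t => g t ^+ 2).
Proof.
move=> e0 sg; have p0 := pi_ge0 R.
have B n := Hilbert_reg_bound1 e0 (itg_trunc n sg) (sq_trunc n sg).
have sQ x := sq_conjP_row x e0.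
have [||||||i2 I2] := @fatou_Int R (fun n x => Hilbert_reg e (trunc n g) x ^+ 2) (fun x => Hilbert_reg e g x ^+ 2) (pi ^+ 2 * Int (fun t => g t ^+ 2)).
- by move=> n; exact: (B n).1.2.
- by apply: measurable_funX; apply: mfun_Hilbert_reg; exact: sg.1.
- by move=> n x; exact: sqr_ge0.
- by move=> x; exact: sqr_ge0.
- by move=> n; apply: le_trans (B n).2 _; rewrite ler_wpM2l ?sqr_ge0// Int_trunc2_le.
- apply: (aeW mu) => x; rewrite expr2; under eq_cvg do rewrite expr2.
  suff : Hilbert_reg e (trunc n g) x @[n --> \oo] --> Hilbert_reg e g x by move=> h; exact: cvgM.
  apply: (dct (g := fun t => `|conjP e (x - t) * g t|)).
  + by move=> n; apply: measurable_funM; [exact: (sQ x).1|exact: (sq_trunc n sg).1].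
  + by apply: measurable_funM; [exact: (sQ x).1|exact: sg.1].
  + by apply: itg_norm; exact: sq_mul.
  + by move=> n t; rewrite [leLHS]normrM [leRHS]normrM ler_wpM2l// trunc_le.
  + by apply: (aeW mu) => t; apply: cvgMr; exact: cvg_trunc.
by split => //; split => //; apply: mfun_Hilbert_reg; exact: sg.1.
Qed.

(** The Fourier integral of v in real form: the phase gam(tau) carries the argument
    of the complex amplitude. *)
Definition cosint (v gam : R -> R) (y : R) : R := Int (fun tau => v tau * cos (tau * y + gam tau)).

Lemma mfun2_cos (gam : R -> R) : mfun gam -> mfun2 (fun y tau : R => cos (tau * y + gam tau)).
Proof.
move=> mg; apply: mfun_cos; apply: measurable_funD; last exact: (mfun2_snd mg).
by apply: measurable_funM; [exact: measurable_snd|exact: measurable_fst].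
Qed.

Lemma mfun_cosint (v gam : R -> R) : mfun v -> mfun gam -> mfun (cosint v gam).
Proof.
by move=> mv mg; apply: mfun_Int; apply: measurable_funM; [exact: (mfun2_snd mv)|exact: mfun2_cos].
Qed.

Lemma mfun_expabs (e : R) : mfun (fun y : R => expR (- (e * `|y|))).
Proof. by apply: mfun_exp; apply: measurableT_comp => //; apply: measurable_funM. Qed.

(** With the convergence factor e^(-e|y|), the autocorrelation of the kernel
    cos (tau y + gam tau) is dominated by two Poisson kernels of mass pi, at t - s
    and at t + s, so the Schur test yields the constant 2 pi. *)
Lemma bessel1 (e : R) (v gam : R -> R) : 0 < e -> itg v -> sq v -> mfun gam ->
  sq (fun y => expR (- (e * `|y|)) * cosint v gam y) /\
  Int (fun y => (expR (- (e * `|y|)) * cosint v gam y) ^+ 2) <= (pi + pi) * Int (fun t => v t ^+ 2).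
Proof.
move=> e0 iv sv mg; have e20 : 0 < 2 * e by rewrite mulr_gt0.
pose K (y tau : R) := expR (- (e * `|y|)) * cos (tau * y + gam tau).
have KE y : expR (- (e * `|y|)) * cosint v gam y = Int (fun tau => K y tau * v tau).
  rewrite /cosint -IntZ.
    by apply: eq_Int => tau; rewrite /K; ring.
  apply: itg_le (itg_norm iv) _.
    by apply: measurable_funM; [exact: sv.1|exact: (mfun2_row y (mfun2_cos mg))].
  by move=> tau; rewrite normrM ler_piMr// cos_max.
rewrite (_ : (fun y => _ * _) = (fun y => Int (fun tau => K y tau * v tau))); last exact/funext.
rewrite (eq_Int (g := fun y => Int (fun tau => K y tau * v tau) ^+ 2)); last by move=> y; rewrite KE.
have mK : mfun2 K by apply: measurable_funM; [exact: (mfun2_fst (mfun_expabs e))|exact: mfun2_cos].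
have K1 y tau : `|K y tau| <= expR (- (e * `|y|)).
  by rewrite normrM (ger0_norm (expR_ge0 _)) ler_piMr ?expR_ge0// cos_max.
have E2 (y : R) : expR (- (e * `|y|)) ^+ 2 = expR (- ((2 * e) * `|y|)).
  by rewrite expr2 -expRD; congr expR; ring.
have K2 t : itg (fun y => K y t ^+ 2).
  apply: itg_le (itg_laplace e20) _; first by apply: measurable_funX; exact: (mfun2_col t mK).
  by move=> y; rewrite ger0_norm ?sqr_ge0// -E2 -[K _ _ ^+ 2]real_normK ?num_real// lerXn2r ?nnegrE ?expR_ge0.
pose P (t s : R) := poisson (2 * e) (t - s) + poisson (2 * e) (t + s).
have iP t : itg (fun s => poisson (2 * e) (t - s)) /\ itg (fun s => poisson (2 * e) (t + s)) /\
   Int (fun s => poisson (2 * e) (t - s)) = pi /\ Int (fun s => poisson (2 * e) (t + s)) = pi.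
  have [h1 h2] := poisson_int t e20; have [h3 h4] := poisson_int (- t) e20.
  have F1 s : poisson (2 * e) (s - t) = poisson (2 * e) (t - s) by rewrite -[in LHS]opprB poisson_sym.
  have F2 s : poisson (2 * e) (s - - t) = poisson (2 * e) (t + s) by rewrite opprK addrC.
  by rewrite -(eq_Int F1) -(eq_Int F2); split; [exact: eq_itg h1|split; [exact: eq_itg h3|]].
apply: (@schur_bound R K P 1 (Int (fun y => expR (- ((2 * e) * `|y|)))) (pi + pi) ((2 * e)^-1 + (2 * e)^-1) v) => //.
- move=> y t; apply: (le_trans (K1 _ _)); rewrite -expR0 ler_expR oppr_le0 mulr_ge0//; exact: ltW.
- move=> t; apply: Int_le => //; first exact: itg_laplace.
  by move=> y; rewrite -E2 -[K _ _ ^+ 2]real_normK ?num_real// lerXn2r ?nnegrE ?expR_ge0.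
- apply: measurable_funD; first exact: mfun2_poisson.
  apply: (measurableT_comp (mfun_poisson _)); apply: measurable_funD; [exact: measurable_fst|exact: measurable_snd].
- move=> t s; congr (_ + _); last by rewrite addrC.
  by rewrite -[t - s]opprB poisson_sym.
- by move=> t s; rewrite addr_ge0 ?poisson_ge0.
- by move=> t s; rewrite lerD ?poisson_le.
- by move=> t; apply: itgD; [exact: (iP t).1|exact: (iP t).2.1].
- by move=> t; rewrite IntD; [rewrite (iP t).2.2.1 (iP t).2.2.2|exact: (iP t).1|exact: (iP t).2.1].
- move=> t s.
  have [h1 h2] := laplace_cosT (t - s) (gam t - gam s) e20.
  have [h3 h4] := laplace_cosT (t + s) (gam t + gam s) e20.
  rewrite (eq_Int (g := fun y => 2^-1 * (expR (- ((2 * e) * `|y|)) * cos ((t - s) * y + (gam t - gam s)) + expR (- ((2 * e) * `|y|)) * cos ((t + s) * y + (gam t + gam s))))); last first.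
    move=> y; rewrite -E2 /K.
    have -> : (t - s) * y + (gam t - gam s) = (t * y + gam t) - (s * y + gam s) by ring.
    have -> : (t + s) * y + (gam t + gam s) = (t * y + gam t) + (s * y + gam s) by ring.
    by move: (t * y + gam t) (s * y + gam s) => p q; rewrite cosB cosD; field.
  rewrite IntZ; last exact: itgD.
  rewrite IntD// h2 h4 /P normrM ger0_norm ?invr_ge0// mulrC ler_pdivrMr//.
  have pb (a g : R) : `|2 * (2 * e) * cos g / ((2 * e) ^+ 2 + a ^+ 2)| <= poisson (2 * e) a * 2.
    have -> : 2 * (2 * e) * cos g / ((2 * e) ^+ 2 + a ^+ 2) = poisson (2 * e) a * 2 * cos g.
      by rewrite /poisson; ring.
    have p0 : 0 <= poisson (2 * e) a * 2 by rewrite mulr_ge0// poisson_ge0.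
    by rewrite normrM (ger0_norm p0) ler_piMr// cos_max.
  by apply: le_trans (ler_normD _ _) _; rewrite [leRHS]mulrDl; apply: lerD; exact: pb.
Qed.

(** Bessel's inequality for cosine integrals, from bessel1 by letting e tend to 0 in
    Fatou's lemma. *)
Lemma bessel (v gam : R -> R) : itg v -> sq v -> mfun gam ->
  sq (cosint v gam) /\ Int (fun y => cosint v gam y ^+ 2) <= (pi + pi) * Int (fun t => v t ^+ 2).
Proof.
move=> iv sv mg.
have e0 n : (0 : R) < n.+1%:R^-1 by rewrite invr_gt0.
have mH : mfun (cosint v gam) by apply: mfun_cosint => //; exact: itg_m.
have [||||||i2 I2] := @fatou_Int R (fun n y => (expR (- (n.+1%:R^-1 * `|y|)) * cosint v gam y) ^+ 2) (fun y => cosint v gam y ^+ 2) ((pi + pi) * Int (fun t => v t ^+ 2)).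
- by move=> n; exact: (bessel1 (e0 n) iv sv mg).1.2.
- exact: measurable_funX.
- by move=> n x; exact: sqr_ge0.
- by move=> x; exact: sqr_ge0.
- by move=> n; exact: (bessel1 (e0 n) iv sv mg).2.
- apply: (aeW mu) => y.
  pose F (r : R) := (expR (- (r * `|y|)) * cosint v gam y) ^+ 2.
  have -> : cosint v gam y ^+ 2 = F 0 by rewrite /F mul0r oppr0 expR0 mul1r.
  apply: (cvg_comp _ F); last by apply: derivable_continuous => r; rewrite /F; exact: ex_derive.
  exact: cvg_harmonic.
by [].
Qed.

End L2bounds.

(** * Logarithmic coordinates *)
Section LogCoordinates.
Context {R : realType}.
Local Notation mu := (@lebesgue_measure R).
Local Notation Rp := (`]0%R, +oo[%classic : set R).
Implicit Types f g h H v gam : R -> R.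

(** The isometry between L2(R+) and L2(R) given by x = e^y, and its inverse, which is
    extended by 0 to x <= 0. *)
Definition to_log g (y : R) : R := expR (y / 2) * g (expR y).
Definition of_log H (x : R) : R := expR (- (ln x / 2)) * H (ln x) * \1_Rp x.

Lemma Rp_expR (y : R) : \1_Rp (expR y) = 1 :> R.
Proof. by rewrite indicE mem_set//= in_itv/= expR_gt0. Qed.

Lemma expR_half2 (y : R) : expR (y / 2) * expR (y / 2) = expR y.
Proof. by rewrite -expRD; congr expR; field. Qed.

Lemma mfun_to_log g : mfun g -> mfun (to_log g).
Proof.
move=> mg; apply: measurable_funM; first by apply: mfun_exp; exact: measurable_funM.
exact: (measurableT_comp mg (@measurable_expR R)).
Qed.

Lemma mfun_Rp : mfun (\1_Rp : R -> R).
Proof. exact: mfun_indic. Qed.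

Lemma mfun_of_log H : mfun H -> mfun (of_log H).
Proof.
move=> mH; apply: measurable_funM; last exact: mfun_Rp.
apply: measurable_funM; last exact: (measurableT_comp mH (@measurable_ln R)).
by apply: mfun_exp; apply: measurableT_comp => //; apply: measurable_funM => //; exact: measurable_ln.
Qed.

Lemma of_logK H : to_log (of_log H) = H.
Proof.
apply/funext => y; rewrite /to_log /of_log expRK Rp_expR mulr1 mulrA -expRD subrr expR0 mul1r//.
Qed.

Lemma itg_log (F : R -> R) : mfun F ->
  itg (fun x => F x * \1_Rp x) <-> itg (fun y => F (expR y) * expR y).
Proof.
move=> mF; rewrite (itg_expR (ltr01) mF).
by split; apply: eq_itg => y; rewrite mul1r.
Qed.

Lemma Int_log (F : R -> R) : itg (fun x => F x * \1_Rp x) -> mfun F ->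
  Int (fun x => F x * \1_Rp x) = Int (fun y => F (expR y) * expR y).
Proof.
move=> iF mF; rewrite (Int_expR ltr01 iF mF).
by apply: eq_Int => y; rewrite mul1r.
Qed.

Lemma Rp2 (x : R) : \1_Rp x * \1_Rp x = \1_Rp x :> R.
Proof. by rewrite indicE; case: (_ \in _); rewrite ?mulr1 ?mulr0. Qed.

Lemma sq_Rp g : sq g -> sq (fun x => g x * \1_Rp x).
Proof.
move=> sg; have mg := sg.1; apply: (sq_le _ sg); first by apply: measurable_funM => //; exact: mfun_Rp.
by move=> x; rewrite normrM ler_piMr// indicE; case: (_ \in _); rewrite ?normr1 ?normr0.
Qed.

Lemma sq_to_log g : mfun g -> sq (fun x => g x * \1_Rp x) <-> sq (to_log g).
Proof.
move=> mg; have mg2 : mfun (fun x => g x ^+ 2) by exact: measurable_funX.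
have E x : (g x * \1_Rp x) ^+ 2 = g x ^+ 2 * \1_Rp x by rewrite exprMn [X in _ * X]expr2 Rp2.
have E' y : to_log g y ^+ 2 = g (expR y) ^+ 2 * expR y.
  by rewrite exprMn [X in X * _]expr2 expR_half2 mulrC.
split=> -[_ i2]; split.
- exact: mfun_to_log.
- exact: (eq_itg (fun y => esym (E' y)) ((itg_log mg2).1 (eq_itg E i2))).
- by apply: measurable_funM => //; exact: mfun_Rp.
- exact: (eq_itg (fun y => esym (E y)) ((itg_log mg2).2 (eq_itg E' i2))).
Qed.

Lemma sq_of_log H : sq H -> sq (of_log H).
Proof.
move=> sH; have mH := sH.1; have mu' := mfun_of_log mH.
have h : sq (fun x => of_log H x * \1_Rp x) by apply/sq_to_log => //; rewrite of_logK.
apply: (sq_le mu' h) => x; by rewrite /of_log -[in leRHS]mulrA Rp2.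
Qed.

(** The weights of to_log and of_log combine because
    x^(-1/2) dx = e^(y/2) dy. *)
Lemma pair_log g H : sq (fun x => g x * \1_Rp x) -> mfun g -> sq H ->
  Int (fun x => g x * of_log H x) = Int (fun y => to_log g y * H y).
Proof.
move=> sg mg sH.
pose F x := g x * (expR (- (ln x / 2)) * H (ln x)).
have E x : g x * of_log H x = F x * \1_Rp x by rewrite /F /of_log; ring.
have mF : mfun F.
  apply: measurable_funM => //; apply: measurable_funM; last exact: (measurableT_comp sH.1 (@measurable_ln R)).
  by apply: mfun_exp; apply: measurableT_comp => //; apply: measurable_funM => //; exact: measurable_ln.
rewrite (eq_Int E) Int_log//.
  apply: eq_Int => y; rewrite /F /to_log expRK -{2}(expR_half2 y).
  rewrite expRN; field; exact: lt0r_neq0 (expR_gt0 _).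
apply: eq_itg (sq_mul sg (sq_of_log sH)) => x.
by rewrite /F /of_log -[in RHS]Rp2; ring.
Qed.

(** Translation invariance of the integral is invariance of dx / x under dilations,
    read through the exponential substitution. *)
Lemma itg_shift f (a : R) : itg f -> itg (fun y => f (y - a)) /\ Int (fun y => f (y - a)) = Int f.
Proof.
move=> iF; have mf := itg_m iF.
pose F x := f (ln x) * x^-1.
have mF : mfun F.
  by apply: measurable_funM; [exact: (measurableT_comp mf (@measurable_ln R))|exact: mfunV].
have E y : F (expR y) * expR y = f y by rewrite /F expRK mulfVK// lt0r_neq0 ?expR_gt0.
have E' y : F (expR (- a) * expR y) * (expR (- a) * expR y) = f (y - a).
  by rewrite -expRD E addrC.
have i0 : itg (fun x => F x * \1_Rp x) by apply/itg_log => //; exact: (eq_itg (fun y => esym (E y)) iF).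
have i1 := (itg_expR (expR_gt0 (- a)) mF).1 i0.
split; first exact: eq_itg i1.
by rewrite -(eq_Int E') -(Int_expR (expR_gt0 (- a)) i0 mF) Int_log// (eq_Int E).
Qed.

Lemma itg_csum_shift (z : R) : itg (fun y => (csum (y - z))^-1).
Proof. exact: (itg_shift z (@itg_csumV R)).1. Qed.

Lemma csum_sub (y z : R) : csum (y - z) = csum (z - y).
Proof. by rewrite -opprB csum_even. Qed.

Lemma mfun2_csum : mfun2 (fun y z : R => (csum (y - z))^-1).
Proof. exact: (measurableT_comp (itg_m (@itg_csumV R)) mfun2_sub). Qed.

Lemma csumV_ge0 (y : R) : 0 <= (csum y)^-1.
Proof. by rewrite invr_ge0 ltW// csum_gt0. Qed.

Lemma itg2_sech f : itg f -> itg2 (fun z y => f z * (csum (y - z))^-1).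
Proof.
move=> iF; have mf := itg_m iF.
pose c := Int (fun y : R => (csum y)^-1).
apply: (itg2_bound (G := fun z => c * `|f z|)).
- by apply: measurable_funM; [exact: mfun2_fst|exact: (mfun2_swap mfun2_csum)].
- by move=> z; apply: itgZ; exact: itg_csum_shift.
- by apply: itgZ; exact: itg_norm.
- move=> z; rewrite (eq_Int (g := fun y => `|f z| * (csum (y - z))^-1)); last first.
    by move=> y; rewrite normrM (ger0_norm (csumV_ge0 _)).
  rewrite IntZ; last exact: itg_csum_shift.
  by rewrite (itg_shift z (@itg_csumV R)).2 mulrC.
Qed.

Lemma itg2_sech_sq g H : sq g -> sq H -> itg2 (fun z y => g z * H y * (csum (y - z))^-1).
Proof.
move=> sg sH; have mg := sg.1; have mH := sH.1.
have i1 := itg2_sech sg.2.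
have i2 := itg2_swap (itg2_sech sH.2).
have i3 : itg2 (fun z y => g z ^+ 2 * (csum (y - z))^-1 + H y ^+ 2 * (csum (z - y))^-1).
  exact: integrableD i1 i2.
apply: (le_integrable _ _ _ i3) => //.
  apply/measurable_EFinP; apply: measurable_funM; last exact: (mfun2_swap mfun2_csum).
  by apply: measurable_funM; [exact: mfun2_fst|exact: mfun2_snd].
move=> [z y] _ /=; rewrite lee_fin [csum (z - y)]csum_sub -mulrDl !normrM (ger0_norm (csumV_ge0 _)).
by rewrite ler_wpM2r ?csumV_ge0// [leRHS]ger0_norm ?addr_ge0 ?sqr_ge0// -normrM normM_le.
Qed.

(** The symbols of the Stieltjes operator and of the Hilbert transform on the half-line, up to
    the factor pi. *)
Definition sechpi (tau : R) : R := (cosh (tau * pi))^-1.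
Definition tanhpi (tau : R) : R := sinh (tau * pi) / cosh (tau * pi).

Lemma mfun_coshpi : mfun (fun tau : R => cosh (tau * pi)).
Proof.
by apply: measurable_funM => //; apply: measurable_funD; apply: mfun_exp; [|apply: measurableT_comp => //]; exact: measurable_funM.
Qed.
Lemma mfun_sinhpi : mfun (fun tau : R => sinh (tau * pi)).
Proof.
by apply: measurable_funM => //; apply: measurable_funB; apply: mfun_exp; [|apply: measurableT_comp => //]; exact: measurable_funM.
Qed.
Lemma mfun_sechpi : mfun sechpi. Proof. exact: mfunV mfun_coshpi. Qed.
Lemma mfun_tanhpi : mfun tanhpi.
Proof. by apply: measurable_funM; [exact: mfun_sinhpi|exact: mfun_sechpi]. Qed.

Lemma cosh2_sinh2 (a : R) : cosh a ^+ 2 - sinh a ^+ 2 = 1.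
Proof.
have : expR a * expR (- a) = 1 by rewrite -expRD subrr expR0.
by rewrite /cosh /sinh; move: (expR a) (expR (- a)) => p q pq; rewrite -[RHS]pq; field.
Qed.

Lemma sechpi2_tanhpi2 tau : sechpi tau ^+ 2 + tanhpi tau ^+ 2 = 1.
Proof.
have c0 := cosh_gt0 (tau * pi); have := cosh2_sinh2 (tau * pi); rewrite /sechpi /tanhpi => e.
have -> : (cosh (tau * pi))^-1 ^+ 2 + (sinh (tau * pi) / cosh (tau * pi)) ^+ 2 =
  (1 + sinh (tau * pi) ^+ 2) / cosh (tau * pi) ^+ 2 by field; exact: lt0r_neq0.
by rewrite -e subrK divff// expf_neq0// lt0r_neq0.
Qed.

Lemma sechpi_gt0 tau : 0 < sechpi tau. Proof. by rewrite invr_gt0 cosh_gt0. Qed.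

Lemma sechpi_le1 tau : `|sechpi tau| <= 1.
Proof.
rewrite -(ler_pXn2r (n := 2))// ?nnegrE// real_normK ?num_real// expr1n.
by have := sechpi2_tanhpi2 tau; have := sqr_ge0 (tanhpi tau); lra.
Qed.

Lemma tanhpi_le1 tau : `|tanhpi tau| <= 1.
Proof.
rewrite -(ler_pXn2r (n := 2))// ?nnegrE// real_normK ?num_real// expr1n.
by have := sechpi2_tanhpi2 tau; have := sqr_ge0 (sechpi tau); lra.
Qed.

Lemma itg_cos_v v gam y : itg v -> mfun gam -> itg (fun tau => v tau * cos (tau * y + gam tau)).
Proof.
move=> iv mg; apply: itg_le (itg_norm iv) _.
  by apply: measurable_funM; [exact: itg_m|exact: (mfun2_row y (mfun2_cos mg))].
by move=> tau; rewrite normrM ler_piMr// cos_max.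
Qed.

(** By Fubini's theorem it is enough to convolve one oscillation
    cos (tau y + gam), which is sech_transformE after a translation by z. *)
Lemma Int_cosint_sech v gam z : itg v -> mfun gam ->
  Int (fun y => cosint v gam y * (csum (y - z))^-1) = pi * cosint (fun tau => sechpi tau * v tau) gam z.
Proof.
move=> iv mg; have mv := itg_m iv.
have ics := itg_csum_shift z.
have i2 : itg2 (fun y tau => v tau * cos (tau * y + gam tau) * (csum (y - z))^-1).
  apply: (itg2_bound (G := fun y => Int (fun tau => `|v tau|) * (csum (y - z))^-1)).
  - apply: measurable_funM; last exact: (mfun2_fst (itg_m ics)).
    by apply: measurable_funM; [exact: mfun2_snd|exact: mfun2_cos].
  - by move=> y; apply: eq_itg (itgZ (csum (y - z))^-1 (itg_cos_v y iv mg)) => tau; rewrite mulrC.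
  - exact: itgZ.
  - move=> y; rewrite [leRHS]mulrC -IntZ; last exact: itg_norm.
    apply: Int_le; [|by apply: itgZ; exact: itg_norm|].
      apply: itg_norm; apply: eq_itg (itgZ (csum (y - z))^-1 (itg_cos_v y iv mg)) => tau.
      by rewrite mulrC.
    move=> tau; rewrite !normrM (ger0_norm (csumV_ge0 _)) mulrC ler_wpM2l ?csumV_ge0//.
    by rewrite ler_piMr// cos_max.
transitivity (Int (fun y => Int (fun tau => v tau * cos (tau * y + gam tau) * (csum (y - z))^-1))).
  apply: eq_Int => y; rewrite /cosint mulrC -IntZ; last exact: itg_cos_v.
  by apply: eq_Int => tau; rewrite mulrC.
rewrite (Fubini_Int i2) /cosint -IntZ; last first.
  apply: itg_cos_v => //; apply: itg_bM => //; [exact: mfun_sechpi|exact: sechpi_le1].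
apply: eq_Int => tau.
have ic (b : R) : itg (fun y : R => cos (tau * y + b) * (csum y)^-1).
  apply: itg_bM; [exact: itg_csumV|exact: mfun_cos_affine|by move=> x; exact: cos_max].
have E y : v tau * cos (tau * y + gam tau) * (csum (y - z))^-1 =
   v tau * (cos (tau * (y - z) + (tau * z + gam tau)) * (csum (y - z))^-1).
  by rewrite -mulrA; congr (_ * (cos _ * _)); ring.
have [j1 j2] := itg_shift z (ic (tau * z + gam tau)).
rewrite (eq_Int E) IntZ// j2.
have := sech_transformE tau (tau * z + gam tau); rewrite /sech_transform => ->; rewrite /sechpi; field.
exact: lt0r_neq0 (cosh_gt0 _).
Qed.

End LogCoordinates.

(** * The Stieltjes operator *)
Section Stieltjes.
Context {R : realType}.
Local Notation mu := (@lebesgue_measure R).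
Local Notation Rp := (`]0%R, +oo[%classic : set R).
Implicit Types f g h H v gam : R -> R.

Definition Stieltjes g (x : R) : R := Int (fun t => g t / (x + t) * \1_Rp t).

Lemma mfun_addV (x : R) : mfun (fun t : R => (x + t)^-1).
Proof. by apply: mfunV; exact: measurable_funD. Qed.

Lemma to_log_addV (y z : R) : to_log (fun t => (expR y + t)^-1) z = expR (- (y / 2)) * (csum (y - z))^-1.
Proof.
rewrite /to_log /csum (_ : (y - z) / 2 = y / 2 - z / 2); last by field.
rewrite opprB !expRD -!(expR_half2 y) -!(expR_half2 z) !expRN.
have := expR_gt0 (y / 2); have := expR_gt0 (z / 2).
move: (expR (y / 2)) (expR (z / 2)) => p q q0 p0.
by field; rewrite ?gt_eqF// ?addr_gt0// ?mulr_gt0.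
Qed.

Lemma csumV_le1 (y : R) : (csum y)^-1 <= 1.
Proof.
have p0 := expR_gt0 (y / 2); rewrite invf_le1 ?csum_gt0// /csum expRN.
have q0 : 0 < (expR (y / 2))^-1 by rewrite invr_gt0.
have : expR (y / 2) * (expR (y / 2))^-1 = 1 by rewrite divff// gt_eqF.
move: (expR (y / 2)) (_^-1) p0 q0 => p q p0 q0 pq.
have := sqr_ge0 (p - q); nra.
Qed.

Lemma sq_csumV (z : R) : sq (fun y : R => (csum (z - y))^-1).
Proof.
have i0 : itg (fun y : R => (csum (z - y))^-1).
  by apply: eq_itg (itg_csum_shift z) => y; rewrite csum_sub.
have m0 := itg_m i0; split => //.
apply: (itg_le _ i0); first exact: measurable_funX.
move=> y; rewrite ger0_norm ?sqr_ge0// expr2 ler_piMr ?csumV_ge0//; exact: csumV_le1.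
Qed.

Lemma sq_addV (x : R) : 0 < x -> sq (fun t => (x + t)^-1 * \1_Rp t).
Proof.
move=> x0; apply/(sq_to_log (g := fun t => (x + t)^-1)); first exact: mfun_addV.
rewrite -(lnK (x0 : x \is Num.pos)).
rewrite (_ : to_log _ = (fun z => expR (- (ln x / 2)) * (csum (ln x - z))^-1)); last first.
  by apply/funext => z; exact: to_log_addV.
exact/sqZ/sq_csumV.
Qed.

Lemma itg_Stieltjes g (x : R) : 0 < x -> sq (fun t => g t * \1_Rp t) -> itg (fun t => g t / (x + t) * \1_Rp t).
Proof.
move=> x0 sg; apply: eq_itg (sq_mul sg (sq_addV x0)) => t.
by rewrite -[in RHS]Rp2; ring.
Qed.

Lemma mfun_Stieltjes g : mfun g -> mfun (Stieltjes g).
Proof.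
move=> mg; apply: mfun_Int; apply: measurable_funM; last exact: (mfun2_snd mfun_Rp).
apply: measurable_funM; first exact: mfun2_snd.
by apply: mfunV; apply: measurable_funD; [exact: measurable_fst|exact: measurable_snd].
Qed.

(** Since x + t = e^((y+z)/2) 2 cosh ((y - z) / 2) for x = e^y and t = e^z, the
    kernel is a convolution kernel in logarithmic coordinates. *)
Lemma Stieltjes_log g y : mfun g -> sq (fun t => g t * \1_Rp t) ->
  expR (y / 2) * Stieltjes g (expR y) = Int (fun z => to_log g z * (csum (y - z))^-1).
Proof.
move=> mg sg.
have i1 := itg_Stieltjes (expR_gt0 y) sg.
rewrite /Stieltjes Int_log//; last by apply: measurable_funM => //; exact: mfun_addV.
rewrite -IntZ; last first.
  by apply/(itg_log (F := fun t => g t / (expR y + t))) => //; apply: measurable_funM => //; exact: mfun_addV.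
apply: eq_Int => z.
have := to_log_addV y z; rewrite /to_log => h.
have -> : (csum (y - z))^-1 = expR (y / 2) * (expR (z / 2) * (expR y + expR z)^-1).
  by rewrite h mulrA -expRD subrr expR0 mul1r.
by rewrite -(expR_half2 z); ring.
Qed.

(** A weak form of the Fourier transform of to_log g. *)
Definition pairing g v gam : R := Int (fun y => to_log g y * cosint v gam y).

(** The Stieltjes operator is symmetric, so it can be moved to the cosine integral. *)
Lemma Stieltjes_pair g v gam : mfun g -> sq (fun t => g t * \1_Rp t) -> itg v -> sq v -> mfun gam ->
  itg (fun x => Stieltjes g x * of_log (cosint v gam) x) /\
  Int (fun x => Stieltjes g x * of_log (cosint v gam) x) = pi * pairing g (fun tau => sechpi tau * v tau) gam.
Proof.
move=> mg sg iv sv mgam.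
have [sH _] := bessel iv sv mgam; have mH := sH.1.
have sl := (sq_to_log mg).1 sg.
have i2 := itg2_sech_sq sl sH.
pose F x := Stieltjes g x * (expR (- (ln x / 2)) * cosint v gam (ln x)).
have E x : Stieltjes g x * of_log (cosint v gam) x = F x * \1_Rp x by rewrite /F /of_log; ring.
have mF : mfun F.
  apply: measurable_funM; first exact: mfun_Stieltjes.
  apply: measurable_funM; last exact: (measurableT_comp mH (@measurable_ln R)).
  by apply: mfun_exp; apply: measurableT_comp => //; apply: measurable_funM => //; exact: measurable_ln.
have E2 y : F (expR y) * expR y = Int (fun z => to_log g z * cosint v gam y * (csum (y - z))^-1).
  transitivity (cosint v gam y * (expR (y / 2) * Stieltjes g (expR y))).
    rewrite /F expRK -[X in _ * X = _](expR_half2 y) expRN; field; exact: lt0r_neq0 (expR_gt0 _).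
  rewrite (Stieltjes_log y mg sg) -IntZ; last exact: sq_mul sl (sq_csumV y).
  by apply: eq_Int => z; ring.
have i3 : itg (fun y => F (expR y) * expR y) := eq_itg (fun y => esym (E2 y)) (itg2_Int (itg2_swap i2)).
have i4 := (itg_log mF).2 i3.
split; first exact: (eq_itg (fun x => esym (E x)) i4).
rewrite (eq_Int E) Int_log// (eq_Int E2) -(Fubini_Int i2) /pairing -IntZ; last first.
  apply: sq_mul => //; apply: (bessel _ _ mgam).1.
  - apply: itg_bM => //; [exact: mfun_sechpi|exact: sechpi_le1].
  - have mv := sv.1; apply: (sq_le _ sv); first by apply: measurable_funM => //; exact: mfun_sechpi.
    by move=> x; rewrite normrM ler_piMl// sechpi_le1.
apply: eq_Int => z; transitivity (to_log g z * Int (fun y => cosint v gam y * (csum (y - z))^-1)).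
  rewrite -IntZ; last first.
    apply: (eq_itg _ (sq_mul sH (sq_csumV z))) => y; by rewrite csum_sub.
  by apply: eq_Int => y; ring.
by rewrite Int_cosint_sech//; ring.
Qed.
End Stieltjes.

(** * Principal values as limits of conjugate Poisson integrals *)
Section PrincipalValue.
Context {R : realType}.
Local Notation mu := (@lebesgue_measure R).
Local Notation Rp := (`]0%R, +oo[%classic : set R).
Implicit Types h : R -> R.

(** pv_weight e (x - t) / (x - t) is the conjugate Poisson kernel.  As a function of
    |s|/e, the weight is the distribution function of the probability density pv_density
    on the half-line. *)
Definition pv_weight (e s : R) : R := s ^+ 2 / (s ^+ 2 + e ^+ 2).
Definition pv_density (r : R) : R := 2 * r / (r ^+ 2 + 1) ^+ 2.

Lemma pv_den_gt0 (r : R) : 0 < r ^+ 2 + 1.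
Proof. by rewrite ltr_wpDl ?sqr_ge0. Qed.

Lemma is_derive_pv_density (r : R) : is_derive r (1 : R) (fun r => - (r ^+ 2 + 1)^-1) (pv_density r).
Proof.
have d0 : r ^+ 2 + 1 != 0 by rewrite gt_eqF// pv_den_gt0.
have dV := is_deriveV d0.
apply: is_derive_eq; rewrite /GRing.scale/= /pv_density; field; exact: d0.
Qed.

Lemma continuous_pv_density : continuous pv_density.
Proof.
apply: continuous_mul; first by apply: derivable_continuous => r; exact: ex_derive.
apply: continuous_inv => [r|r]; last by rewrite expf_neq0// gt_eqF// pv_den_gt0.
by apply: derivable_continuous => x; exact: ex_derive.
Qed.

Lemma pv_density_ge0 (r : R) : 0 < r -> 0 <= pv_density r.
Proof. by move=> r0; rewrite divr_ge0 ?exprn_ge0 ?mulr_ge0 ?(ltW r0)// ltW// pv_den_gt0. Qed.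

Lemma pv_density_le (r : R) : `|pv_density r| <= poisson 1 r.
Proof.
have d0 := pv_den_gt0 r.
rewrite /pv_density /poisson normrM normfV (ger0_norm (exprn_ge0 2 (ltW d0))) expr1n [1 + _]addrC mul1r expr2 invfM mulrA.
rewrite ler_piMl ?invr_ge0 ?(ltW d0)// ler_pdivrMr// mul1r normrM ger0_norm//.
rewrite -[r ^+ 2]real_normK ?num_real//.
by have := sqr_ge0 (`|r| - 1); rewrite sqrrB => *; lra.
Qed.

Lemma itg_pv_density : itg pv_density.
Proof.
apply: itg_le (poisson_int 0 ltr01).1 _.
  by apply: continuous_measurable_fun; exact: continuous_pv_density.
by move=> r; rewrite subr0 pv_density_le.
Qed.

Lemma itg_pv_density_Rp : itg (fun r => pv_density r * \1_Rp r).
Proof. by apply: itg_indicM => //; exact: itg_pv_density. Qed.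

Lemma pv_density_int : Int (fun r => pv_density r * \1_Rp r) = 1.
Proof.
rewrite (FTC_Rp (lp := 0) is_derive_pv_density continuous_pv_density itg_pv_density_Rp).
  by rewrite expr0n !add0r invr1 opprK.
pose F (r : R) := - (r ^+ 2 / (1 + r ^+ 2)).
  have F0 : F 0 = 0 by rewrite /F expr0n mul0r oppr0.
  have : F (n%:R^-1) @[n --> \oo] --> (0 : R).
    rewrite -[X in _ --> X]F0; apply: (cvg_comp _ F cvg_invn); apply: derivable_continuous => r.
    have d0 : 1 + r ^+ 2 != 0 by rewrite gt_eqF// addrC pv_den_gt0.
    by have dV := is_deriveV d0; exact: ex_derive.
  apply: cvg_trans; apply: near_eq_cvg; near=> n.
  have n0 : (0 : R) < n%:R by rewrite ltr0n; near: n; exact: nbhs_infty_gt.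
  by rewrite /F; field; rewrite !gt_eqF// ?pv_den_gt0// addrC pv_den_gt0.
Unshelve. all: by end_near. Qed.

(** The cut-off |t - x| > e of the principal value. *)
Definition cut (e s : R) : R := if e < `|s| then 1 else 0.

Lemma cut_ge0 e s : 0 <= cut e s.
Proof. by rewrite /cut; case: ifP. Qed.
Lemma cut_le1 e s : `|cut e s| <= 1.
Proof. by rewrite /cut; case: ifP; rewrite ?normr1 ?normr0. Qed.

(** A layer cake formula: the smooth weight is an average of the sharp cut-offs at
    e r over the density. *)
Lemma pv_density_cut (e s : R) : 0 < e -> Int (fun r => pv_density r * \1_Rp r * cut (e * r) s) = pv_weight e s.
Proof.
move=> e0.
have E r : pv_density r * \1_Rp r * cut (e * r) s = pv_density r * \1_(`]0, (`|s| / e)%R[%classic : set R) r.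
  rewrite -mulrA /cut [e * r]mulrC -ltr_pdivlMr// !indicE.
  congr (_ * _); rewrite !mem_setE !in_itv/= andbT.
  by case: (0 < r); case: (r < `|s| / e); rewrite ?mulr0 ?mulr1 ?mul0r.
rewrite (eq_Int E) -Rintegral_Int Rintegral_itv_bndo_bndc; last first.
  apply: (integrableS measurableT) => //; exact: itg_pv_density.
rewrite (FTC_itvoc _ is_derive_pv_density continuous_pv_density); last by rewrite divr_ge0// ltW.
rewrite expr0n add0r invr1 /pv_weight expr_div_n real_normK ?num_real//.
by field; rewrite !gt_eqF// ltr_wpDl ?sqr_ge0// exprn_gt0.
Qed.

Lemma pv_weight_ge0 (e s : R) : 0 <= pv_weight e s.
Proof. by rewrite divr_ge0 ?addr_ge0 ?sqr_ge0. Qed.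

Lemma mfun_cut e x : mfun (fun t => cut e (t - x)).
Proof.
apply: measurable_fun_ifT => //; apply: measurable_fun_ltr => //.
by apply: measurableT_comp => //; exact: measurable_funB.
Qed.

Lemma mfun2_cut (e x : R) : mfun2 (fun t r => cut (e * r) (t - x)).
Proof.
apply: (measurable_fun_ifT (f := fun p : R * R => e * p.2 < `|p.1 - x|)) => //.
apply: measurable_fun_ltr.
  by apply: measurable_funM => //; exact: measurable_snd.
by apply: measurableT_comp => //; apply: measurable_funB => //; exact: measurable_fst.
Qed.

Lemma mfun_pv_weight (e x : R) : mfun (fun t => pv_weight e (x - t)).
Proof.
have m : mfun (fun t => (x - t) ^+ 2) by apply: measurable_funX; exact: measurable_funB.
by apply: measurable_funM => //; apply: mfunV; exact: measurable_funD.
Qed.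

(** By pv_density_cut, the weighted integral at e is the average over r of the integrals
    truncated at e r.  These are bounded, uniformly in e and r, and tend to P. *)
Lemma PV_regularization h (x P : R) (en : nat -> R) : mfun h ->
  (forall e, 0 < e -> itg (fun t => h t * cut e (t - x))) ->
  Int (fun t => h t * cut e (t - x)) @[e --> 0^'+] --> P ->
  (forall e, 0 < e -> itg (fun t => h t * pv_weight e (x - t))) ->
  (forall n, 0 < en n) -> en n @[n --> \oo] --> (0 : R) ->
  Int (fun t => h t * pv_weight (en n) (x - t)) @[n --> \oo] --> P.
Proof.
move=> mh ih cP iw en0 cen.
pose H e := Int (fun t => h t * cut e (t - x)).
(* Near 0 the truncated integrals are bounded because they converge; for
   larger e they are dominated by the integral of the modulus at d / 2. *)
have [C HC] : exists C, forall e, 0 < e -> `|H e| <= C.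
  move/cvgrPdist_le : (cP) => /(_ 1 ltr01) [d /= d0 hd].
  pose d2 := d / 2; have d20 : 0 < d2 by rewrite divr_gt0.
  exists (Num.max (`|P| + 1) (Int (fun t => `|h t * cut d2 (t - x)|))) => e e0.
  rewrite le_max; have [ed|de] := ltP e d.
    apply/orP; left; have := hd e; rewrite /= sub0r normrN gtr0_norm// => /(_ ed e0) h1.
    rewrite -/(H e) in h1; have := ler_normD P (H e - P); rewrite addrC subrK distrC => h2.
    by apply: le_trans h2 _; rewrite lerD2l.
  apply/orP; right; apply: Int_abs_le; [exact: ih|by apply: itg_norm; exact: ih|].
  move=> t; rewrite !normrM ler_wpM2l// ger0_norm ?cut_ge0// ger0_norm ?cut_ge0//.
  rewrite /cut; case: ifPn => // h1; case: ifPn => // /negP[]; apply: lt_trans h1.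
  by apply: lt_le_trans de; rewrite /d2 ltr_pdivrMr// mulrDr !mulr1 ltrDl.
have key n : Int (fun t => h t * pv_weight (en n) (x - t)) = Int (fun r => pv_density r * \1_Rp r * H (en n * r)).
  have e0 := en0 n; set e := en n in e0 *.
  pose K t r := h t * (pv_density r * \1_Rp r * cut (e * r) (t - x)).
  have icut t : itg (fun r => pv_density r * \1_Rp r * cut (e * r) (t - x)).
    apply: itg_le (itg_norm itg_pv_density_Rp) _.
      by apply: measurable_funM; [exact: (itg_m itg_pv_density_Rp)|exact: (mfun2_row t (mfun2_cut e x))].
    by move=> r; rewrite normrM ler_piMr// cut_le1.
  have pvwC t : pv_weight e (t - x) = pv_weight e (x - t) by rewrite -opprB /pv_weight sqrrN.
  have mK : mfun2 K.
    apply: measurable_funM; first exact: mfun2_fst.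
    apply: measurable_funM; last exact: mfun2_cut.
    by apply: (mfun2_snd (itg_m itg_pv_density_Rp)).
  have i2 : itg2 K.
    apply: (itg2_bound (G := fun t => `|h t * pv_weight e (x - t)|)) => //.
    - by move=> t; exact: itgZ.
    - by apply: itg_norm; exact: iw.
    - move=> t; rewrite (eq_Int (g := fun r => `|h t| * (pv_density r * \1_Rp r * cut (e * r) (t - x)))).
        by rewrite IntZ// pv_density_cut// pvwC normrM (ger0_norm (pv_weight_ge0 _ _)).
      move=> r; rewrite normrM; congr (_ * _); rewrite ger0_norm// mulr_ge0 ?cut_ge0//.
      have [r0|r0] := ltP 0 r; last by rewrite Rp_neg// mulr0.
      by rewrite Rp_pos// mulr1 pv_density_ge0.
  transitivity (Int (fun t => Int (K t))).
    by apply: eq_Int => t; rewrite IntZ// pv_density_cut// pvwC.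
  rewrite (Fubini_Int i2); apply: eq_Int => r.
  have [r0|r0] := ltP 0 r; last first.
    rewrite Rp_neg// mulr0 mul0r -[RHS]Int0; apply: eq_Int => t.
    by rewrite /K Rp_neg// mulr0 mul0r mulr0.
  rewrite Rp_pos// mulr1 /H -IntZ; last by apply: ih; rewrite mulr_gt0.
  by apply: eq_Int => t; rewrite /K Rp_pos// mulr1; ring.
under eq_cvg do rewrite key.
rewrite -[P]mulr1 -pv_density_int -IntZ; last exact: itg_pv_density_Rp.
apply: (dct (g := fun r => C * `|pv_density r * \1_Rp r|)).
- move=> n; apply: measurable_funM; first exact: (itg_m itg_pv_density_Rp).
  apply: (mfun_Int (K := fun r t => h t * cut (en n * r) (t - x))).
  by apply: measurable_funM; [exact: mfun2_snd|exact: (mfun2_swap (mfun2_cut _ _))].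
- by apply: measurable_funM => //; exact: (itg_m itg_pv_density_Rp).
- by apply: itgZ; apply: itg_norm; exact: itg_pv_density_Rp.
- move=> n r; rewrite normrM mulrC; have [r0|r0] := ltP 0 r.
    by rewrite ler_wpM2r// HC// mulr_gt0.
  by rewrite Rp_neg// !mulr0 normr0 !mulr0.
- apply: (aeW mu) => r; rewrite [P * _]mulrC; have [r0|r0] := ltP 0 r; last first.
    rewrite Rp_neg// mulr0 mul0r.
    by under eq_cvg do rewrite mul0r; exact: cvg_cst.
  apply: cvgMr; move/cvg_at_rightP : cP; apply; split.
    by move=> n; rewrite mulr_gt0.
  by rewrite -(mul0r r); exact: cvgMl.
Qed.

End PrincipalValue.

(** * The Hilbert transform of cosine integrals *)
Section HilbertAtom.
Context {R : realType}.
Local Notation mu := (@lebesgue_measure R).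
Local Notation Rp := (`]0%R, +oo[%classic : set R).
Implicit Types f g h H v gam : R -> R.

(** x + i e = polar_radius * exp (i * polar_coangle). *)
Definition polar_coangle (x e : R) : R := atan (e / x).
Definition polar_radius (x e : R) : R := x / cos (polar_coangle x e).

Lemma polar_coangle_gt0 x e : 0 < x -> 0 < e -> 0 < polar_coangle x e.
Proof. by move=> x0 e0; rewrite /polar_coangle -(@atan0 R); apply: lt_atan; rewrite divr_gt0. Qed.

Lemma polar_coangle_lt x e : polar_coangle x e < pi / 2.
Proof. exact: atan_ltpi2. Qed.

Lemma cos_polar_coangle x e : 0 < cos (polar_coangle x e).
Proof. by apply: cos_gt0_pihalf; rewrite atan_gtNpi2 atan_ltpi2. Qed.

Lemma polar_radius_gt0 x e : 0 < x -> 0 < polar_radius x e.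
Proof. by move=> x0; rewrite divr_gt0// cos_polar_coangle. Qed.

Lemma polar_radius_cos x e : polar_radius x e * cos (polar_coangle x e) = x.
Proof. by rewrite /polar_radius mulfVK// gt_eqF// cos_polar_coangle. Qed.

Lemma polar_radius_sin x e : 0 < x -> polar_radius x e * sin (polar_coangle x e) = e.
Proof.
move=> x0; have c0 := cos_polar_coangle x e.
have : tan (polar_coangle x e) = e / x by rewrite atanK.
rewrite /tan => h; have -> : sin (polar_coangle x e) = e / x * cos (polar_coangle x e) by rewrite -h mulfVK// gt_eqF.
by rewrite /polar_radius; field; rewrite !gt_eqF.
Qed.

Lemma polar_radius_ge x e : 0 < x -> x <= polar_radius x e.
Proof.
by move=> x0; rewrite /polar_radius ler_pdivlMr ?cos_polar_coangle// ler_piMr ?(ltW x0)// cos_le1.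
Qed.

(** The height t in the strip |t| < pi at which the secant is evaluated:
    x + i e = - polar_radius * exp (- i * polar_angle).  It tends to pi as e
    tends to 0. *)
Definition polar_angle (x e : R) : R := pi - polar_coangle x e.

Lemma polar_angle_itv x e : 0 < x -> 0 < e -> 0 <= polar_angle x e < pi.
Proof.
move=> x0 e0; rewrite /polar_angle; have := polar_coangle_gt0 x0 e0; have := polar_coangle_lt x e; have := pi_gt0 R => *.
by apply/andP; split; lra.
Qed.

Lemma cos_polar_angle x e : cos (polar_angle x e) = - cos (polar_coangle x e).
Proof. by rewrite /polar_angle addrC cosDpi cosN. Qed.

(** With t = rho e^y and th = polar_angle,
    1 / (x - t + i e) = - 1 / (rho (e^y + e^(- i th))), and the right side is
    - e^(- (y - i th) / 2) / (2 rho cosh ((y + i th) / 2)).  This is the real part of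
    that identity, multiplied by t e^(- y / 2). *)
Lemma conjP_polar (x e y : R) : 0 < x -> 0 < e ->
  conjP e (x - polar_radius x e * expR y) * (polar_radius x e * expR y) * expR (- (y / 2)) =
  - (cos (polar_angle x e / 2) * (cX (polar_angle x e) y / cN (polar_angle x e) y) + sin (polar_angle x e / 2) * (cY (polar_angle x e) y / cN (polar_angle x e) y)).
Proof.
move=> x0 e0; set th := polar_angle x e; set a := polar_coangle x e; set rho := polar_radius x e.
have rho0 : 0 < rho by exact: polar_radius_gt0.
have thpi : - pi < th < pi by have /andP[h1 h2] := polar_angle_itv x0 e0; rewrite h2 (lt_le_trans _ h1)// oppr_lt0 pi_gt0.
have N0 : cN th y != 0 by rewrite gt_eqF// cN_gt0.
have s2 : sin (th / 2) ^+ 2 = 1 - cos (th / 2) ^+ 2 by have := cos2Dsin2 (th / 2); lra.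
have c2 : 2 * cos (th / 2) ^+ 2 = 1 - cos a.
  have := cos_polar_angle x e; rewrite -/a -/th.
  have -> : cos th = cos (th / 2) ^+ 2 - sin (th / 2) ^+ 2 by rewrite {1}(splitr th) cosD -!expr2.
  by rewrite s2 => h; lra.
rewrite -(polar_radius_cos x e) -/rho -/a.
have Qe : conjP e (rho * cos a - rho * expR y) = (cos a - expR y) / (rho * (1 - 2 * cos a * expR y + expR y ^+ 2)).
  have es : e ^+ 2 = rho ^+ 2 * (1 - cos a ^+ 2).
    have sa : sin a ^+ 2 = 1 - cos a ^+ 2 by have := cos2Dsin2 a; lra.
    by rewrite -(polar_radius_sin e x0) -/rho -/a exprMn sa.
  rewrite /conjP es (_ : (rho * cos a - rho * expR y) ^+ 2 + _ = rho * (rho * (1 - 2 * cos a * expR y + expR y ^+ 2))); last by ring.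
  by rewrite -mulrBr -mulf_div divff ?mul1r// gt_eqF.
have C2 : cos (th / 2) ^+ 2 = (1 - cos a) / 2 by rewrite -c2; field.
have NE : cN th y = (expR (y / 2) - (expR (y / 2))^-1) ^+ 2 + 2 * (1 - cos a).
  by rewrite cN_E -c2 /cdif expRN; ring.
have RE : cos (th / 2) * (cX th y / cN th y) + sin (th / 2) * (cY th y / cN th y) =
  (csum y * cos (th / 2) ^+ 2 + cdif y * sin (th / 2) ^+ 2) / cN th y by rewrite /cX /cY; ring.
rewrite NE in N0; rewrite RE s2 C2 NE Qe -(expR_half2 y) /csum /cdif !expRN.
(* What remains is an identity of rational functions in p = e^(y/2) and
   c = cos a. *)
have p0 := expR_gt0 (y / 2); move: (expR (y / 2)) p0 (cos a) N0 => p p0 c N0.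
have D0 : 1 - 2 * c * (p * p) + (p * p) ^+ 2 != 0.
  rewrite (_ : _ + _ = p ^+ 2 * ((p - p^-1) ^+ 2 + 2 * (1 - c))); last by field; rewrite gt_eqF.
  by rewrite mulf_neq0// expf_neq0// gt_eqF.
field; apply/and3P; split; [exact: lt0r_neq0| |exact: lt0r_neq0].
by rewrite (_ : _ + _ = 1 - 2 * c * (p * p) + (p * p) ^+ 2)//; ring.
Qed.

Lemma cosD_pihalf (b : R) : cos (b + pi / 2) = - sin b.
Proof. by rewrite cosD cos_pihalf sin_pihalf; ring. Qed.

(** The sine part of Int_cos_sin with the phase advanced by a quarter turn. *)
Lemma Int_cosYN (tau b t : R) : 0 <= t < pi ->
  itg (fun y => cos (tau * y + b) * (cY t y / cN t y)) /\
  Int (fun y => cos (tau * y + b) * (cY t y / cN t y)) = - (pi * sin b * sechpi tau * sinh (tau * t)).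
Proof.
move=> tpi; have [t0 t1] := andP tpi.
have tpi' : - pi < t < pi by rewrite t1 (lt_le_trans _ t0)// oppr_lt0 pi_gt0.
have E y : sin (tau * y + (b + pi / 2)) * (cY t y / cN t y) = cos (tau * y + b) * (cY t y / cN t y).
  by rewrite addrA sinD cos_pihalf sin_pihalf mulr0 add0r mulr1.
split; first exact: (eq_itg E (itg_sinYN tau _ tpi')).
rewrite -(eq_Int E) (Int_cos_sin tau _ tpi).2 sech_transformE cosD_pihalf /sechpi; ring.
Qed.

Lemma Int_cosXN (tau b t : R) : 0 <= t < pi ->
  itg (fun y => cos (tau * y + b) * (cX t y / cN t y)) /\
  Int (fun y => cos (tau * y + b) * (cX t y / cN t y)) = pi * cos b * sechpi tau * cosh (tau * t).
Proof.
move=> tpi; have [t0 t1] := andP tpi.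
have tpi' : - pi < t < pi by rewrite t1 (lt_le_trans _ t0)// oppr_lt0 pi_gt0.
split; first exact: itg_cosXN.
by rewrite (Int_cos_sin tau _ tpi).1 sech_transformE /sechpi.
Qed.

(** The real part of e^(i b) t^(-1/2 + i tau), a generalized eigenfunction. *)
Definition atom (tau b t : R) : R := expR (- (ln t / 2)) * cos (tau * ln t + b).

Lemma mfun_atom tau b : mfun (atom tau b).
Proof.
apply: measurable_funM.
  by apply: mfun_exp; apply: measurableT_comp => //; apply: measurable_funM => //; exact: measurable_ln.
by apply: mfun_cos; apply: measurable_funD => //; apply: measurable_funM => //; exact: measurable_ln.
Qed.

(** The regularized Hilbert transform of the atom on the half-line in closed form
    (Hilbert_atom), obtained from the integrals at height polar_angle in the strip. *)
Definition atom_image (tau b x e : R) : R :=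
  - (expR (- (ln (polar_radius x e) / 2)) * (pi * sechpi tau *
    (cos (polar_angle x e / 2) * cos (tau * ln (polar_radius x e) + b) * cosh (tau * polar_angle x e) -
     sin (polar_angle x e / 2) * sin (tau * ln (polar_radius x e) + b) * sinh (tau * polar_angle x e)))).

Lemma Hilbert_atom (tau b x e : R) : 0 < x -> 0 < e ->
  itg (fun t => conjP e (x - t) * atom tau b t * \1_Rp t) /\
  Int (fun t => conjP e (x - t) * atom tau b t * \1_Rp t) = atom_image tau b x e.
Proof.
move=> x0 e0; have rho0 := polar_radius_gt0 e x0; have tpi := polar_angle_itv x0 e0.
set b' := tau * ln (polar_radius x e) + b.
pose F t := conjP e (x - t) * atom tau b t.
have mF : mfun F by apply: measurable_funM; [exact: (mfun2_row x (mfun2_conjP e))|exact: mfun_atom].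
pose th := polar_angle x e; pose r0 := expR (- (ln (polar_radius x e) / 2)).
have [iX IX] := Int_cosXN tau b' tpi; have [iY IY] := Int_cosYN tau b' tpi.
rewrite -/th in iX IX iY IY.
have E y : - r0 * (cos (th / 2) * (cos (tau * y + b') * (cX th y / cN th y)) +
     sin (th / 2) * (cos (tau * y + b') * (cY th y / cN th y))) = F (polar_radius x e * expR y) * (polar_radius x e * expR y).
  rewrite /F /atom lnM ?posrE ?expR_gt0// expRK.
  rewrite (_ : tau * (ln (polar_radius x e) + y) + b = tau * y + b'); last by rewrite /b'; ring.
  rewrite (_ : - ((ln (polar_radius x e) + y) / 2) = - (ln (polar_radius x e) / 2) + - (y / 2)); last by field.
  rewrite expRD -/r0.
  have := conjP_polar y x0 e0; rewrite -/th => h.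
  transitivity (r0 * cos (tau * y + b') * (- (cos (th / 2) * (cX th y / cN th y) + sin (th / 2) * (cY th y / cN th y)))); first by ring.
  by rewrite -h; ring.
have iXY := itgD (itgZ (cos (th / 2)) iX) (itgZ (sin (th / 2)) iY).
have iF : itg (fun t => F t * \1_Rp t).
  by apply/(itg_expR rho0 mF); exact: (eq_itg E (itgZ (- r0) iXY)).
split => //.
rewrite (Int_expR rho0 iF mF) -(eq_Int E) IntZ// IntD; [|exact: itgZ|exact: itgZ].
by rewrite !IntZ// IX IY /atom_image -/b' -/r0 -/th; ring.
Qed.
End HilbertAtom.

Section HilbertPairing.
Context {R : realType}.
Local Notation mu := (@lebesgue_measure R).
Local Notation Rp := (`]0%R, +oo[%classic : set R).
Implicit Types f g h H v gam : R -> R.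

(** Cosine integrals are superpositions of atoms. *)
Lemma Hilbert_reg_of_log v gam (x e : R) : 0 < x -> 0 < e -> itg v -> mfun gam ->
  itg (fun tau => v tau * atom_image tau (gam tau) x e) /\
  Hilbert_reg e (of_log (cosint v gam)) x = Int (fun tau => v tau * atom_image tau (gam tau) x e).
Proof.
move=> x0 e0 iv mg; have mv := itg_m iv.
have mln := @measurable_ln R.
pose K (t tau : R) := v tau * (conjP e (x - t) * atom tau (gam tau) t * \1_Rp t).
have [i0 _] := Hilbert_atom 0 0 x0 e0.
have mQ : mfun (fun t => conjP e (x - t)) := mfun2_row x (mfun2_conjP e).
have mK : mfun2 K.
  apply: measurable_funM; first exact: mfun2_snd.
  apply: measurable_funM; last exact: (mfun2_fst mfun_Rp).
  apply: measurable_funM; first exact: (mfun2_fst mQ).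
  apply: measurable_funM.
    apply: (mfun2_fst (f := fun t : R => expR (- (ln t / 2)))).
    by apply: mfun_exp; apply: measurableT_comp => //; exact: measurable_funM.
  apply: mfun_cos; apply: measurable_funD; last exact: mfun2_snd.
  by apply: measurable_funM; [exact: measurable_snd|exact: (mfun2_fst mln)].
have E0 t : atom 0 0 t = expR (- (ln t / 2)) by rewrite /atom mul0r addr0 cos0 mulr1.
have KE t tau : K t tau = (conjP e (x - t) * atom 0 0 t * \1_Rp t) * (v tau * cos (tau * ln t + gam tau)).
  by rewrite E0 /K /atom; ring.
have i2 : itg2 K.
  apply: (itg2_bound (G := fun t => Int (fun tau => `|v tau|) * `|conjP e (x - t) * atom 0 0 t * \1_Rp t|)) => //.
  - by move=> t; apply: (eq_itg (fun tau => esym (KE t tau))); apply: itgZ; exact: itg_cos_v.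
  - by apply: itgZ; exact: itg_norm.
  - move=> t; rewrite mulrC -IntZ; last exact: itg_norm.
    apply: Int_le; [|by apply: itgZ; exact: itg_norm|].
      by apply: itg_norm; apply: (eq_itg (fun tau => esym (KE t tau))); apply: itgZ; exact: itg_cos_v.
    by move=> tau; rewrite KE normrM ler_wpM2l// normrM ler_piMr// cos_max.
have E1 tau : Int (fun t => K t tau) = v tau * atom_image tau (gam tau) x e.
  have [i1 <-] := Hilbert_atom tau (gam tau) x0 e0; by rewrite -IntZ.
split; first exact: (eq_itg E1 (itg2_Int (itg2_swap i2))).
rewrite -(eq_Int E1) -(Fubini_Int i2); apply: eq_Int => t.
rewrite (eq_Int (KE t)) IntZ; last exact: itg_cos_v.
by rewrite E0 /of_log /cosint; ring.
Qed.

Lemma Rp_le1 (x : R) : \1_Rp x <= 1 :> R.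
Proof. by rewrite indicE; case: (_ \in _). Qed.

Lemma cosh_even (a : R) : cosh (- a) = cosh a. Proof. by rewrite /cosh opprK addrC. Qed.

Lemma cosh_abs (a : R) : cosh `|a| = cosh a.
Proof. by case: (ger0P a) => // _; rewrite cosh_even. Qed.

Lemma sinh_le_cosh (a : R) : `|sinh a| <= cosh a.
Proof.
rewrite ler_norml /sinh /cosh; have := expR_gt0 a; have := expR_gt0 (- a) => *.
by apply/andP; split; lra.
Qed.

Lemma cosh_le (a b : R) : `|a| <= `|b| -> cosh a <= cosh b.
Proof.
rewrite -(cosh_abs a) -(cosh_abs b) => ab; rewrite /cosh ler_pM2r// !expRN.
have p1 : 1 <= expR `|a| by rewrite -expR0 ler_expR.
have pq : expR `|a| <= expR `|b| by rewrite ler_expR.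
move: (expR `|a|) (expR `|b|) p1 pq => p q p1 pq.
have p0 : 0 < p by lra. have q0 : 0 < q by lra.
rewrite -subr_ge0 (_ : _ - _ = (q - p) * (p * q - 1) / (p * q)); last by field; rewrite !gt_eqF.
rewrite divr_ge0 ?mulr_ge0 ?(ltW p0) ?(ltW q0)// subr_ge0//.
by rewrite -[leLHS]mulr1 ler_pM ?ler01//; lra.
Qed.

(** The bound is uniform in e and tau: cosh (tau * polar_angle) is at most
    cosh (tau * pi), which sechpi compensates. *)
Lemma atom_image_le (tau b x e : R) : 0 < x -> 0 < e ->
  `|atom_image tau b x e| <= expR (- (ln x / 2)) * (pi * 2).
Proof.
move=> x0 e0; rewrite /atom_image normrN normrM (ger0_norm (expR_ge0 _)).
have [t0 t1] := andP (polar_angle_itv x0 e0).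
have c0 := cosh_gt0 (tau * pi).
have cl : sechpi tau * cosh (tau * polar_angle x e) <= 1.
  rewrite /sechpi mulrC ler_pdivrMr// mul1r; apply: cosh_le.
  by rewrite !normrM ler_wpM2l// !ger0_norm// ?pi_ge0// ltW.
have m0 := sechpi_gt0 tau.
have sl : sechpi tau * `|sinh (tau * polar_angle x e)| <= 1.
  by apply: le_trans cl; rewrite ler_pM2l// sinh_le_cosh.
apply: ler_pM; [exact: expR_ge0|exact: normr_ge0| |].
  by rewrite ler_expR lerN2 ler_pM2r// ler_ln ?posrE// ?polar_radius_gt0// polar_radius_ge.
rewrite normrM normrM (ger0_norm (pi_ge0 R)) (gtr0_norm m0) -mulrA ler_wpM2l ?pi_ge0//.
have h (p q r : R) : `|p| <= 1 -> `|q| <= 1 -> sechpi tau * `|r| <= 1 -> sechpi tau * `|p * q * r| <= 1.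
  move=> hp hq; apply: le_trans; rewrite ler_pM2l// normrM ler_piMl// normrM.
  by rewrite -[1]mulr1 ler_pM.
apply: (@le_trans _ _ (sechpi tau * (`|cos (polar_angle x e / 2) * cos (tau * ln (polar_radius x e) + b) * cosh (tau * polar_angle x e)| +
   `|sin (polar_angle x e / 2) * sin (tau * ln (polar_radius x e) + b) * sinh (tau * polar_angle x e)|))).
  by rewrite ler_pM2l// ler_normB.
rewrite mulrDr; apply: lerD; apply: h => //; rewrite ?cos_max ?sin_max//.
by rewrite (gtr0_norm (cosh_gt0 _)).
Qed.

Lemma cvg_derivable (F : R -> R) (u : nat -> R) l : (forall x, derivable F x 1) ->
  u n @[n --> \oo] --> l -> F (u n) @[n --> \oo] --> F l.
Proof. by move=> dF ul; apply: (cvg_comp _ F ul); exact: derivable_continuous. Qed.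

(** As e tends to 0 the height polar_angle tends to pi, which turns sech and sinh into
    tanh (pi tau) and leaves the sine, that is the cosine with phase b - pi / 2. *)
Lemma atom_image_cvg (tau b x : R) (en : nat -> R) : 0 < x -> en n @[n --> \oo] --> (0 : R) ->
  atom_image tau b x (en n) @[n --> \oo] --> expR (- (ln x / 2)) * (pi * (tanhpi tau * cos (tau * ln x + (b - pi / 2)))).
Proof.
move=> x0 cen.
have ca : polar_coangle x (en n) @[n --> \oo] --> (0 : R).
  rewrite -(@atan0 R) -(mul0r (x^-1)).
  apply: (cvg_comp (fun n => en n / x) atan); last exact: continuous_atan.
  exact: cvgMl.
have ct : polar_angle x (en n) @[n --> \oo] --> (pi : R).
  by rewrite -[X in _ --> X]subr0; apply: cvgB => //; exact: cvg_cst.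
have cr : polar_radius x (en n) @[n --> \oo] --> x.
  rewrite -[X in _ --> X]mulr1 -(@invr1 R); apply: cvgMr; apply: cvgV; first exact: oner_neq0.
  by rewrite -(@cos0 R); apply: (cvg_comp _ cos ca); exact: continuous_cos.
have cl : ln (polar_radius x (en n)) @[n --> \oo] --> ln x.
  by apply: (cvg_comp _ (@ln R) cr); exact: continuous_ln.
have -> : expR (- (ln x / 2)) * (pi * (tanhpi tau * cos (tau * ln x + (b - pi / 2)))) =
  - (expR (- (ln x / 2)) * (pi * sechpi tau * (cos (pi / 2) * cos (tau * ln x + b) * cosh (tau * pi) -
    sin (pi / 2) * sin (tau * ln x + b) * sinh (tau * pi)))).
  by rewrite cos_pihalf sin_pihalf addrA cosBpihalf /tanhpi /sechpi; ring.
apply: cvgN; apply: cvgM.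
  by apply: (@cvg_derivable (fun l => expR (- (l / 2)))) cl => l; exact: ex_derive.
apply: cvgMr; apply: cvgB; (apply: cvgM; [apply: cvgM|]).
- by apply: (@cvg_derivable (fun l => cos (l / 2))) ct => l; exact: ex_derive.
- by apply: (@cvg_derivable (fun l => cos (tau * l + b))) cl => l; exact: ex_derive.
- by apply: (@cvg_derivable (fun l => cosh (tau * l))) ct => l; rewrite /cosh; exact: ex_derive.
- by apply: (@cvg_derivable (fun l => sin (l / 2))) ct => l; exact: ex_derive.
- by apply: (@cvg_derivable (fun l => sin (tau * l + b))) cl => l; exact: ex_derive.
- by apply: (@cvg_derivable (fun l => sinh (tau * l))) ct => l; rewrite /sinh; exact: ex_derive.
Qed.

Lemma itg_tanhpi v : itg v -> itg (fun tau => tanhpi tau * v tau).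
Proof. by move=> iv; apply: itg_bM => //; [exact: mfun_tanhpi|exact: tanhpi_le1]. Qed.
Lemma sq_bM (p v : R -> R) : mfun p -> (forall x, `|p x| <= 1) -> sq v -> sq (fun x => p x * v x).
Proof.
move=> mp p1 sv; have mv := sv.1; apply: (sq_le _ sv); first exact: measurable_funM.
by move=> x; rewrite normrM ler_piMl.
Qed.
Lemma sq_tanhpi v : sq v -> sq (fun tau => tanhpi tau * v tau).
Proof. exact: sq_bM mfun_tanhpi tanhpi_le1. Qed.
Definition quarter gam : R -> R := fun tau => gam tau - pi / 2.

Lemma mfun_quarter gam : mfun gam -> mfun (quarter gam).
Proof. by move=> mg; exact: measurable_funB. Qed.

Lemma Hilbert_reg_of_log_cvg v gam (x : R) (en : nat -> R) : 0 < x -> itg v -> mfun gam ->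
  (forall n, 0 < en n) -> en n @[n --> \oo] --> (0 : R) ->
  Hilbert_reg (en n) (of_log (cosint v gam)) x @[n --> \oo] --> pi * of_log (cosint (fun tau => tanhpi tau * v tau) (quarter gam)) x.
Proof.
move=> x0 iv mg en0 cen.
under eq_cvg do rewrite (Hilbert_reg_of_log x0 (en0 _) iv mg).2.
have inv := itg_tanhpi iv; have mq := mfun_quarter mg.
have x1 := Rp_pos x0.
have -> : pi * of_log (cosint (fun tau => tanhpi tau * v tau) (quarter gam)) x =
  Int (fun tau => v tau * (expR (- (ln x / 2)) * (pi * (tanhpi tau * cos (tau * ln x + (gam tau - pi / 2)))))).
  rewrite /of_log x1 mulr1 /cosint mulrA -IntZ; last exact: itg_cos_v.
  by apply: eq_Int => tau; rewrite /quarter; ring.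
have iG : itg (fun tau => expR (- (ln x / 2)) * (pi * 2) * `|v tau|) by apply: itgZ; exact: itg_norm.
apply: (dct _ _ iG).
- by move=> n; exact: (itg_m (Hilbert_reg_of_log x0 (en0 n) iv mg).1).
- have E tau : expR (- (ln x / 2)) * pi * (tanhpi tau * v tau * cos (tau * ln x + quarter gam tau)) =
    v tau * (expR (- (ln x / 2)) * (pi * (tanhpi tau * cos (tau * ln x + (gam tau - pi / 2))))).
    by rewrite /quarter; ring.
  exact: (itg_m (eq_itg E (itgZ _ (itg_cos_v (ln x) inv mq)))).
- by move=> n tau; rewrite normrM mulrC ler_wpM2r// atom_image_le.
- by apply: (aeW mu) => tau; apply: cvgMr; exact: atom_image_cvg.
Qed.

(** The conjugate Poisson kernel is odd. *)
Lemma Hilbert_reg_anti1 (e : R) g p : 0 < e -> itg g -> sq g -> sq p ->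
  Int (fun x => Hilbert_reg e g x * p x) = - Int (fun t => g t * Hilbert_reg e p t).
Proof.
move=> e0 ig sg sp; have mg := sg.1; have mp := sp.1.
pose K t x := g t * (conjP e (x - t) * p x).
have sQ t := sq_conjP t e0.
have iK t : itg (fun x => conjP e (x - t) * p x) by exact: sq_mul.
have C t : Int (fun x => `|conjP e (x - t) * p x|) <= e^-1 * pi + Int (fun x => p x ^+ 2).
  apply: (@le_trans _ _ (Int (fun x => conjP e (x - t) ^+ 2 + p x ^+ 2))).
    apply: Int_le; [exact: itg_norm|exact: itgD (sQ t).2 sp.2|].
    by move=> x; exact: normM_le.
  by rewrite (IntD (sQ t).2 sp.2) lerD2r (conjP2_int t e0).2.
have i2 : itg2 K.
  apply: (itg2_bound (G := fun t => (e^-1 * pi + Int (fun x => p x ^+ 2)) * `|g t|)).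
  - apply: measurable_funM; first exact: mfun2_fst.
    by apply: measurable_funM; [exact: (mfun2_swap (mfun2_conjP e))|exact: mfun2_snd].
  - by move=> t; exact: itgZ.
  - by apply: itgZ; exact: itg_norm.
  - move=> t; rewrite (eq_Int (g := fun x => `|g t| * `|conjP e (x - t) * p x|)); last by move=> x; rewrite normrM.
    by rewrite IntZ; [rewrite mulrC ler_wpM2r|exact: itg_norm].
transitivity (Int (fun x => Int (fun t => K t x))).
  apply: eq_Int => x; rewrite mulrC -IntZ.
    by apply: eq_Int => t; rewrite /K; ring.
  apply: itg_le (itgZ e^-1 (itg_norm ig)) _.
    by apply: measurable_funM => //; exact: (mfun2_row x (mfun2_conjP e)).
  by move=> t; rewrite normrM ler_wpM2r// conjP_le.
rewrite -(Fubini_Int i2) -mulN1r -IntZ; last first.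
  apply: sq_mul => //; exact: (Hilbert_reg_bound e0 sp).1.
apply: eq_Int => t; rewrite IntZ// /Hilbert_reg mulN1r -mulrN -mulN1r; congr (_ * _).
rewrite -IntZ; last first.
  by apply: sq_mul => //; exact: sq_conjP_row.
by apply: eq_Int => x; rewrite -[t - x]opprB conjP_odd; ring.
Qed.

(** The case of an integrable g extends by truncation and weak convergence. *)
Lemma Hilbert_reg_anti (e : R) g p : 0 < e -> sq g -> sq p ->
  Int (fun x => Hilbert_reg e g x * p x) = - Int (fun t => g t * Hilbert_reg e p t).
Proof.
move=> e0 sg sp.
have sQ x := sq_conjP_row x e0.
have p0 := pi_ge0 R; have sQp := (Hilbert_reg_bound e0 sp).1.
have [_ _ c1] : [/\ sq (Hilbert_reg e g), Int (fun x => Hilbert_reg e g x ^+ 2) <= pi ^+ 2 * Int (fun x => g x ^+ 2) &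
   Int (fun x => Hilbert_reg e (trunc n g) x * p x) @[n --> \oo] --> Int (fun x => Hilbert_reg e g x * p x)].
  apply: weak_cvg => //.
  - by move=> n; exact: (Hilbert_reg_bound e0 (sq_trunc n sg)).1.
  - move=> n; apply: le_trans (Hilbert_reg_bound e0 (sq_trunc n sg)).2 _.
    by rewrite ler_wpM2l ?sqr_ge0// Int_trunc2_le.
  - by apply: mfun_Hilbert_reg; exact: sg.1.
  - apply: (aeW mu) => x.
    have iG : itg (fun t => `|conjP e (x - t) * g t|) by apply: itg_norm; exact: sq_mul.
    apply: (dct _ _ iG).
    + by move=> n; apply: measurable_funM; [exact: (sQ x).1|exact: (sq_trunc n sg).1].
    + by apply: measurable_funM; [exact: (sQ x).1|exact: sg.1].
    + by move=> n t; rewrite [leLHS]normrM [leRHS]normrM ler_wpM2l// trunc_le.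
    + by apply: (aeW mu) => t; apply: cvgMr; exact: cvg_trunc.
have c2 : - Int (fun t => trunc n g t * Hilbert_reg e p t) @[n --> \oo] --> - Int (fun t => g t * Hilbert_reg e p t).
  have iG : itg (fun t => `|g t * Hilbert_reg e p t|) by apply: itg_norm; exact: sq_mul.
  apply: cvgN; apply: (dct _ _ iG).
  - by move=> n; apply: measurable_funM; [exact: (sq_trunc n sg).1|exact: sQp.1].
  - by apply: measurable_funM; [exact: sg.1|exact: sQp.1].
  - by move=> n t; rewrite [leLHS]normrM [leRHS]normrM ler_wpM2r// trunc_le.
  - by apply: (aeW mu) => t; apply: cvgMl; exact: cvg_trunc.
have E n : Int (fun x => Hilbert_reg e (trunc n g) x * p x) = - Int (fun t => trunc n g t * Hilbert_reg e p t).
  by apply: Hilbert_reg_anti1 => //; [exact: itg_trunc|exact: sq_trunc].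
move: c1; under eq_cvg do rewrite E; move=> c1.
exact: cvg_unique c1 c2.
Qed.

(** The limit is moved to the cosine integral: both sides converge weakly, and the
    regularized operators are antisymmetric.  The symbol is tanh (pi tau), with the
    phase shifted by a quarter turn. *)
Lemma Hilbert_pair g ginf v gam (en : nat -> R) : mfun g -> sq (fun t => g t * \1_Rp t) ->
  mfun ginf -> itg v -> sq v -> mfun gam ->
  (forall n, 0 < en n) -> en n @[n --> \oo] --> (0 : R) ->
  {ae mu, forall x, 0 < x -> Hilbert_reg (en n) (fun t => g t * \1_Rp t) x @[n --> \oo] --> ginf x} ->
  itg (fun x => ginf x * of_log (cosint v gam) x) /\
  Int (fun x => ginf x * of_log (cosint v gam) x) = - (pi * pairing g (fun tau => tanhpi tau * v tau) (quarter gam)).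
Proof.
move=> mg sg mgi iv sv mgam en0 cen cQ.
set G := fun t => g t * \1_Rp t in sg cQ *.
have [sH _] := bessel iv sv mgam; have sU := sq_of_log sH.
have sH' := (bessel (itg_tanhpi iv) (sq_tanhpi sv) (mfun_quarter mgam)).1.
have UR H x : of_log H x * \1_Rp x = of_log H x by rewrite /of_log -mulrA Rp2.
have [s1 _ c1] : [/\ sq (fun x => ginf x * \1_Rp x), Int (fun x => (ginf x * \1_Rp x) ^+ 2) <= pi ^+ 2 * Int (fun x => G x ^+ 2) &
   Int (fun x => (Hilbert_reg (en n) G x * \1_Rp x) * of_log (cosint v gam) x) @[n --> \oo] --> Int (fun x => (ginf x * \1_Rp x) * of_log (cosint v gam) x)].
  apply: weak_cvg => //.
  - by move=> n; apply: sq_Rp; exact: (Hilbert_reg_bound (en0 n) sg).1.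
  - move=> n; apply: le_trans (Hilbert_reg_bound (en0 n) sg).2.
    apply: Int_le; [exact: (sq_Rp (Hilbert_reg_bound (en0 n) sg).1).2|exact: (Hilbert_reg_bound (en0 n) sg).1.2|].
    move=> x; rewrite exprMn [X in _ * X]expr2 Rp2 ler_piMr ?sqr_ge0//; exact: Rp_le1.
  - by apply: measurable_funM => //; exact: mfun_Rp.
  - apply: aeS cQ => x cx; have [x0|x0] := ltP 0 x; first by apply: cvgMl; exact: cx.
    rewrite Rp_neg// mulr0.
    by under eq_cvg do rewrite mulr0; exact: cvg_cst.
have [_ _ c2] : [/\ sq (fun x => pi * of_log (cosint (fun tau => tanhpi tau * v tau) (quarter gam)) x),
    Int (fun x => (pi * of_log (cosint (fun tau => tanhpi tau * v tau) (quarter gam)) x) ^+ 2) <= pi ^+ 2 * Int (fun x => of_log (cosint v gam) x ^+ 2) &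
   Int (fun x => (Hilbert_reg (en n) (of_log (cosint v gam)) x * \1_Rp x) * G x) @[n --> \oo] -->
   Int (fun x => (pi * of_log (cosint (fun tau => tanhpi tau * v tau) (quarter gam)) x) * G x)].
  apply: weak_cvg => //.
  - by move=> n; apply: sq_Rp; exact: (Hilbert_reg_bound (en0 n) sU).1.
  - move=> n; apply: le_trans (Hilbert_reg_bound (en0 n) sU).2.
    apply: Int_le; [exact: (sq_Rp (Hilbert_reg_bound (en0 n) sU).1).2|exact: (Hilbert_reg_bound (en0 n) sU).1.2|].
    move=> x; rewrite exprMn [X in _ * X]expr2 Rp2 ler_piMr ?sqr_ge0//; exact: Rp_le1.
  - by apply: measurable_funM => //; exact: mfun_of_log sH'.1.
  - apply: (aeW mu) => x; have [x0|x0] := ltP 0 x.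
      rewrite -UR mulrA; apply: cvgMl; exact: Hilbert_reg_of_log_cvg.
    rewrite /of_log Rp_neg// !mulr0.
    by under eq_cvg do rewrite mulr0; exact: cvg_cst.
have E x : ginf x * \1_Rp x * of_log (cosint v gam) x = ginf x * of_log (cosint v gam) x.
  by rewrite -mulrA [\1_Rp x * _]mulrC UR.
split; first exact: (eq_itg E (sq_mul s1 sU)).
rewrite -(eq_Int E).
have E2 n : Int (fun x => (Hilbert_reg (en n) G x * \1_Rp x) * of_log (cosint v gam) x) =
  - Int (fun x => (Hilbert_reg (en n) (of_log (cosint v gam)) x * \1_Rp x) * G x).
  rewrite (eq_Int (g := fun x => Hilbert_reg (en n) G x * of_log (cosint v gam) x)); last first.
    by move=> x; rewrite -mulrA [\1_Rp x * _]mulrC UR.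
  rewrite Hilbert_reg_anti//; congr (- _); apply: eq_Int => x.
  by rewrite /G -[X in _ * X * _ = _]Rp2; ring.
have {}c1 : - Int (fun x => (Hilbert_reg (en n) (of_log (cosint v gam)) x * \1_Rp x) * G x) @[n --> \oo] --> Int (fun x => (ginf x * \1_Rp x) * of_log (cosint v gam) x).
  by under eq_cvg do rewrite -E2.
have -> : Int (fun x => ginf x * \1_Rp x * of_log (cosint v gam) x) =
    - Int (fun x => pi * of_log (cosint (fun tau => tanhpi tau * v tau) (quarter gam)) x * G x).
  have c3 : - Int (fun x => (Hilbert_reg (en n) (of_log (cosint v gam)) x * \1_Rp x) * G x) @[n --> \oo] -->
    - Int (fun x => pi * of_log (cosint (fun tau => tanhpi tau * v tau) (quarter gam)) x * G x).
    exact: cvgN.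
  exact: cvg_unique c1 c3.
congr (- _).
rewrite /pairing -(pair_log sg mg sH') -IntZ; last first.
  have E4 x : G x * of_log (cosint (fun tau => tanhpi tau * v tau) (quarter gam)) x = g x * of_log (cosint (fun tau => tanhpi tau * v tau) (quarter gam)) x.
    by rewrite /G -mulrA [\1_Rp x * _]mulrC UR.
  exact: (eq_itg E4 (sq_mul sg (sq_of_log sH'))).
by apply: eq_Int => x; rewrite -[in RHS]UR /G; ring.
Qed.
End HilbertPairing.

(** * Uniqueness for Poisson integrals *)
Section PoissonUniqueness.
Context {R : realType}.
Local Notation mu := (@lebesgue_measure R).
Implicit Types f g h u : R -> R.

Lemma Int0_ae_eq0 f : itg f -> (forall x, 0 <= f x) -> Int f = 0 -> {ae mu, forall x, f x = 0}.
Proof.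
move=> iF f0 If.
have h : (\int[mu]_(x in setT) `|(f x)%:E| = 0)%E.
  rewrite (_ : (\int[mu]_(x in _) _)%E = (\int[mu]_x (f x)%:E)%E); first by rewrite -IntE// If.
  by apply: eq_integral => x _; rewrite gee0_abs// lee_fin.
have mf : measurable_fun setT (EFin \o f) by apply/measurable_EFinP; exact: itg_m.
have /(ae_eq_integral_abs mu measurableT mf) : (\int[mu]_(x in setT) `|(EFin \o f) x| = 0)%E by [].
by apply: aeS => x /(_ I) [].
Qed.

(** Lebesgue's differentiation theorem. *)
Lemma interval_integrals_eq0 f : itg f ->
  (forall x, Int (fun t => f t * \1_(`]-oo, x]%classic) t) = 0) -> {ae mu, forall x, f x = 0}.
Proof.
move=> iF f0.
have iy (y : R) : mu.-integrable `]-oo, y] (EFin \o f) by exact: (integrableS measurableT).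
have lf : locally_integrable [set: R] f.
  rewrite (_ : f = f \_ [set: R]); first exact: integrable_locally.
  by rewrite patch_indic; apply/funext => x; rewrite indicT mulr1.
have := FTC1Ny iy lf.
apply: aeS => x [_]; rewrite (_ : (fun x0 : R => _) = cst 0).
  by rewrite derive1_cst.
by apply/funext => y; rewrite Rintegral_Int f0.
Qed.

(** The Poisson integral of the indicator of [c, d]. *)
Definition pbox (e c d y : R) : R := Int (fun b => poisson e (y - b) * \1_(`[c, d]%classic) b).

Lemma poisson_subC (e x y : R) : poisson e (x - y) = poisson e (y - x).
Proof. by rewrite -opprB poisson_sym. Qed.

Lemma pboxE (e c d y : R) : 0 < e -> c <= d -> pbox e c d y = atan ((d - y) / e) - atan ((c - y) / e).
Proof.
move=> e0 cd; rewrite /pbox -Rintegral_Int.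
rewrite (_ : (fun b => _) = (fun b => poisson e (b - y))); last by apply/funext => b; exact: poisson_subC.
rewrite (FTC_itv cd (fun b => is_derive_atan_div y b e0))//.
apply: continuous_mul; first exact: cst_continuous.
apply: continuous_inv => b; first by apply: derivable_continuous => x; exact: ex_derive.
by rewrite gt_eqF// addrC Qden_gt0.
Qed.

Lemma itg_poisson_shift (e b : R) : 0 < e -> itg (fun y => poisson e (b - y)).
Proof. by move=> e0; exact: (eq_itg (fun y => poisson_subC e y b) (poisson_int b e0).1). Qed.

Lemma itg_box (c d : R) : itg (\1_(`[c, d]%classic) : R -> R).
Proof. exact: integrable_indic_itv. Qed.

Lemma pbox_bound (e c d : R) : 0 < e -> 
  [/\ itg (pbox e c d), Int (pbox e c d) = pi * Int (\1_(`[c, d]%classic) : R -> R) & forall y, 0 <= pbox e c d y <= pi].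
Proof.
move=> e0; pose K (b y : R) := \1_(`[c, d]%classic) b * poisson e (y - b).
have m1 : mfun (\1_(`[c, d]%classic) : R -> R) := mfun_indic (measurable_itv _).
have i2 : itg2 K.
  apply: (itg2_bound (G := fun b => pi * \1_(`[c, d]%classic) b)).
  - by apply: measurable_funM; [exact: (mfun2_fst m1)|exact: (mfun2_swap (mfun2_poisson e))].
  - by move=> b; apply: itgZ; exact: (poisson_int b e0).1.
  - by apply: itgZ; exact: itg_box.
  - move=> b; rewrite (eq_Int (g := K b)).
      by rewrite IntZ ?(poisson_int b e0).2 1?mulrC//; exact: (poisson_int b e0).1.
    by move=> y; rewrite ger0_norm// mulr_ge0 ?poisson_ge0// ind_ge0.
have E y : Int (fun b => K b y) = pbox e c d y by apply: eq_Int => b; rewrite mulrC.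
split; first exact: (eq_itg E (itg2_Int (itg2_swap i2))).
  rewrite -(eq_Int E) -(Fubini_Int i2) -IntZ; last exact: itg_box.
  by apply: eq_Int => b; rewrite IntZ ?(poisson_int b e0).2 1?mulrC//; exact: (poisson_int b e0).1.
move=> y; apply/andP; split; first by apply: Int_ge0 => b; rewrite mulr_ge0 ?poisson_ge0// ind_ge0.
rewrite -(poisson_int y e0).2; apply: Int_le.
- by apply: itg_indicM => //; exact: itg_poisson_shift.
- exact: (poisson_int y e0).1.
- move=> b; rewrite poisson_subC ler_piMr ?poisson_ge0// indicE; by case: (_ \in _).
Qed.

Lemma pbox_pair (e c d : R) u : 0 < e -> sq u ->
  (forall b, Int (fun y => u y * poisson e (y - b)) = 0) -> Int (fun y => pbox e c d y * u y) = 0.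
Proof.
move=> e0 su u0; have mu' := su.1.
have m1 : mfun (\1_(`[c, d]%classic) : R -> R) := mfun_indic (measurable_itv _).
have sp (b : R) := sq_poisson b e0.
pose C := Int (fun y => u y ^+ 2) + Int (fun y => poisson e (y - 0) ^+ 2).
have CE (b : R) : Int (fun y => `|u y * poisson e (y - b)|) <= C.
  have E : Int (fun y => poisson e (y - 0) ^+ 2) = Int (fun y => poisson e (y - b) ^+ 2).
    have := (itg_shift b (sp 0).2).2 => <-; by apply: eq_Int => y; rewrite subr0.
  rewrite /C E -(IntD su.2 (sp b).2); apply: Int_le.
  - by apply: itg_norm; exact: sq_mul.
  - exact: itgD su.2 (sp b).2.
  - by move=> y; exact: normM_le.
pose K (b y : R) := \1_(`[c, d]%classic) b * (u y * poisson e (y - b)).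
have i2 : itg2 K.
  apply: (itg2_bound (G := fun b => C * \1_(`[c, d]%classic) b)).
  - apply: measurable_funM; first exact: (mfun2_fst m1).
    by apply: measurable_funM; [exact: mfun2_snd|exact: (mfun2_swap (mfun2_poisson e))].
  - by move=> b; apply: itgZ; exact: sq_mul.
  - by apply: itgZ; exact: itg_box.
  - move=> b; rewrite (eq_Int (g := fun y => \1_(`[c, d]%classic) b * `|u y * poisson e (y - b)|)).
      by rewrite IntZ; [rewrite mulrC ler_wpM2r// ind_ge0|apply: itg_norm; exact: sq_mul].
    by move=> y; rewrite normrM (ger0_norm (ind_ge0 _ _)).
transitivity (Int (fun y => Int (fun b => K b y))).
  apply: eq_Int => y; rewrite /pbox mulrC -IntZ; last first.
    by apply: itg_indicM => //; exact: itg_poisson_shift.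
  by apply: eq_Int => b; rewrite /K; ring.
rewrite -(Fubini_Int i2) -[RHS]Int0; apply: eq_Int => b.
by rewrite IntZ ?u0 ?mulr0//; exact: sq_mul.
Qed.

Lemma cvg_natS (s : R) : 0 < s -> s / n.+1%:R^-1 @[n --> \oo] --> +oo.
Proof.
move=> s0; have := @cvg_affine_pinfty R s s s0; apply: cvg_trans; apply: near_eq_cvg.
by apply: nearW => n; rewrite invrK -natr1 mulrDr mulr1.
Qed.

Lemma cvg_atan_sgn (s : R) : s != 0 -> atan (s / n.+1%:R^-1) @[n --> \oo] --> (if 0 < s then 1 else -1) * (pi / 2).
Proof.
move=> s0; case: ltP => hs; first by rewrite mul1r; apply: cvg_atan_pinfty; exact: cvg_natS.
have s1 : 0 < - s by rewrite oppr_gt0 lt_neqAle s0.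
rewrite mulN1r (_ : (fun n => _) = (fun n => - atan (- s / n.+1%:R^-1))); last first.
  by apply/funext => n; rewrite -atanN mulNr opprK.
by apply: cvgN; apply: cvg_atan_pinfty; exact: cvg_natS.
Qed.

(** By Fubini, u is orthogonal to the Poisson integrals of all intervals.  These
    are bounded in L2 and converge, as e tends to 0, to pi times the indicators,
    so u has integral zero over every interval. *)
Lemma poisson_unique u : sq u ->
  (forall e b, 0 < e -> Int (fun y => u y * poisson e (y - b)) = 0) -> {ae mu, forall y, u y = 0}.
Proof.
move=> su u0.
have box (c d : R) : c <= d -> Int (fun y => u y * \1_(`[c, d]%classic) y) = 0.
  move=> cd; have e0 n : 0 < n.+1%:R^-1 :> R by rewrite invr_gt0.
  have p0 := pi_ge0 R.
  pose C := pi * (pi * Int (\1_(`[c, d]%classic) : R -> R)).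
  have sA n : sq (pbox n.+1%:R^-1 c d) /\ Int (fun y => pbox n.+1%:R^-1 c d y ^+ 2) <= C.
    have [iA IA bA] := pbox_bound c d (e0 n).
    have le2 y : pbox n.+1%:R^-1 c d y ^+ 2 <= pi * pbox n.+1%:R^-1 c d y.
      by have /andP[h1 h2] := bA y; rewrite expr2 ler_wpM2r.
    have i2 : itg (fun y => pbox n.+1%:R^-1 c d y ^+ 2).
      have mA := itg_m iA; apply: itg_le (itgZ pi iA) _; first exact: measurable_funX.
      by move=> y; rewrite ger0_norm ?sqr_ge0.
    split; first by split => //; exact: itg_m iA.
    by rewrite /C -IA -IntZ//; apply: Int_le => //; exact: itgZ.
  have [_ _ cv] : [/\ sq (fun y => pi * \1_(`[c, d]%classic) y), Int (fun y => (pi * \1_(`[c, d]%classic) y) ^+ 2) <= C &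
     Int (fun y => pbox n.+1%:R^-1 c d y * u y) @[n --> \oo] --> Int (fun y => pi * \1_(`[c, d]%classic) y * u y)].
    apply: weak_cvg => //.
    - by move=> n; exact: (sA n).1.
    - by move=> n; exact: (sA n).2.
    - by apply: measurable_funM => //; exact: mfun_indic.
    - apply: aeS (aeI (ae_neq c) (ae_neq d)) => y [yc yd].
      (* Away from c and d the primitive atan tends to +pi / 2 or -pi / 2, and the
         difference of the two limits is pi inside the interval and 0 outside. *)
      have E : (pi * \1_(`[c, d]%classic) y = (if 0 < d - y then 1 else -1) * (pi / 2) - (if 0 < c - y then 1 else -1) * (pi / 2) :> R)%R.
        rewrite indicE mem_setE in_itv/= !subr_gt0.
        by have [h1|h1|h1] := ltgtP c y; have [h2|h2|h2] := ltgtP d y; rewrite /=; (try by field); exfalso; subst; rewrite ?eqxx in yc yd; lra.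
      rewrite E; under eq_cvg do rewrite pboxE//.
      by apply: cvgB; apply: cvg_atan_sgn; rewrite subr_eq0 eq_sym.
  have : Int (fun y => pi * \1_(`[c, d]%classic) y * u y) = 0.
    have cv0 : Int (fun y => pbox n.+1%:R^-1 c d y * u y) @[n --> \oo] --> (0 : R).
      rewrite (_ : (fun n => _) = (fun=> 0)); first exact: cvg_cst.
      by apply/funext => n; apply: pbox_pair => // b; exact: u0.
    exact: cvg_unique cv cv0.
  rewrite (eq_Int (g := fun y => pi * (u y * \1_(`[c, d]%classic) y))); last by move=> y; ring.
  rewrite IntZ; last first.
    apply: sq_mul => //; split; first exact: mfun_indic.
    by apply: eq_itg (itg_box c d) => x; rewrite indicE; case: (_ \in _); rewrite ?expr1n ?expr0n.
  by move/eqP; rewrite mulf_eq0 gt_eqF ?pi_gt0//= => /eqP.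
have tr n : {ae mu, forall y, trunc n u y = 0}.
  apply: interval_integrals_eq0; first exact: itg_trunc.
  move=> x; have [xn|xn] := ltP x (- n%:R).
    rewrite -[RHS]Int0; apply: eq_Int => y; rewrite /trunc !indicE !mem_setE !in_itv/=.
    by have [h1|h1] := leP (- n%:R) y; have [h2|h2] := leP y x; rewrite ?mulr0//=; lra.
  have n0 : (0 : R) <= n%:R by [].
  rewrite -[RHS](@box (- n%:R) (Num.min x n%:R)); last by rewrite le_min xn/=; lra.
  apply: eq_Int => y; rewrite /trunc -mulrA; congr (_ * _).
  rewrite !indicE !mem_setE !in_itv/= le_min.
  by case: (_ <= y); case: (y <= x); case: (y <= _); rewrite ?mulr1 ?mulr0.
have : {ae mu, forall y n, trunc n u y = 0} by apply/ae_foralln => n; exact: tr.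
apply: aeS => y h; have c1 : trunc n u y @[n --> \oo] --> u y by exact: cvg_trunc.
have c2 : trunc n u y @[n --> \oo] --> (0 : R) by under eq_cvg do rewrite h; exact: cvg_cst.
exact: cvg_unique c1 c2.
Qed.

End PoissonUniqueness.

(** * Vanishing from the pairings *)
Section Core.
Context {R : realType}.
Local Notation mu := (@lebesgue_measure R).
Local Notation Rp := (`]0%R, +oo[%classic : set R).
Implicit Types f g h u v gam : R -> R.

(** The amplitudes v of the test functions cosint v gam. *)
Definition testfun v := itg v /\ sq v.

Lemma testfun_bM (p v : R -> R) : mfun p -> (forall x, `|p x| <= 1) -> testfun v -> testfun (fun x => p x * v x).
Proof. by move=> mp p1 [iv sv]; split; [exact: itg_bM|exact: sq_bM]. Qed.
Lemma testfun_sechpi v : testfun v -> testfun (fun x => sechpi x * v x).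
Proof. exact: testfun_bM mfun_sechpi sechpi_le1. Qed.
Lemma testfun_tanhpi v : testfun v -> testfun (fun x => tanhpi x * v x).
Proof. exact: testfun_bM mfun_tanhpi tanhpi_le1. Qed.
Lemma testfunD v w : testfun v -> testfun w -> testfun (fun x => v x + w x).
Proof. by move=> [iv sv] [iw sw]; split; [exact: itgD|exact: sqD]. Qed.
Lemma testfunZ a v : testfun v -> testfun (fun x => a * v x).
Proof. by move=> [iv sv]; split; [exact: itgZ|exact: sqZ]. Qed.

Section Pairing.
Context (g : R -> R) (su : sq (to_log g)).

Lemma sq_cosint v gam : testfun v -> mfun gam -> sq (cosint v gam).
Proof. by move=> [iv sv] mg; exact: (bessel iv sv mg).1. Qed.

Lemma pairingD v w gam : testfun v -> testfun w -> mfun gam ->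
  pairing g (fun x => v x + w x) gam = pairing g v gam + pairing g w gam.
Proof.
move=> tv tw mg; rewrite /pairing -IntD; [|exact: sq_mul su (sq_cosint tv mg)|exact: sq_mul su (sq_cosint tw mg)].
apply: eq_Int => y; rewrite -mulrDr; congr (_ * _); rewrite /cosint -IntD; [|exact: itg_cos_v tv.1 mg|exact: itg_cos_v tw.1 mg].
by apply: eq_Int => x; rewrite mulrDl.
Qed.

Lemma pairingZ a v gam : testfun v -> mfun gam -> pairing g (fun x => a * v x) gam = a * pairing g v gam.
Proof.
move=> tv mg; rewrite /pairing -IntZ; last exact: sq_mul su (sq_cosint tv mg).
apply: eq_Int => y; rewrite mulrCA; congr (_ * _); rewrite /cosint -IntZ; last exact: itg_cos_v tv.1 mg.
by apply: eq_Int => x; rewrite mulrA.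
Qed.

Lemma eq_pairing v w gam del : v =1 w -> gam =1 del -> pairing g v gam = pairing g w del.
Proof. by move=> /funext -> /funext ->. Qed.

Lemma pairing_halfturn v gam : testfun v -> mfun gam ->
  pairing g v (fun x => gam x + pi / 2) = - pairing g v (quarter gam).
Proof.
move=> tv mg; have mq := mfun_quarter mg.
rewrite /pairing -IntN; last exact: sq_mul su (sq_cosint tv mq).
apply: eq_Int => y; rewrite -mulrN; congr (_ * _); rewrite /cosint -IntN; last exact: itg_cos_v tv.1 mq.
apply: eq_Int => x; rewrite -mulrN; congr (_ * _); rewrite /quarter !addrA.
by rewrite cosD_pihalf cosBpihalf.
Qed.

(** Dominated convergence of the amplitudes gives pointwise convergence of the cosine
    integrals, and Bessel's inequality bounds their norms. *)
Lemma pairing_cvg (vn : nat -> R -> R) v w gam : (forall n, mfun (vn n)) -> mfun v -> testfun w ->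
  (forall n x, `|vn n x| <= `|w x|) -> {ae mu, forall x, vn n x @[n --> \oo] --> v x} -> testfun v -> mfun gam ->
  pairing g (vn n) gam @[n --> \oo] --> pairing g v gam.
Proof.
move=> mvn mv tw vw cv tv mg; have [iw sw] := tw.
have tvn n : testfun (vn n).
  split; last exact: sq_le (mvn n) sw (vw n).
  by apply: itg_le (itg_norm iw) _ => // x; exact: vw.
have p0 : 0 <= pi + pi :> R by rewrite addr_ge0 ?pi_ge0.
have [_ _] : [/\ sq (cosint v gam), Int (fun y => cosint v gam y ^+ 2) <= (pi + pi) * Int (fun x => w x ^+ 2) &
    Int (fun y => cosint (vn n) gam y * to_log g y) @[n --> \oo] --> Int (fun y => cosint v gam y * to_log g y)].
  apply: weak_cvg => //.
  - by move=> n; exact: sq_cosint.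
  - move=> n; apply: le_trans (bessel (tvn n).1 (tvn n).2 mg).2 _.
    rewrite ler_wpM2l//; apply: Int_le; [exact: (tvn n).2.2|exact: sw.2|].
    move=> x; rewrite -[vn n x ^+ 2]real_normK ?num_real// -[w x ^+ 2]real_normK ?num_real//.
    by rewrite lerXn2r ?nnegrE// vw.
  - exact: mfun_cosint.
  - apply: (aeW mu) => y; have inw := itg_norm iw.
    apply: (dct _ _ inw).
    + by move=> n; exact: itg_m (itg_cos_v y (tvn n).1 mg).
    + exact: itg_m (itg_cos_v y tv.1 mg).
    + move=> n x; apply: le_trans (vw n x); by rewrite normrM ler_piMr// cos_max.
    + by apply: aeS cv => x cx; exact: cvgMl.
rewrite /pairing (eq_Int (f := fun y => cosint v gam y * to_log g y) (g := fun y => to_log g y * cosint v gam y)); last by move=> y; rewrite mulrC.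
by under eq_cvg do rewrite (eq_Int (fun y => mulrC (cosint _ gam y) (to_log g y))).
Qed.

End Pairing.

Section Symbol.
Context (c1 c2 : R).
(** The squared modulus of 2 sech (pi tau) - c for the complex number c = c1 + i c2. *)
Definition symbol (tau : R) : R := (2 * sechpi tau - c1) ^+ 2 + c2 ^+ 2.

Lemma mfun_symbol : mfun symbol.
Proof.
apply: measurable_funD => //; apply: measurable_funX; apply: measurable_funB => //.
by apply: measurable_funM => //; exact: mfun_sechpi.
Qed.

Lemma symbol_ge0 tau : 0 <= symbol tau.
Proof. by rewrite addr_ge0 ?sqr_ge0. Qed.

Lemma cosh_inj_abs (a b : R) : cosh a = cosh b -> `|a| = `|b|.
Proof.
rewrite -(cosh_abs a) -(cosh_abs b) /cosh !expRN => h.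
have p1 : 1 <= expR `|a| by rewrite -expR0 ler_expR.
have q1 : 1 <= expR `|b| by rewrite -expR0 ler_expR.
suff E : expR `|a| = expR `|b| by rewrite -[LHS]expRK E expRK.
move: (expR `|a|) (expR `|b|) p1 q1 h => p q p1 q1 h.
have p0 : 0 < p by lra. have q0 : 0 < q by lra.
have : (q - p) * (p * q - 1) = 0.
  have -> : (q - p) * (p * q - 1) = p * q * (2 * ((q + q^-1) / 2 - (p + p^-1) / 2)).
    by field; rewrite !gt_eqF.
  by rewrite h subrr !mulr0.
move/eqP; rewrite mulf_eq0 !subr_eq0 => /orP[/eqP -> //|/eqP pq].
have pq1 : 0 <= (p - 1) * (q - 1) by rewrite mulr_ge0// subr_ge0.
have : (p - 1) * (q - 1) = p * q - p - q + 1 by ring.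
by rewrite pq => h'; rewrite h' in pq1; lra.
Qed.

(** The function sech (pi tau) takes each value at most twice, at opposite points. *)
Lemma symbol_ae : {ae mu, forall tau, symbol tau != 0}.
Proof.
have [[t0 ht0]|none] := pselect (exists t, symbol t = 0); last first.
  by apply: (aeW mu) => t; apply/eqP => h; apply: none; exists t.
have Q0 t : symbol t = 0 -> 2 * sechpi t = c1.
  move/eqP; rewrite paddr_eq0 ?sqr_ge0// => /andP[h _].
  by move: h; rewrite expf_eq0/= subr_eq0 => /eqP.
apply: aeS (aeI (ae_neq t0) (ae_neq (- t0))) => t [h1 h2]; apply/eqP => h.
have /cosh_inj_abs : cosh (t * pi) = cosh (t0 * pi).
  apply: invr_inj; rewrite -!/(sechpi _).
  by have := Q0 _ h; have := Q0 _ ht0; lra.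
rewrite !normrM => /(mulIf _) H.
have {H} : `|t| = `|t0| by apply: H; rewrite normr_eq0 gt_eqF ?pi_gt0.
by move=> /eqP; rewrite eqr_norm2 (negbTE h1) (negbTE h2).
Qed.

Lemma testfun_expabs (e : R) : 0 < e -> testfun (fun t => expR (- (e * `|t|))).
Proof.
move=> e0; have i1 := itg_laplace e0; have m1 := itg_m i1.
split => //; split => //; apply: itg_le i1 _; first exact: measurable_funX.
move=> t; rewrite ger0_norm ?sqr_ge0// expr2 ler_piMr ?expR_ge0//.
by rewrite -expR0 ler_expR oppr_le0 mulr_ge0// ltW.
Qed.

(** A multiplier that is nonzero almost everywhere can be divided out.  With amplitude
    w = e^(-e|t|) and phase - t b, the cosine integral is 2 poisson e (y - b), so by
    poisson_unique it suffices that the pairing with w vanishes; w is approximated by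
    its restrictions to the sets where the symbol exceeds 1 / (n + 1). *)
Lemma symbol_injective g : sq (to_log g) ->
  (forall v gam, testfun v -> mfun gam -> pairing g (fun t => symbol t * v t) gam = 0) ->
  {ae mu, forall y, to_log g y = 0}.
Proof.
move=> su QL; apply: poisson_unique => // e b e0.
pose w (t : R) := expR (- (e * `|t|)); have tw : testfun w := testfun_expabs e0.
pose gam (t : R) := - (t * b); have mg : mfun gam by apply: measurable_funN; exact: measurable_funM.
pose dn n : R := n.+1%:R^-1; have d0 n : 0 < dn n by rewrite invr_gt0.
pose level n t : R := if dn n < symbol t then 1 else 0.
have mch n : mfun (level n).
  by apply: measurable_fun_ifT => //; apply: measurable_fun_ltr => //; exact: mfun_symbol.
(* level n / symbol is at most n + 1; the factor dn n normalizes the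
   quotient to at most 1. *)
have tvn n : testfun (fun t => dn n * (level n t / symbol t) * w t).
  apply: testfun_bM => //.
    have mQV : mfun (fun t => (symbol t)^-1) by apply: mfunV; exact: mfun_symbol.
    have m2 : mfun (fun t => level n t / symbol t) by apply: measurable_funM; [exact: mch|exact: mQV].
    by apply: measurable_funM.
  move=> t; rewrite /level; case: ltP => h; last by rewrite mul0r mulr0 normr0.
  have q0 : 0 < symbol t := lt_trans (d0 n) h.
  have r0 : 0 <= dn n / symbol t by rewrite divr_ge0// ltW.
  by rewrite [1 / _]mul1r ger0_norm// ler_pdivrMr// mul1r ltW.
have wnE n t : level n t * w t = (dn n)^-1 * (symbol t * (dn n * (level n t / symbol t) * w t)).
  rewrite /level; case: ltP => h; last by rewrite !mul0r mulr0 mul0r !mulr0.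
  have q0 : 0 < symbol t := lt_trans (d0 n) h.
  by field; rewrite !gt_eqF.
have tQ n : testfun (fun t => symbol t * (dn n * (level n t / symbol t) * w t)).
  have E t : dn n * (level n t * w t) = symbol t * (dn n * (level n t / symbol t) * w t).
    by rewrite wnE mulVKf// gt_eqF.
  rewrite (_ : (fun t => _) = (fun t => dn n * (level n t * w t))); last by apply/funext => t; rewrite E.
  apply: testfunZ; apply: testfun_bM => //.
  by move=> t; rewrite /level; case: ifP; rewrite ?normr1 ?normr0.
have L0 n : pairing g (fun t => level n t * w t) gam = 0.
  by rewrite (eq_pairing _ (wnE n) (fun=> erefl)) (pairingZ su _ (tQ n) mg) QL ?mulr0.
have cw : pairing g (fun t => level n t * w t) gam @[n --> \oo] --> pairing g w gam.
  apply: (pairing_cvg su _ _ tw) => //.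
  - by move=> n; apply: measurable_funM; [exact: mch|exact: (itg_m tw.1)].
  - exact: (itg_m tw.1).
  - by move=> n t; rewrite normrM ler_piMl// /level; case: ifP; rewrite ?normr1 ?normr0.
  - apply: aeS symbol_ae => t q; have q0 : 0 < symbol t by rewrite lt_neqAle eq_sym q symbol_ge0.
    rewrite -[X in _ --> X]mul1r; apply: cvgMl.
    apply: cvg_near_cst; near=> n; rewrite /level ifT//.
    by near: n; apply: (cvgr_lt _ (@cvg_harmonic R)).
have Lw : pairing g w gam = 0.
  have c0 : pairing g (fun t => level n t * w t) gam @[n --> \oo] --> (0 : R).
    by under eq_cvg do rewrite L0; exact: cvg_cst.
  exact: cvg_unique cw c0.
have HE y : cosint w gam y = 2 * poisson e (y - b).
  have [_ h] := laplace_cosT (y - b) 0 e0.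
  transitivity (Int (fun t => expR (- (e * `|t|)) * cos ((y - b) * t + 0))).
    by apply: eq_Int => t; rewrite /w /gam; congr (_ * cos _); ring.
  by rewrite h cos0 /poisson; ring.
have sP := sq_poisson b e0.
have : pairing g w gam = 2 * Int (fun y => to_log g y * poisson e (y - b)).
  rewrite /pairing -IntZ; last exact: sq_mul.
  by apply: eq_Int => y; rewrite HE; ring.
rewrite Lw => /esym/eqP; rewrite mulf_eq0 pnatr_eq0/= => /eqP ->//.
Unshelve. all: by end_near. Qed.

(** With L = L1 + i L2, M = M1 + i M2 and c = a + i b, the hypotheses are the relation
    c L = 2 M and the real part of c M = 2 (N + i N'); the conclusion is the real part of
    4 (N + i N') - 4 a M + |c|^2 L = 0. *)
Lemma symbol_algebra (a b L1 L2 M1 M2 N : R) : a * L1 - b * L2 = 2 * M1 -> a * L2 + b * L1 = 2 * M2 ->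
  a * M1 - b * M2 = 2 * N -> 4 * N + (- (4 * a)) * M1 + (a ^+ 2 + b ^+ 2) * L1 = 0.
Proof.
move=> h1 h2 h3.
have -> : N = (a * M1 - b * M2) / 2 by rewrite h3; field.
have -> : M1 = (a * L1 - b * L2) / 2 by rewrite h1; field.
have -> : M2 = (a * L2 + b * L1) / 2 by rewrite h2; field.
by field.
Qed.

(** In complex terms, (2 m - c) F = 0 with F = g1 + i g2 and c = c1 + i c2.
    Multiplication by the conjugate factor separates g1 from g2, and each of them is
    annihilated by the symbol |2 m - c|^2. *)
Lemma pairing_core g1 g2 : sq (to_log g1) -> sq (to_log g2) ->
  (forall v gam, testfun v -> mfun gam ->
     c1 * pairing g1 v gam - c2 * pairing g2 v gam = 2 * pairing g1 (fun t => sechpi t * v t) gam /\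
     c1 * pairing g2 v gam + c2 * pairing g1 v gam = 2 * pairing g2 (fun t => sechpi t * v t) gam) ->
  {ae mu, forall y, to_log g1 y = 0} /\ {ae mu, forall y, to_log g2 y = 0}.
Proof.
move=> s1 s2 H.
have E v t : symbol t * v t = (4 * (sechpi t * (sechpi t * v t)) + (- (4 * c1)) * (sechpi t * v t)) + (c1 ^+ 2 + c2 ^+ 2) * v t.
  by rewrite /symbol; ring.
have LE g v gam : sq (to_log g) -> testfun v -> mfun gam -> pairing g (fun t => symbol t * v t) gam =
   4 * pairing g (fun t => sechpi t * (sechpi t * v t)) gam + (- (4 * c1)) * pairing g (fun t => sechpi t * v t) gam + (c1 ^+ 2 + c2 ^+ 2) * pairing g v gam.
  move=> sg tv mg; rewrite (eq_pairing _ (E v) (fun=> erefl)).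
  have t1 := testfun_sechpi tv; have t2 := testfun_sechpi t1.
  by rewrite !pairingD ?pairingZ//; (try exact: testfunD); (try apply: testfunD); exact: testfunZ.
split; apply: symbol_injective => // v gam tv mg; rewrite LE//;
  have [h1 h2] := H _ _ tv mg; have [h3 h4] := H _ _ (testfun_sechpi tv) mg.
- exact: symbol_algebra h1 h2 h3.
- rewrite -[c2 ^+ 2]sqrrN; apply: (symbol_algebra _ _ (_ : _ = 2 * _)); [by rewrite mulNr opprK; exact: h2|by rewrite mulNr; exact: h1|by rewrite mulNr opprK; exact: h4].
Qed.
End Symbol.
End Core.

(** * The equations in real form *)
Section RealUniqueness.
Context {R : realType}.
Local Notation mu := (@lebesgue_measure R).
Local Notation Rp := (`]0%R, +oo[%classic : set R).
Implicit Types f g h u v gam : R -> R.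

Lemma mfun_opp g : mfun g -> mfun (fun x => g (- x)).
Proof. by move=> mg; apply: (measurableT_comp mg); exact: measurable_funN. Qed.

(** The map f(x) |-> f(1/x)/x, which is y |-> - y in logarithmic coordinates. *)
Definition invert g (x : R) : R := g (1 / x) / x.

Lemma mfun_invert g : mfun g -> mfun (invert g).
Proof.
move=> mg; apply: measurable_funM; last exact: measurable_inv.
by apply: (measurableT_comp mg); apply: measurable_funM => //; exact: measurable_inv.
Qed.

Lemma to_log_invert g y : to_log (invert g) y = to_log g (- y).
Proof.
rewrite /to_log /invert div1r -expRN mulNr mulrC -mulrA mulrC; congr (_ * _).
by rewrite expRN -{1}(expR_half2 y) expRN; field; rewrite gt_eqF ?expR_gt0.
Qed.

Lemma sq_invert g : mfun g -> sq (fun x => g x * \1_Rp x) -> sq (fun x => invert g x * \1_Rp x).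
Proof.
move=> mg sg; apply/sq_to_log; first exact: mfun_invert.
have [ml il] := (sq_to_log mg).1 sg.
rewrite (_ : to_log _ = (fun y => to_log g (- y))); last by apply/funext => y; exact: to_log_invert.
split; first exact: mfun_opp.
exact: (itg_opp il).
Qed.

Lemma pair_invert g v gam : mfun g -> sq (fun x => g x * \1_Rp x) -> testfun v -> mfun gam ->
  Int (fun x => invert g x * of_log (cosint v gam) x) = pairing g v (fun t => - gam t).
Proof.
move=> mg sg tv mgam; have sH := sq_cosint tv mgam.
rewrite pair_log//; [|exact: sq_invert|exact: mfun_invert].
have su := (sq_to_log mg).1 sg.
have [ml il] := su.
have i1 : itg (fun y => to_log g (- y) * cosint v gam y).
  by apply: sq_mul => //; split; [exact: mfun_opp|exact: (itg_opp il)].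
rewrite (eq_Int (g := fun y => to_log g (- y) * cosint v gam y)); last by move=> y; rewrite to_log_invert.
rewrite -(Int_opp i1); apply: eq_Int => y; rewrite opprK; congr (_ * _).
by apply: eq_Int => t; congr (_ * _); rewrite -cosN; congr cos; ring.
Qed.

Lemma of_log_neg (H : R -> R) x : x <= 0 -> of_log H x = 0.
Proof. by move=> x0; rewrite /of_log Rp_neg// mulr0. Qed.

Lemma itg_pair g H : sq (fun x => g x * \1_Rp x) -> sq H -> itg (fun x => g x * of_log H x).
Proof.
move=> sg sH; apply: eq_itg (sq_mul sg (sq_of_log sH)) => x.
by rewrite /of_log -[in RHS]Rp2; ring.
Qed.

(** The equation is c g = (2 / pi) S g for g = g1 + i g2 and c = c1 + i c2; paired with
    cosine integrals it becomes the hypothesis of pairing_core. *)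
Lemma Stieltjes_unique (c1 c2 : R) g1 g2 : mfun g1 -> mfun g2 ->
  sq (fun x => g1 x * \1_Rp x) -> sq (fun x => g2 x * \1_Rp x) ->
  {ae mu, forall x, 0 < x -> c1 * g1 x - c2 * g2 x = 2 / pi * Stieltjes g1 x /\
     c1 * g2 x + c2 * g1 x = 2 / pi * Stieltjes g2 x} ->
  {ae mu, forall y, to_log g1 y = 0} /\ {ae mu, forall y, to_log g2 y = 0}.
Proof.
move=> m1 m2 s1 s2 H.
apply: (@pairing_core R c1 c2); [exact/sq_to_log|exact/sq_to_log|move=> v gam tv mg].
have sH := sq_cosint tv mg; have [iv sv] := tv.
have P g (p q : R) h : mfun g -> sq (fun x => g x * \1_Rp x) -> mfun h -> sq (fun x => h x * \1_Rp x) ->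
  {ae mu, forall x, 0 < x -> p * g x + q * h x = 2 / pi * Stieltjes g x} ->
  p * pairing g v gam + q * pairing h v gam = 2 * pairing g (fun t => sechpi t * v t) gam.
  move=> mG sG mh sqh hE.
  have [iS IS] := Stieltjes_pair mG sG iv sv mg.
  have -> : 2 * pairing g (fun t => sechpi t * v t) gam = 2 / pi * (pi * pairing g (fun t => sechpi t * v t) gam).
    by rewrite mulrA divfK// gt_eqF// pi_gt0.
  have ig := itg_pair sG sH; have ih := itg_pair sqh sH.
  have Lg : pairing g v gam = Int (fun x => g x * of_log (cosint v gam) x) by rewrite pair_log.
  have Lh : pairing h v gam = Int (fun x => h x * of_log (cosint v gam) x) by rewrite pair_log.
  rewrite Lg Lh -IS -!IntZ// -IntD; [|exact: itgZ|exact: itgZ].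
  apply: ae_eq_Int.
  - by apply: itg_m; apply: itgD; exact: itgZ.
  - by apply: itg_m; exact: itgZ.
  - apply: aeS hE => x hx; have [x0|x0] := ltP 0 x; last by rewrite of_log_neg// !mulr0 addr0.
    by rewrite [RHS]mulrA -hx//; ring.
split.
  rewrite -mulNr; apply: P => //; apply: aeS H => x hx x0; rewrite mulNr; exact: (hx x0).1.
by apply: P => //; apply: aeS H => x hx x0; exact: (hx x0).2.
Qed.

Lemma or_comm (P Q : Prop) : P \/ Q -> Q \/ P.
Proof. by case; [right|left]. Qed.

(** With lam = a + i b and L = L1 + i L2, the hypothesis reads
    lam L(v, -gam) = L((1 + m) v, gam) - s L(n v, gam - pi / 2).  It is used for -gam
    and then, after multiplication by lam, three more times to return to gam.  The two terms with
    n (1 + m) v have phases that differ by a half turn and cancel; the others add up to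
    (1 + m)^2 + s^2 n^2 = 2 + 2 m. *)
Lemma reflection_algebra (a b s : R) (L1 L2 : (R -> R) -> (R -> R) -> R) v gam : s ^+ 2 = 1 ->
  (forall L, L = L1 \/ L = L2 -> forall v w gam, testfun v -> testfun w -> mfun gam -> L (fun t => v t + w t) gam = L v gam + L w gam) ->
  (forall L, L = L1 \/ L = L2 -> forall v gam, testfun v -> mfun gam -> L v (fun t => gam t + pi / 2) = - L v (quarter gam)) ->
  (forall v gam, testfun v -> mfun gam ->
    a * L1 v (fun t => - gam t) - b * L2 v (fun t => - gam t) =
      L1 v gam + L1 (fun t => sechpi t * v t) gam - s * L1 (fun t => tanhpi t * v t) (quarter gam) /\
    a * L2 v (fun t => - gam t) + b * L1 v (fun t => - gam t) =
      L2 v gam + L2 (fun t => sechpi t * v t) gam - s * L2 (fun t => tanhpi t * v t) (quarter gam)) ->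
  testfun v -> mfun gam ->
  (a ^+ 2 - b ^+ 2 - 2) * L1 v gam - (2 * a * b) * L2 v gam = 2 * L1 (fun t => sechpi t * v t) gam.
Proof.
move=> s2 LD LQ E tv mg.
have mN : mfun (fun t => - gam t) by exact: measurable_funN.
have mQ : mfun (fun t => gam t + pi / 2) by exact: measurable_funD.
(* B, C and D turn the three terms on the right of A back to the phase gam;
   the phase in D is chosen so that its reflection is the one in A. *)
have [A1 A2] := E v (fun t => - gam t) tv mN.
have [B1 B2] := E v gam tv mg.
have [C1 C2] := E _ gam (testfun_sechpi tv) mg.
have [D1 D2] := E _ (fun t => gam t + pi / 2) (testfun_tanhpi tv) mQ.
have EN : (fun t => - - gam t) = gam by apply/funext => t; rewrite opprK.
have EQ : (fun t => - (gam t + pi / 2)) = quarter (fun t => - gam t).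
  by apply/funext => t; rewrite /quarter opprD.
have EQ2 : quarter (fun t => gam t + pi / 2) = gam by apply/funext => t; rewrite /quarter addrK.
have EC : (fun t => tanhpi t * (sechpi t * v t)) = (fun t => sechpi t * (tanhpi t * v t)).
  by apply/funext => t; rewrite mulrCA.
rewrite EN in A1 A2; rewrite EQ EQ2 in D1 D2; rewrite EC in C1 C2.
have tn := testfun_tanhpi tv; have tm := testfun_sechpi tv.
have ES L : L = L1 \/ L = L2 -> L (fun t => sechpi t * (sechpi t * v t)) gam + L (fun t => tanhpi t * (tanhpi t * v t)) gam = L v gam.
  move=> h; rewrite -LD//; [|exact: testfun_sechpi|exact: testfun_tanhpi].
  congr (L _ _); apply/funext => t; rewrite -[RHS]mul1r -(sechpi2_tanhpi2 t); ring.
have F1 := ES L1 (or_introl erefl).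
rewrite (LQ L1 (or_introl erefl))// (LQ L1 (or_introl erefl)) in D1; [|exact: testfun_sechpi|by []].
have -> : (a ^+ 2 - b ^+ 2 - 2) * L1 v gam - 2 * a * b * L2 v gam =
    a * (a * L1 v gam - b * L2 v gam) - b * (a * L2 v gam + b * L1 v gam) - 2 * L1 v gam by ring.
rewrite A1 A2.
have -> : a * (L1 v (fun t => - gam t) + L1 (fun t => sechpi t * v t) (fun t => - gam t) - s * L1 (fun t => tanhpi t * v t) (quarter (fun t => - gam t))) -
    b * (L2 v (fun t => - gam t) + L2 (fun t => sechpi t * v t) (fun t => - gam t) - s * L2 (fun t => tanhpi t * v t) (quarter (fun t => - gam t))) =
    (a * L1 v (fun t => - gam t) - b * L2 v (fun t => - gam t)) +
    (a * L1 (fun t => sechpi t * v t) (fun t => - gam t) - b * L2 (fun t => sechpi t * v t) (fun t => - gam t)) -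
    s * (a * L1 (fun t => tanhpi t * v t) (quarter (fun t => - gam t)) - b * L2 (fun t => tanhpi t * v t) (quarter (fun t => - gam t))) by ring.
rewrite B1 C1 D1; apply/eqP; rewrite -subr_eq0; apply/eqP.
set N2 := L1 (fun t => tanhpi t * (tanhpi t * v t)) gam in F1 *.
rewrite (_ : _ - _ = (L1 (fun t => sechpi t * (sechpi t * v t)) gam + N2 - L1 v gam) + (s ^+ 2 - 1) * N2); last by ring.
by rewrite F1 s2 !subrr mul0r addr0.
Qed.

(** The principal value equation for g1 + i g2 and lam = a + i b, solved for the limit of
    the regularized Hilbert transforms.  Paired with cosine integrals it becomes the
    hypothesis of reflection_algebra, first for (g1, g2) and then, with b replaced by - b,
    for (g2, g1). *)
Lemma Hilbert_unique (a b s : R) g1 g2 (en : nat -> R) : s ^+ 2 = 1 -> mfun g1 -> mfun g2 ->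
  sq (fun x => g1 x * \1_Rp x) -> sq (fun x => g2 x * \1_Rp x) ->
  (forall n, 0 < en n) -> en n @[n --> \oo] --> (0 : R) ->
  {ae mu, forall x, 0 < x ->
     Hilbert_reg (en n) (fun t => g1 t * \1_Rp t) x @[n --> \oo] --> s * (pi * (a * invert g1 x - b * invert g2 x - g1 x) - Stieltjes g1 x) /\
     Hilbert_reg (en n) (fun t => g2 t * \1_Rp t) x @[n --> \oo] --> s * (pi * (a * invert g2 x + b * invert g1 x - g2 x) - Stieltjes g2 x)} ->
  {ae mu, forall y, to_log g1 y = 0} /\ {ae mu, forall y, to_log g2 y = 0}.
Proof.
move=> s2 m1 m2 q1 q2 en0 cen H.
have ss : s * s = 1 by rewrite -expr2.
have P g h (p q : R) v gam : mfun g -> mfun h -> sq (fun x => g x * \1_Rp x) -> sq (fun x => h x * \1_Rp x) ->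
  testfun v -> mfun gam ->
  {ae mu, forall x, 0 < x -> Hilbert_reg (en n) (fun t => g t * \1_Rp t) x @[n --> \oo] --> s * (pi * (p * invert g x + q * invert h x - g x) - Stieltjes g x)} ->
  p * pairing g v (fun t => - gam t) + q * pairing h v (fun t => - gam t) =
    pairing g v gam + pairing g (fun t => sechpi t * v t) gam - s * pairing g (fun t => tanhpi t * v t) (quarter gam).
  move=> mg mh sg sqh tv mgam hE; have sH := sq_cosint tv mgam; have [iv sv] := tv.
  have mi := mfun_invert mg; have mi' := mfun_invert mh.
  have si := sq_invert mg sg; have si' := sq_invert mh sqh.
  have mS := mfun_Stieltjes mg.
  pose ginf x := s * (pi * (p * invert g x + q * invert h x - g x) - Stieltjes g x).
  have mginf : mfun ginf.
    apply: measurable_funM => //; apply: measurable_funB => //; apply: measurable_funM => //.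
    by apply: measurable_funB => //; apply: measurable_funD; exact: measurable_funM.
  have [iG IG] := Hilbert_pair mg sg mginf iv sv mgam en0 cen hE.
  have [iS IS] := Stieltjes_pair mg sg iv sv mgam.
  have i1 := itg_pair si sH; have i2 := itg_pair si' sH; have i3 := itg_pair sg sH.
  have E : Int (fun x => s * (ginf x * of_log (cosint v gam) x) + Stieltjes g x * of_log (cosint v gam) x) =
     Int (fun x => pi * (p * (invert g x * of_log (cosint v gam) x) + q * (invert h x * of_log (cosint v gam) x) - g x * of_log (cosint v gam) x)).
    apply: eq_Int => x; rewrite /ginf [s * _]mulrA [s * (s * _)]mulrA ss; ring.
  move: E; rewrite IntD//; last exact: itgZ.
  rewrite IntZ// IG IS IntZ; last first.
    by apply: itgB => //; apply: itgD; exact: itgZ.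
  rewrite IntB//; last by apply: itgD; exact: itgZ.
  rewrite IntD; [|exact: itgZ|exact: itgZ].
  rewrite !IntZ// !pair_invert// (pair_log sg mg sH) -/(pairing g v gam) => E.
  apply: (mulfI (lt0r_neq0 (pi_gt0 R))); move: E.
  move: (pi : R) (pairing g v _) (pairing h v _) (pairing g v gam) (pairing g _ gam) (pairing g _ (quarter gam)) => c A B L M N E.
  have -> : c * (p * A + q * B) = c * (p * A + q * B - L) + c * L by ring.
  by rewrite -E; ring.
apply: (@pairing_core R (a ^+ 2 - b ^+ 2 - 2) (2 * a * b)); [exact/sq_to_log|exact/sq_to_log|move=> v gam tv mg].
have u1 := (sq_to_log m1).1 q1; have u2 := (sq_to_log m2).1 q2.
have E1 v' gam' : testfun v' -> mfun gam' -> a * pairing g1 v' (fun t => - gam' t) - b * pairing g2 v' (fun t => - gam' t) =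
    pairing g1 v' gam' + pairing g1 (fun t => sechpi t * v' t) gam' - s * pairing g1 (fun t => tanhpi t * v' t) (quarter gam').
  move=> tv' mg'; rewrite -mulNr; apply: P => //; apply: aeS H => x hx x0; rewrite mulNr; exact: (hx x0).1.
have E2 v' gam' : testfun v' -> mfun gam' -> a * pairing g2 v' (fun t => - gam' t) + b * pairing g1 v' (fun t => - gam' t) =
    pairing g2 v' gam' + pairing g2 (fun t => sechpi t * v' t) gam' - s * pairing g2 (fun t => tanhpi t * v' t) (quarter gam').
  move=> tv' mg'; apply: P => //; apply: aeS H => x hx x0; exact: (hx x0).2.
have LD (L : (R -> R) -> (R -> R) -> R) : L = pairing g1 \/ L = pairing g2 -> forall v w gam,
    testfun v -> testfun w -> mfun gam -> L (fun t => v t + w t) gam = L v gam + L w gam.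
  by move=> [->|->] *; exact: pairingD.
have LQ (L : (R -> R) -> (R -> R) -> R) : L = pairing g1 \/ L = pairing g2 -> forall v gam,
    testfun v -> mfun gam -> L v (fun t => gam t + pi / 2) = - L v (quarter gam).
  by move=> [->|->] *; exact: pairing_halfturn.
split.
- exact: (@reflection_algebra a b s (pairing g1) (pairing g2) v gam s2 LD LQ (fun v' g' tv' mg' => conj (E1 v' g' tv' mg') (E2 v' g' tv' mg')) tv mg).
- have E3 v' gam' : testfun v' -> mfun gam' ->
    a * pairing g2 v' (fun t => - gam' t) - (- b) * pairing g1 v' (fun t => - gam' t) =
      pairing g2 v' gam' + pairing g2 (fun t => sechpi t * v' t) gam' - s * pairing g2 (fun t => tanhpi t * v' t) (quarter gam') /\
    a * pairing g1 v' (fun t => - gam' t) + (- b) * pairing g2 v' (fun t => - gam' t) =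
      pairing g1 v' gam' + pairing g1 (fun t => sechpi t * v' t) gam' - s * pairing g1 (fun t => tanhpi t * v' t) (quarter gam').
    by move=> tv' mg'; rewrite !mulNr opprK; split; [exact: E2|exact: E1].
  have h := @reflection_algebra a (- b) s (pairing g2) (pairing g1) v gam s2 (fun L o => @LD L (or_comm o)) (fun L o => @LQ L (or_comm o)) E3 tv mg.
  by rewrite -h sqrrN mulrN mulNr opprK.
Qed.
End RealUniqueness.

(** * Injectivity of the Mellin transform *)
Local Open Scope complex_scope.
Section MellinInjective.
Context {R : realType}.
Local Notation mu := (@lebesgue_measure R).
Local Notation Rp := (`]0%R, +oo[%classic : set R).
Implicit Types f g h u v gam p : R -> R.

(** The real part of Int_(-n)^n (p1 + i p2)(tau) e^(- i tau y) d tau; exchanging (p1, p2)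
    for (p2, - p1) gives the imaginary part. *)
Definition mellin_window (n : nat) p1 p2 (y : R) : R :=
  Int (fun tau => trunc n p1 tau * cos (tau * y) + trunc n p2 tau * sin (tau * y)).

Lemma testfun_trunc n p : sq p -> testfun (trunc n p).
Proof. by move=> sp; split; [exact: itg_trunc|exact: sq_trunc]. Qed.

Lemma itg_mellin_window n p1 p2 (y : R) : sq p1 -> sq p2 ->
  itg (fun tau => trunc n p1 tau * cos (tau * y) + trunc n p2 tau * sin (tau * y)).
Proof.
move=> s1 s2; have mty : mfun (fun t : R => t * y) by exact: measurable_funM.
have i1 := itg_bM (itg_trunc n s1) (mfun_cos mty) (fun t => cos_max _).
have i2 := itg_bM (itg_trunc n s2) (mfun_sin mty) (fun t => sin_max _).
by apply: eq_itg (itgD i1 i2) => t; rewrite ![_ * trunc _ _ _]mulrC.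
Qed.

Lemma mellin_windowE n p1 p2 y : sq p1 -> sq p2 ->
  mellin_window n p1 p2 y = cosint (trunc n p1) (fun=> 0) y + cosint (trunc n p2) (fun=> - (pi / 2)) y.
Proof.
move=> s1 s2; rewrite /cosint -IntD.
- by apply: eq_Int => t; rewrite addr0 cosBpihalf.
- exact: (itg_cos_v y (itg_trunc n s1) (measurable_cst _)).
- exact: (itg_cos_v y (itg_trunc n s2) (measurable_cst _)).
Qed.

Lemma sq_mellin_window n p1 p2 : sq p1 -> sq p2 -> sq (mellin_window n p1 p2).
Proof.
move=> s1 s2; rewrite (_ : mellin_window n p1 p2 = fun y => cosint (trunc n p1) (fun=> 0) y + cosint (trunc n p2) (fun=> - (pi / 2)) y).
  by apply: sqD; apply: sq_cosint; [exact: testfun_trunc|exact: measurable_cst|exact: testfun_trunc|exact: measurable_cst].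
by apply/funext => y; exact: mellin_windowE.
Qed.

(** The product of a cosine integral, shifted in frequency by t0, with e^(-e|y|)
    integrates to a Poisson integral of v at t0. *)
Lemma laplace_shift (e t0 c : R) v : 0 < e -> itg v ->
  Int (fun y => expR (- (e * `|y|)) * Int (fun t => v t * cos ((t - t0) * y + c))) =
  2 * cos c * Int (fun t => v t * poisson e (t - t0)).
Proof.
move=> e0 iv; have mv := itg_m iv; have iL := itg_laplace e0.
pose K (y t : R) := expR (- (e * `|y|)) * (v t * cos ((t - t0) * y + c)).
have mc : mfun2 (fun y t : R => cos ((t - t0) * y + c)).
  apply: mfun_cos; apply: measurable_funD => //; apply: measurable_funM; last exact: measurable_fst.
  by apply: measurable_funB => //; exact: measurable_snd.
have ic y : itg (fun t => v t * cos ((t - t0) * y + c)).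
  apply: itg_le (itg_norm iv) _; first by apply: measurable_funM => //; exact: (mfun2_row y mc).
  by move=> t; rewrite normrM ler_piMr// cos_max.
have i2 : itg2 K.
  apply: (itg2_bound (G := fun y => Int (fun t => `|v t|) * expR (- (e * `|y|)))).
  - apply: measurable_funM; first exact: (mfun2_fst (itg_m iL)).
    by apply: measurable_funM => //; exact: mfun2_snd.
  - by move=> y; exact: itgZ.
  - exact: itgZ.
  - move=> y; rewrite [leRHS]mulrC -IntZ; last exact: itg_norm.
    apply: Int_le; [by apply: itg_norm; exact: itgZ|by apply: itgZ; exact: itg_norm|].
    by move=> t; rewrite normrM (ger0_norm (expR_ge0 _)) ler_wpM2l ?expR_ge0// normrM ler_piMr// cos_max.
transitivity (Int (fun y => Int (K y))); first by apply: eq_Int => y; rewrite IntZ.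
rewrite (Fubini_Int i2) -IntZ; last first.
  apply: itg_le (itgZ e^-1 (itg_norm iv)) _.
    by apply: measurable_funM => //; exact: (mfun2_col t0 (mfun2_poisson e)).
  by move=> t; rewrite normrM (ger0_norm (poisson_ge0 _ e0)) mulrC ler_wpM2r// poisson_le.
apply: eq_Int => t; have [i1 h] := laplace_cosT (t - t0) c e0.
transitivity (v t * Int (fun y => expR (- (e * `|y|)) * cos ((t - t0) * y + c))).
  by rewrite -IntZ//; apply: eq_Int => y; rewrite /K; ring.
by rewrite h /poisson; ring.
Qed.

(** The real and imaginary parts of the truncated transforms, tested against
    cos (t0 y) e^(-e|y|) and sin (t0 y) e^(-e|y|), reproduce the Poisson integrals of p1
    at t0.  If the transforms tend to 0 in L2, these vanish and poisson_unique
    applies. *)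
Lemma mellin_injective p1 p2 : sq p1 -> sq p2 ->
  Int (fun y => mellin_window n p1 p2 y ^+ 2) @[n --> \oo] --> (0 : R) ->
  Int (fun y => mellin_window n p2 (fun t => - p1 t) y ^+ 2) @[n --> \oo] --> (0 : R) ->
  {ae mu, forall t, p1 t = 0}.
Proof.
move=> s1 s2 c1 c2; apply: poisson_unique => // e t0 e0.
have s1N := sqN s1.
pose L (y : R) : R := expR (- (e * `|y|)); have sL : sq L := (testfun_expabs e0).2.
have sLb (b : R -> R) : mfun b -> (forall x, `|b x| <= 1) -> sq (fun y => b y * L y) by move=> mb b1; exact: sq_bM.
pose A n := mellin_window n p1 p2; pose B n := mellin_window n p2 (fun t => - p1 t).
have sA n : sq (A n) by exact: sq_mellin_window.
have sB n : sq (B n) by exact: sq_mellin_window.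
have mt0 : mfun (fun y : R => t0 * y) by exact: measurable_funM.
have scos := sLb (fun y => cos (t0 * y)) (mfun_cos mt0) (fun x => cos_max _).
have ssin := sLb (fun y => sin (t0 * y)) (mfun_sin mt0) (fun x => sin_max _).
have key n : Int (fun y => A n y * (cos (t0 * y) * L y)) - Int (fun y => B n y * (sin (t0 * y) * L y)) =
   2 * Int (fun t => trunc n p1 t * poisson e (t - t0)).
  have i1 := itg_trunc n s1; have i2 := itg_trunc n s2.
  have -> : 2 * Int (fun t => trunc n p1 t * poisson e (t - t0)) =
    Int (fun y => L y * Int (fun t => trunc n p1 t * cos ((t - t0) * y + 0))) +
    Int (fun y => L y * Int (fun t => trunc n p2 t * cos ((t - t0) * y + - (pi / 2)))).
    by rewrite !laplace_shift// cos0 cosN cos_pihalf; ring.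
  have HE v (c y : R) : Int (fun t => v t * cos ((t - t0) * y + c)) = cosint v (fun=> c - t0 * y) y.
    by apply: eq_Int => t; congr (_ * cos _); ring.
  have iLH v (c : R) : testfun v -> itg (fun y => L y * Int (fun t => v t * cos ((t - t0) * y + c))).
    move=> tv; have [iv sv] := tv.
    have E y : cos (t0 * y - c) * cosint v (fun=> 0) y - sin (t0 * y - c) * cosint v (fun=> pi / 2) y =
       Int (fun t => v t * cos ((t - t0) * y + c)).
      rewrite /cosint -!IntZ; [|exact: (itg_cos_v y iv (measurable_cst _))|exact: (itg_cos_v y iv (measurable_cst _))].
      rewrite -IntB; [|by apply: itgZ; exact: (itg_cos_v y iv (measurable_cst _))|by apply: itgZ; exact: (itg_cos_v y iv (measurable_cst _))].
      apply: eq_Int => t; rewrite addr0 cosD_pihalf.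
      rewrite (_ : (t - t0) * y + c = t * y - (t0 * y - c)); last by ring.
      by rewrite [in RHS]cosB; ring.
    have m1 : mfun (fun y : R => t0 * y - c) by apply: measurable_funB => //; exact: measurable_funM.
    apply: (eq_itg (fun y => congr1 (fun z => L y * z) (E y))); apply: sq_mul => //.
    have tH (a : R) : sq (cosint v (fun=> a)) by apply: sq_cosint => //; exact: measurable_cst.
    have s3 := sq_bM (mfun_cos m1) (fun x => cos_max _) (tH 0).
    have s4 := sq_bM (mfun_sin m1) (fun x => sin_max _) (tH (pi / 2)).
    exact: sqB s3 s4.
  have t1 := testfun_trunc n s1; have t2 := testfun_trunc n s2.
  rewrite -IntD; [|exact: iLH|exact: iLH].
  rewrite -IntB; [|exact: sq_mul|exact: sq_mul].
  have icv v (b : R -> R) : itg v -> mfun b -> (forall x, `|b x| <= 1) -> itg (fun t => v t * b t).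
    by move=> iv mb b1; apply: (eq_itg (fun t => mulrC (b t) (v t))); exact: itg_bM.
  apply: eq_Int => y.
  have mty : mfun (fun t : R => t * y) by exact: measurable_funM.
  have mtc (c : R) : mfun (fun t : R => cos ((t - t0) * y + c)).
    by apply: mfun_cos; apply: measurable_funD => //; apply: measurable_funM => //; exact: measurable_funB.
  have j1 v : itg v -> itg (fun t => v t * cos (t * y)).
    by move=> iv; apply: icv => // [|x]; [exact: mfun_cos|exact: cos_max].
  have j2 v : itg v -> itg (fun t => v t * sin (t * y)).
    by move=> iv; apply: icv => // [|x]; [exact: mfun_sin|exact: sin_max].
  have i1N := itg_trunc n s1N.
  transitivity (L y * (cos (t0 * y) * A n y - sin (t0 * y) * B n y)); first by ring.
  rewrite -mulrDr; congr (_ * _).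
  rewrite /A /B /mellin_window -!IntZ; [|by apply: itgD; [exact: j1|exact: j2]|by apply: itgD; [exact: j1|exact: j2]].
  rewrite -IntB; [|by apply: itgZ; apply: itgD; [exact: j1|exact: j2]|by apply: itgZ; apply: itgD; [exact: j1|exact: j2]].
  rewrite -IntD; [|by apply: icv => // x; exact: cos_max|by apply: icv => // x; exact: cos_max].
  apply: eq_Int => t; rewrite cosBpihalf addr0 mulrBl cosB sinB /trunc; ring.
(* Norm convergence to 0 implies weak convergence to 0. *)
have lim0 (C : nat -> R -> R) h : (forall n, sq (C n)) -> sq h -> Int (fun y => C n y ^+ 2) @[n --> \oo] --> (0 : R) ->
   Int (fun y => C n y * h y) @[n --> \oo] --> (0 : R).
  move=> sC sqh cC; apply/cvgrPdist_le => d d0.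
  pose I := Int (fun y => h y ^+ 2); have I0 : 0 <= I by apply: Int_ge0 => y; exact: sqr_ge0.
  pose a := 2 * (I + 1) / d; have a0 : 0 < a by rewrite divr_gt0// mulr_gt0// ltr_wpDl.
  move/cvgrPdist_le : cC => /(_ (d / 2 / a)); have da : 0 < d / 2 / a by apply: divr_gt0 => //; exact: divr_gt0.
  move=> /(_ da); apply: filterS => n; rewrite !sub0r !normrN => hn.
  apply: le_trans (Int_young_ineq a0 (sC n) sqh) _.
  have h1 : a * Int (fun y => C n y ^+ 2) <= d / 2.
    by rewrite mulrC -ler_pdivlMr// (le_trans (ler_norm _)).
  have h2 : a^-1 * I <= d / 2.
    by rewrite mulrC ler_pdivrMr// /a (_ : d / 2 * _ = I + 1) ?lerDl//; field; rewrite gt_eqF.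
  by have := lerD h1 h2; rewrite -splitr.
have z1 := lim0 A _ sA scos c1; have z2 := lim0 B _ sB ssin c2.
have lim : 2 * Int (fun t => trunc n p1 t * poisson e (t - t0)) @[n --> \oo] --> 2 * Int (fun t => p1 t * poisson e (t - t0)).
  have sp := sq_poisson t0 e0.
  have iG : itg (fun t => `|p1 t * poisson e (t - t0)|) by apply: itg_norm; exact: sq_mul.
  apply: cvgMr; apply: (dct _ _ iG).
  - by move=> n; apply: measurable_funM; [exact: (sq_trunc n s1).1|exact: sp.1].
  - by apply: measurable_funM; [exact: s1.1|exact: sp.1].
  - by move=> n t; rewrite [leLHS]normrM [leRHS]normrM ler_wpM2r// trunc_le.
  - by apply: (aeW mu) => t; apply: cvgMl; exact: cvg_trunc.
have lim' : 2 * Int (fun t => trunc n p1 t * poisson e (t - t0)) @[n --> \oo] --> (0 : R).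
  by rewrite -[X in _ --> X](subr0 (0 : R)); under eq_cvg do rewrite -key; exact: cvgB.
have z : 2 * Int (fun t => p1 t * poisson e (t - t0)) = 0 by exact: cvg_unique lim lim'.
by move: z => /eqP; rewrite mulf_eq0 pnatr_eq0/= => /eqP.
Qed.
End MellinInjective.

(** * Complex functions by components *)
Section ComplexParts.
Context {R : realType}.
Local Notation mu := (@lebesgue_measure R).
Local Notation Rp := (`]0%R, +oo[%classic : set R).
Implicit Types (z w : R[i]) (F : R -> R[i]) (D : set R).

Lemma normc2 z : ComplexField.Normc.normc z ^+ 2 = complex.Re z ^+ 2 + complex.Im z ^+ 2.
Proof. by case: z => a b /=; rewrite sqr_sqrtr// addr_ge0 ?sqr_ge0. Qed.

Lemma Re_le_normc z : `|complex.Re z| <= ComplexField.Normc.normc z.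
Proof.
have n0 : 0 <= ComplexField.Normc.normc z by case: z => a b; exact: sqrtr_ge0.
by rewrite -(ler_pXn2r (n := 2))// ?nnegrE// normc2 real_normK ?num_real// lerDl sqr_ge0.
Qed.

Lemma Im_le_normc z : `|complex.Im z| <= ComplexField.Normc.normc z.
Proof.
have n0 : 0 <= ComplexField.Normc.normc z by case: z => a b; exact: sqrtr_ge0.
by rewrite -(ler_pXn2r (n := 2))// ?nnegrE// normc2 real_normK ?num_real// lerDr sqr_ge0.
Qed.

Lemma Re_add z w : complex.Re (z + w) = complex.Re z + complex.Re w. Proof. by case: z w => a b [c d]. Qed.
Lemma Im_add z w : complex.Im (z + w) = complex.Im z + complex.Im w. Proof. by case: z w => a b [c d]. Qed.
Lemma Re_sub z w : complex.Re (z - w) = complex.Re z - complex.Re w. Proof. by case: z w => a b [c d]. Qed.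
Lemma Im_sub z w : complex.Im (z - w) = complex.Im z - complex.Im w. Proof. by case: z w => a b [c d]. Qed.
Lemma Re_mul z w : complex.Re (z * w) = complex.Re z * complex.Re w - complex.Im z * complex.Im w.
Proof. by case: z w => a b [c d]. Qed.
Lemma Im_mul z w : complex.Im (z * w) = complex.Re z * complex.Im w + complex.Im z * complex.Re w.
Proof. by case: z w => a b [c d]. Qed.

Lemma real_complexV (x : R) : (x%:C)^-1 = (x^-1)%:C.
Proof. by rewrite fmorphV. Qed.

Lemma complex_eqP z w : complex.Re z = complex.Re w -> complex.Im z = complex.Im w -> z = w.
Proof. by case: z w => a b [c d] /= -> ->. Qed.

Lemma Re_real (x : R) : complex.Re x%:C = x. Proof. by []. Qed.
Lemma Im_real (x : R) : complex.Im x%:C = 0. Proof. by []. Qed.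

(** Components cut off to D, for the passage to integrals over the whole line. *)
Definition ReD D F (x : R) : R := complex.Re (F x) * \1_D x.
Definition ImD D F (x : R) : R := complex.Im (F x) * \1_D x.

Lemma indic2 D (x : R) : \1_D x * \1_D x = \1_D x :> R.
Proof. by rewrite indicE; case: (_ \in _); rewrite ?mulr1 ?mulr0. Qed.

Lemma mfun_onE D (f : R -> R) : measurable D -> measurable_fun D f <-> mfun (fun x => f x * \1_D x).
Proof. by move=> mD; rewrite measurable_restrictT// patch_indic. Qed.

Lemma L2_parts D F : measurable D -> L2 D F -> [/\ sq (ReD D F), sq (ImD D F) &
  sqnorm D F = (Int (fun x => ReD D F x ^+ 2) + Int (fun x => ImD D F x ^+ 2))%:E].
Proof.
move=> mD [/(mfun_onE _ mD) mR /(mfun_onE _ mD) mI fin].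
have E : sqnorm D F = (\int[mu]_x (ReD D F x ^+ 2 + ImD D F x ^+ 2)%:E)%E.
  rewrite /sqnorm integral_mkcond; apply: eq_integral => x _.
  rewrite /patch /ReD /ImD normc2 !exprMn -mulrDl indicE; case: ifP => _; by rewrite /= ?expr1n ?expr0n ?mulr1 ?mulr0.
have m2R : mfun (fun x => ReD D F x ^+ 2) by exact: measurable_funX.
have m2I : mfun (fun x => ImD D F x ^+ 2) by exact: measurable_funX.
have i2 : itg (fun x => ReD D F x ^+ 2 + ImD D F x ^+ 2).
  apply: itg_ge0P; [exact: measurable_funD|by move=> x; rewrite addr_ge0 ?sqr_ge0|by rewrite -E].
have iR : itg (fun x => ReD D F x ^+ 2).
  by apply: itg_le i2 _ => // x; rewrite ger0_norm ?sqr_ge0// lerDl sqr_ge0.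
have iI : itg (fun x => ImD D F x ^+ 2).
  by apply: itg_le i2 _ => // x; rewrite ger0_norm ?sqr_ge0// lerDr sqr_ge0.
by split => //; rewrite E -IntD// IntE.
Qed.

Lemma L2_of_parts D F : measurable D -> sq (ReD D F) -> sq (ImD D F) -> L2 D F.
Proof.
move=> mD [mR iR] [mI iI]; split; [exact/mfun_onE|exact/mfun_onE|].
rewrite (_ : sqnorm D F = (\int[mu]_x (ReD D F x ^+ 2 + ImD D F x ^+ 2)%:E)%E).
  by apply: itg_lty; exact: itgD.
rewrite /sqnorm integral_mkcond; apply: eq_integral => x _.
by rewrite /patch /ReD /ImD normc2 !exprMn -mulrDl indicE; case: ifP => _; rewrite /= ?expr1n ?expr0n ?mulr1 ?mulr0.
Qed.

Lemma cintegral_parts D F :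
  complex.Re (cintegral D F) = Int (ReD D F) /\ complex.Im (cintegral D F) = Int (ImD D F).
Proof. by rewrite /cintegral /= !Rintegral_Int. Qed.

Lemma cintegrable_parts D F : measurable D -> cintegrable D F <-> itg (ReD D F) /\ itg (ImD D F).
Proof. by move=> mD; rewrite /cintegrable !itg_indic_on. Qed.

Lemma measurable_Rpos : measurable (Rpos : set R).
Proof. exact: measurable_itv. Qed.

Lemma ReD_Rp F x : ReD Rpos F x * \1_Rp x = ReD Rpos F x.
Proof. by rewrite /ReD -mulrA indic2. Qed.
Lemma ImD_Rp F x : ImD Rpos F x * \1_Rp x = ImD Rpos F x.
Proof. by rewrite /ImD -mulrA indic2. Qed.

Lemma ReD_pos F x : 0 < x -> ReD Rpos F x = complex.Re (F x).
Proof. by move=> x0; rewrite /ReD Rp_pos// mulr1. Qed.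
Lemma ImD_pos F x : 0 < x -> ImD Rpos F x = complex.Im (F x).
Proof. by move=> x0; rewrite /ImD Rp_pos// mulr1. Qed.

Lemma ReD_neg F x : x <= 0 -> ReD Rpos F x = 0.
Proof. by move=> x0; rewrite /ReD Rp_neg// mulr0. Qed.
Lemma ImD_neg F x : x <= 0 -> ImD Rpos F x = 0.
Proof. by move=> x0; rewrite /ImD Rp_neg// mulr0. Qed.

Lemma to_log_zero (g : R -> R) : mfun g -> sq (fun x => g x * \1_Rp x) -> {ae mu, forall y, to_log g y = 0} ->
  Int (fun x => (g x * \1_Rp x) ^+ 2) = 0.
Proof.
move=> mg sg h; have su := (sq_to_log mg).1 sg.
have mg2 : mfun (fun x => g x ^+ 2) by exact: measurable_funX.
have E x : (g x * \1_Rp x) ^+ 2 = g x ^+ 2 * \1_Rp x by rewrite exprMn [X in _ * X]expr2 Rp2.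
rewrite (eq_Int E) Int_log//; last exact: eq_itg sg.2.
rewrite (eq_Int (g := fun y => to_log g y ^+ 2)); last first.
  by move=> y; rewrite [RHS]exprMn [X in _ = X * _]expr2 expR_half2 mulrC.
rewrite -[RHS]Int0; apply: ae_eq_Int; [exact: (itg_m su.2)|exact: measurable_cst|].
by apply: aeS h => y ->; rewrite expr0n.
Qed.

Lemma sqnorm_of_to_log (m : R -> R[i]) : L2 Rpos m -> {ae mu, forall y, to_log (ReD Rpos m) y = 0} ->
  {ae mu, forall y, to_log (ImD Rpos m) y = 0} -> sqnorm Rpos m = 0%E.
Proof.
move=> Lm zR zI; have [sR sI ->] := L2_parts measurable_Rpos Lm.
have E1 : Int (fun x => ReD Rpos m x ^+ 2) = 0.
  by rewrite -[RHS](to_log_zero sR.1 (sq_Rp sR) zR); apply: eq_Int => x; rewrite ReD_Rp.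
have E2 : Int (fun x => ImD Rpos m x ^+ 2) = 0.
  by rewrite -[RHS](to_log_zero sI.1 (sq_Rp sI) zI); apply: eq_Int => x; rewrite ImD_Rp.
by rewrite E1 E2 addr0.
Qed.

(** The value at 1 / x is included because the equations contain it: inversion preserves
    null functions. *)
Lemma sqnorm_eq0_ae F : L2 Rpos F -> sqnorm Rpos F = 0%E ->
  {ae mu, forall x, 0 < x -> F x = 0 /\ F (1 / x) = 0}.
Proof.
move=> LF; have [sR sI ->] := L2_parts measurable_Rpos LF.
move=> E0; have {E0} h : Int (fun x => ReD Rpos F x ^+ 2) + Int (fun x => ImD Rpos F x ^+ 2) = 0 by exact: EFin_inj E0.
have P (g : R -> R) : sq g -> Int (fun x => g x ^+ 2) = 0 -> {ae mu, forall x, g x = 0}.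
  move=> sg Ig; apply: aeS (Int0_ae_eq0 sg.2 (fun x => sqr_ge0 _) Ig) => x /eqP.
  by rewrite sqrf_eq0 => /eqP.
have R0 : 0 <= Int (fun x => ReD Rpos F x ^+ 2) by apply: Int_ge0 => x; exact: sqr_ge0.
have I0 : 0 <= Int (fun x => ImD Rpos F x ^+ 2) by apply: Int_ge0 => x; exact: sqr_ge0.
have zR := P _ sR (_ : Int (fun x => ReD Rpos F x ^+ 2) = 0).
have zI := P _ sI (_ : Int (fun x => ImD Rpos F x ^+ 2) = 0).
have {}zR := zR (ltac:(lra)); have {}zI := zI (ltac:(lra)).
(* Inversion is the reflection in logarithmic coordinates, where it preserves
   integrals of squares. *)
have Q (g : R -> R) : sq g -> (forall x, g x * \1_Rp x = g x) -> {ae mu, forall x, g x = 0} -> {ae mu, forall x, 0 < x -> g (1 / x) = 0}.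
  move=> sg gE zg; have mg := sg.1.
  have sg' : sq (fun x => g x * \1_Rp x) by exact: sq_Rp.
  have si := sq_invert mg sg'.
  have su := (sq_to_log mg).1 sg'.
  have zl1 : {ae mu, forall y, to_log g y = 0}.
    by apply: aeS (ae_expR ltr01 (aeS (fun x gx _ => gx) zg)) => y; rewrite mul1r /to_log => ->; rewrite mulr0.
  have Iu : Int (fun y => to_log g (- y) ^+ 2) = 0.
    rewrite (Int_opp su.2) -[RHS]Int0; apply: ae_eq_Int; [exact: (itg_m su.2)|exact: measurable_cst|].
    by apply: aeS zl1 => y ->; rewrite expr0n.
  have zl : {ae mu, forall y, to_log (invert g) y = 0}.
    apply: aeS (Int0_ae_eq0 (itg_opp su.2) (fun x => sqr_ge0 _) Iu) => y /eqP.
    by rewrite sqrf_eq0 to_log_invert => /eqP.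
  have := Int0_ae_eq0 si.2 (fun x => sqr_ge0 _) (to_log_zero (mfun_invert mg) si zl).
  apply: aeS => x /eqP; rewrite sqrf_eq0 => h0 x0; move: h0.
  by rewrite /invert Rp_pos// mulr1 mulf_eq0 invr_eq0 (gt_eqF x0) orbF => /eqP.
have qR := Q _ sR (ReD_Rp F) zR; have qI := Q _ sI (ImD_Rp F) zI.
apply: aeS (aeI (aeI zR zI) (aeI qR qI)) => x [[a b] [c d]] x0.
have x1 : 0 < 1 / x by rewrite div1r invr_gt0.
have {}c := c x0; have {}d := d x0.
rewrite ReD_pos// in a; rewrite ImD_pos// in b; rewrite ReD_pos// in c; rewrite ImD_pos// in d.
by split; apply: complex_eqP.
Qed.

End ComplexParts.

(** * The principal value equations *)
Section PVtoHilbert.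
Context {R : realType}.
Local Notation mu := (@lebesgue_measure R).
Local Notation Rp := (`]0%R, +oo[%classic : set R).
Implicit Types (g kap : R -> R) (F f : R -> R[i]).

Lemma pv_weight_le1 (e y : R) : `|pv_weight e y| <= 1.
Proof.
rewrite ger0_norm ?pv_weight_ge0// /pv_weight; have [->|y0] := eqVneq y 0; first by rewrite expr0n mul0r.
by rewrite ler_pdivrMr ?mul1r ?lerDl ?sqr_ge0// ltr_wpDr ?sqr_ge0// exprn_even_gt0.
Qed.

(** The kernel 2 kap is the sum of s / (x - t) and the Stieltjes kernel.  The first part is
    regularized to the conjugate Poisson kernel by PV_regularization, the second is
    absolutely integrable. *)
Lemma PV_Hilbert (s : R) g kap (x P : R) (en : nat -> R) : s ^+ 2 = 1 -> 0 < x ->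
  mfun g -> mfun kap -> sq (fun t => g t * \1_Rp t) ->
  (forall t, 0 < t -> t != x -> 2 * kap t = s / (x - t) + 1 / (x + t)) ->
  (forall e, 0 < e -> itg (fun t => kap t * g t * \1_Rp t * cut e (t - x))) ->
  Int (fun t => kap t * g t * \1_Rp t * cut e (t - x)) @[e --> 0^'+] --> P ->
  (forall n, 0 < en n) -> en n @[n --> \oo] --> (0 : R) ->
  Hilbert_reg (en n) (fun t => g t * \1_Rp t) x @[n --> \oo] --> s * (2 * P - Stieltjes g x).
Proof.
move=> s2 x0 mg mk sg kE ic cP en0 cen.
have mRp := @mfun_Rp R.
have E e t : 0 < e -> kap t * g t * \1_Rp t * pv_weight e (x - t) =
   2^-1 * (s * (conjP e (x - t) * (g t * \1_Rp t)) + (g t / (x + t) * \1_Rp t) * pv_weight e (x - t)).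
  move=> e0; have [t0|t0] := ltP 0 t; last first.
    by rewrite Rp_neg// !mulr0 !mul0r addr0 mulr0.
  have [->|tx] := eqVneq t x; first by rewrite subrr /pv_weight /conjP expr0n !mul0r !mulr0 addr0 mulr0.
  have xt : x - t != 0 by rewrite subr_eq0 eq_sym.
  have -> : kap t = 2^-1 * (2 * kap t) by field.
  rewrite kE// /pv_weight /conjP; field.
  by apply/and3P; split; [rewrite gt_eqF// Qden_gt0|rewrite gt_eqF// addr_gt0|].
have iS := itg_Stieltjes x0 sg.
have iQ e : 0 < e -> itg (fun t => conjP e (x - t) * (g t * \1_Rp t)).
  by move=> e0; apply: sq_mul => //; exact: sq_conjP_row.
have iW e : 0 < e -> itg (fun t => (g t / (x + t) * \1_Rp t) * pv_weight e (x - t)).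
  move=> e0; apply: itg_le (itg_norm iS) _.
    by apply: measurable_funM; [exact: itg_m iS|exact: mfun_pv_weight].
  by move=> t; rewrite normrM ler_piMr// pv_weight_le1.
have c1 : Int (fun t => kap t * g t * \1_Rp t * pv_weight (en n) (x - t)) @[n --> \oo] --> P.
  apply: PV_regularization => //.
    by apply: measurable_funM => //; exact: measurable_funM.
  move=> e e0; apply: (eq_itg (fun t => esym (E e t e0))).
  by apply: itgZ; apply: itgD; [apply: itgZ; exact: iQ|exact: iW].
have c2 : Int (fun t => (g t / (x + t) * \1_Rp t) * pv_weight (en n) (x - t)) @[n --> \oo] --> Stieltjes g x.
  have iG := itg_norm iS; apply: (dct _ _ iG).
  - by move=> n; exact: (itg_m (iW _ (en0 n))).
  - exact: itg_m iS.
  - by move=> n t; rewrite normrM ler_piMr// pv_weight_le1.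
  - apply: aeS (ae_neq x) => t tx; rewrite -[X in _ --> X]mulr1; apply: cvgMr.
    have xt : x - t != 0 by rewrite subr_eq0 eq_sym.
    pose w (e : R) := (x - t) ^+ 2 / ((x - t) ^+ 2 + e ^+ 2).
    have w0 : w 0 = 1 by rewrite /w expr0n addr0 divff// expf_neq0.
    rewrite -w0; apply: (cvg_comp _ w cen); apply: derivable_continuous => e.
    have d0 : (x - t) ^+ 2 + e ^+ 2 != 0 by rewrite gt_eqF// ltr_wpDr ?sqr_ge0// exprn_even_gt0.
    by have dV := is_deriveV d0; exact: ex_derive.
have key n : s * (2 * Int (fun t => kap t * g t * \1_Rp t * pv_weight (en n) (x - t)) -
    Int (fun t => (g t / (x + t) * \1_Rp t) * pv_weight (en n) (x - t))) = Hilbert_reg (en n) (fun t => g t * \1_Rp t) x.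
  rewrite (eq_Int (fun t => E (en n) t (en0 n))) IntZ; last by apply: itgD; [apply: itgZ; exact: iQ|exact: iW].
  rewrite IntD; [|by apply: itgZ; exact: iQ|exact: iW].
  rewrite IntZ; last exact: iQ.
  by rewrite mulrA divff// mul1r addrK mulrA -expr2 s2 mul1r.
under eq_cvg do rewrite -key.
by apply: cvgMr; apply: cvgB => //; exact: cvgMr.
Qed.

Lemma cut_indic (e x t : R) : \1_(Rpos `&` [set t | e < `|t - x|]) t = \1_Rp t * cut e (t - x).
Proof.
have -> : \1_(Rpos `&` [set t | e < `|t - x|]) t = \1_Rp t * \1_[set t | e < `|t - x|] t :> R by rewrite indicI.
congr (_ * _); rewrite /cut indicE; case: ifPn => h; first by rewrite mem_set.
by rewrite memNset//=; exact/negP.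
Qed.

Lemma measurable_PVdom (e x : R) : measurable (Rpos `&` [set t : R | e < `|t - x|]).
Proof.
apply: measurableI; first exact: measurable_Rpos.
have m : measurable_fun setT (fun t : R => e < `|t - x|).
  by apply: measurable_fun_ltr => //; apply: measurableT_comp => //; exact: measurable_funB.
by have := m measurableT [set true] I; rewrite setTI; congr measurable.
Qed.

Lemma PV_parts (e x : R) F f kap : (forall t, F t = (kap t)%:C * f t) ->
  (forall t, ReD (Rpos `&` [set t | e < `|t - x|]) F t = kap t * ReD Rpos f t * \1_Rp t * cut e (t - x)) /\
  (forall t, ImD (Rpos `&` [set t | e < `|t - x|]) F t = kap t * ImD Rpos f t * \1_Rp t * cut e (t - x)).
Proof.
move=> FE; split=> t.
- by rewrite /ReD cut_indic FE Re_mul Re_real Im_real mul0r subr0 -[in LHS]Rp2; ring.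
- by rewrite /ImD cut_indic FE Im_mul Re_real Im_real mul0r addr0 -[in LHS]Rp2; ring.
Qed.

Lemma is_PV_Hilbert (s : R) F f kap (x : R) (p : R[i]) (en : nat -> R) : s ^+ 2 = 1 -> 0 < x ->
  L2 Rpos f -> mfun kap ->
  (forall t, F t = (kap t)%:C * f t) ->
  (forall t, 0 < t -> t != x -> 2 * kap t = s / (x - t) + 1 / (x + t)) ->
  is_PV F x p -> (forall n, 0 < en n) -> en n @[n --> \oo] --> (0 : R) ->
  Hilbert_reg (en n) (fun t => ReD Rpos f t * \1_Rp t) x @[n --> \oo] --> s * (2 * complex.Re p - Stieltjes (ReD Rpos f) x) /\
  Hilbert_reg (en n) (fun t => ImD Rpos f t * \1_Rp t) x @[n --> \oo] --> s * (2 * complex.Im p - Stieltjes (ImD Rpos f) x).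
Proof.
move=> s2 x0 Lf mk FE kE [iF cF] en0 cen.
have [sR sI _] := L2_parts measurable_Rpos Lf.
have mD (e : R) := measurable_PVdom e x.
have HR (e : R) := (PV_parts e x FE).1; have HI (e : R) := (PV_parts e x FE).2.
split.
- apply: (PV_Hilbert s2 x0 sR.1 mk _ kE) => //.
  + by apply: sq_Rp.
  + by move=> e e0; apply: (eq_itg (HR e)); exact: ((cintegrable_parts F (mD e)).1 (iF e e0)).1.
  + apply/subr_cvg0/norm_cvg0P; apply: (@squeeze_cvgr _ _ _ _ (fun=> 0) (fun e => ComplexField.Normc.normc (cintegral (Rpos `&` [set t | e < `|t - x|]) F - p))).
    * apply: nearW => e; rewrite normr_ge0/=; apply: le_trans (Re_le_normc _).
      by rewrite Re_sub (cintegral_parts _ F).1 (eq_Int (HR e)).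
    * exact: cvg_cst.
    * exact: cF.
- apply: (PV_Hilbert s2 x0 sI.1 mk _ kE) => //.
  + by apply: sq_Rp.
  + by move=> e e0; apply: (eq_itg (HI e)); exact: ((cintegrable_parts F (mD e)).1 (iF e e0)).2.
  + apply/subr_cvg0/norm_cvg0P; apply: (@squeeze_cvgr _ _ _ _ (fun=> 0) (fun e => ComplexField.Normc.normc (cintegral (Rpos `&` [set t | e < `|t - x|]) F - p))).
    * apply: nearW => e; rewrite normr_ge0/=; apply: le_trans (Im_le_normc _).
      by rewrite Im_sub (cintegral_parts _ F).2 (eq_Int (HI e)).
    * exact: cvg_cst.
    * exact: cF.
Qed.

(** Both principal value equations, with the kernel kap as a parameter. *)
Definition sol_PV (kap : R -> R -> R) (lam : R[i]) f : Prop :=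
  {ae mu, forall x, 0 < x -> exists2 p, is_PV (fun t => (kap x t)%:C * f t) x p &
    f x + (2 / pi)%:C * p = lam / x%:C * f (1 / x)}.

Lemma sol_PV_trivial (s : R) (kap : R -> R -> R) lam f : s ^+ 2 = 1 -> L2 Rpos f ->
  (forall x, mfun (kap x)) ->
  (forall x t, 0 < x -> 0 < t -> t != x -> 2 * kap x t = s / (x - t) + 1 / (x + t)) ->
  sol_PV kap lam f -> sqnorm Rpos f = 0%E.
Proof.
move=> s2 Lf mk kE sol; have [sR sI _] := L2_parts measurable_Rpos Lf.
pose en (n : nat) : R := n.+1%:R^-1.
have en0 n : 0 < en n by rewrite invr_gt0.
have cen : en n @[n --> \oo] --> (0 : R) by exact: cvg_harmonic.
have sR' := sq_Rp sR; have sI' := sq_Rp sI.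
have [zR zI] : {ae mu, forall y, to_log (ReD Rpos f) y = 0} /\ {ae mu, forall y, to_log (ImD Rpos f) y = 0}.
  apply: (@Hilbert_unique R (complex.Re lam) (complex.Im lam) s _ _ en s2 sR.1 sI.1 sR' sI' en0 cen).
  apply: aeS sol => x h x0; have [p pv E] := h x0.
  have [h1 h2] := is_PV_Hilbert s2 x0 Lf (mk x) (fun t => erefl) (fun t => kE x t x0) pv en0 cen.
  have x1 : 0 < 1 / x by rewrite div1r invr_gt0.
  have pi0 : pi != 0 :> R by rewrite gt_eqF ?pi_gt0.
  have ER := congr1 (@complex.Re R) E; have EI := congr1 (@complex.Im R) E.
  rewrite real_complexV in ER EI.
  rewrite Re_add !Re_mul !Im_mul !Re_real !Im_real in ER; rewrite Im_add !Im_mul !Re_mul !Re_real !Im_real in EI.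
  rewrite /invert (ReD_pos f x0) (ImD_pos f x0) (ReD_pos f x1) (ImD_pos f x1); split.
  - rewrite (_ : pi * _ = 2 * complex.Re p)//.
    have -> : 2 * complex.Re p = pi * (2 / pi * complex.Re p) by rewrite mulrA mulrCA divff// mulr1.
    congr (_ * _); rewrite !mul0r subr0 mulr0 mulr0 !subr0 add0r in ER; lra.
  - rewrite (_ : pi * _ = 2 * complex.Im p)//.
    have -> : 2 * complex.Im p = pi * (2 / pi * complex.Im p) by rewrite mulrA mulrCA divff// mulr1.
    congr (_ * _); rewrite !mul0r !mulr0 !addr0 !add0r !subr0 in EI; lra.
exact: sqnorm_of_to_log.
Qed.
End PVtoHilbert.

(** * Null functions and the Mellin representation *)
Section Conclusion.
Context {R : realType}.
Local Notation mu := (@lebesgue_measure R).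
Local Notation Rp := (`]0%R, +oo[%classic : set R).
Local Notation normc := ComplexField.Normc.normc.
Implicit Types (f m : R -> R[i]) (h phi : R[i] -> R[i]) (lam : R[i]).

Import HBNNSimple.

(** Applied to quotients that are only known to vanish almost everywhere.  Every
    nonnegative simple function below g is null, and the integral is the supremum of
    the integrals of those. *)
Lemma ge0_integral_ae0 (g : R -> \bar R) : (forall x, (0 <= g x)%E) -> {ae mu, forall x, g x = 0%E} ->
  (\int[mu]_x g x = 0)%E.
Proof.
move=> g0 gz; rewrite ge0_integralTE//; apply/eqP; rewrite eq_le; apply/andP; split.
  apply: ge_ereal_sup => _ [s /= sg <-]; rewrite -integralT_nnsfun.
  suff -> : (\int[mu]_x (s x)%:E = 0)%E by [].
  rewrite -[RHS](integral0 mu setT); apply: ae_eq_integral => //.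
    by apply/measurable_EFinP; exact: measurable_funP.
  apply: aeS gz => x gx _ /=; apply/eqP; rewrite eq_le -{1}gx sg/= lee_fin.
  exact: fun_ge0.
by apply: ereal_sup_ubound; exists nnsfun0 => //; exact: sintegral0.
Qed.

Lemma Int_ae0 (g : R -> R) : {ae mu, forall x, g x = 0} -> Int g = 0.
Proof.
move=> gz; rewrite /Int /Rintegral integralE !ge0_integral_ae0 ?subee//.
- by apply: aeS gz => x gx; rewrite funenegE /= gx oppr0 maxxx.
- by apply: aeS gz => x gx; rewrite funeposE /= gx maxxx.
Qed.

Lemma mellin_trunc_ae0 h N x : {ae mu, forall tau, h (sigma_pt tau) = 0} -> mellin_trunc h N x = 0.
Proof.
move=> hz; rewrite /mellin_trunc.
have [E1 E2] := cintegral_parts `[- N, N]%classic (fun tau => h (sigma_pt tau) * cpow x (- sigma_pt tau)).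
rewrite [cintegral _ _](_ : _ = 0) ?mulr0//.
apply: complex_eqP; rewrite ?E1 ?E2; apply: Int_ae0; apply: aeS hz => t ht.
- by rewrite /ReD ht mul0r mul0r.
- by rewrite /ImD ht mul0r mul0r.
Qed.

(** The truncated integrals of a null h are all zero. *)
Lemma is_inv_mellin_ae0 h f : {ae mu, forall tau, h (sigma_pt tau) = 0} ->
  is_inv_mellin h f <-> L2 Rpos f /\ sqnorm Rpos f = 0%E.
Proof.
move=> hz; have E N : sqnorm Rpos (fun x => f x - mellin_trunc h N x) = sqnorm Rpos f.
  by congr (sqnorm _ _); apply/funext => x; rewrite mellin_trunc_ae0// subr0.
have E' : (fun N => sqnorm Rpos (fun x => f x - mellin_trunc h N x)) = (fun=> sqnorm Rpos f) by exact/funext.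
rewrite /is_inv_mellin E'; split=> -[Lf c]; split => //.
  have c' : (fun _ : R => sqnorm Rpos f) @ +oo%R --> sqnorm Rpos f by exact: cvg_cst.
  exact: cvg_unique c' c.
by rewrite c; exact: cvg_cst.
Qed.

Lemma cpow_sigma (x tau : R) : 0 < x ->
  cpow x (- sigma_pt tau) = (expR (- (ln x / 2)) * cos (tau * ln x)) +i* (- (expR (- (ln x / 2)) * sin (tau * ln x))).
Proof.
move=> x0; have E : - sigma_pt tau * (ln x)%:C = (- (ln x / 2)) +i* (- (tau * ln x)).
  by apply: complex_eqP; rewrite ?Re_mul ?Im_mul /=; ring.
rewrite /cpow E /cexp; apply: complex_eqP; rewrite ?Re_mul ?Im_mul /= cosN sinN; ring.
Qed.

Lemma mellin_trunc_mellin_window phi (n : nat) (x : R) : 0 < x -> L2_sigma phi ->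
  let p1 := ReD setT (phi \o sigma_pt) in let p2 := ImD setT (phi \o sigma_pt) in
  complex.Re (mellin_trunc phi n%:R x) = expR (- (ln x / 2)) * ((2 * pi)^-1 * mellin_window n p1 p2 (ln x)) /\
  complex.Im (mellin_trunc phi n%:R x) = expR (- (ln x / 2)) * ((2 * pi)^-1 * mellin_window n p2 (fun t => - p1 t) (ln x)).
Proof.
move=> x0 Lp p1 p2; have [s1 s2 _] := L2_parts measurableT Lp.
have s1N : sq (fun t => - p1 t) := sqN s1.
have [E1 E2] := cintegral_parts `[- (n%:R : R), n%:R]%classic (fun tau => phi (sigma_pt tau) * cpow x (- sigma_pt tau)).
have p1E t : p1 t = complex.Re (phi (sigma_pt t)) by rewrite /p1 /ReD indicT mulr1.
have p2E t : p2 t = complex.Im (phi (sigma_pt t)) by rewrite /p2 /ImD indicT mulr1.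
rewrite /mellin_trunc Re_mul Im_mul Re_real Im_real !mul0r subr0 addr0 E1 E2 /mellin_window; split.
- rewrite [RHS]mulrCA; congr (_ * _); rewrite -IntZ; last exact: itg_mellin_window.
  by apply: eq_Int => t; rewrite /ReD cpow_sigma// Re_mul /= /trunc -p1E -p2E; ring.
- rewrite [RHS]mulrCA; congr (_ * _); rewrite -IntZ; last exact: itg_mellin_window.
  by apply: eq_Int => t; rewrite /ImD cpow_sigma// Im_mul /= /trunc -p1E -p2E; ring.
Qed.

Lemma Int_of_log2 (H : R -> R) : sq H -> Int (fun x => of_log H x ^+ 2) = Int (fun y => H y ^+ 2).
Proof.
move=> sH; have su := sq_of_log sH.
have su1 := sq_Rp su.
have := pair_log su1 su.1 sH; rewrite of_logK => h.
by rewrite -(eq_Int (f := fun x => of_log H x * of_log H x)) ?h.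
Qed.

(** In logarithmic coordinates, the components of the truncated inverse Mellin integral
    are the windows of mellin_window, up to the factor 1 / (2 pi).  As m is null, they
    tend to 0 in L2. *)
Lemma inv_mellin_injective phi m : L2_sigma phi -> is_inv_mellin phi m -> sqnorm Rpos m = 0%E ->
  {ae mu, forall tau, phi (sigma_pt tau) = 0}.
Proof.
move=> Lp [Lm cm] m0; have [s1 s2 _] := L2_parts measurableT Lp.
set p1 := ReD setT (phi \o sigma_pt) in s1; set p2 := ImD setT (phi \o sigma_pt) in s2.
have s1N : sq (fun t => - p1 t) := sqN s1.
pose c : R := (2 * pi)^-1.
have c0 : 0 < c by rewrite invr_gt0 mulr_gt0// pi_gt0.
pose A n := mellin_window n p1 p2; pose B n := mellin_window n p2 (fun t => - p1 t).
have sA n : sq (A n) by exact: sq_mellin_window.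
have sB n : sq (B n) by exact: sq_mellin_window.
have scA n : sq (fun y => c * A n y) by exact: sqZ.
have scB n : sq (fun y => c * B n y) by exact: sqZ.
have mz := sqnorm_eq0_ae Lm m0.
have [sR sI _] := L2_parts measurable_Rpos Lm.
pose D n (x : R) := m x - mellin_trunc phi n%:R x.
have DR n x : ReD Rpos (D n) x = ReD Rpos m x - of_log (fun y => c * A n y) x.
  have [x0|x0] := ltP 0 x; last by rewrite of_log_neg// subr0 !ReD_neg.
  have [E _] := mellin_trunc_mellin_window n x0 Lp.
  by rewrite !ReD_pos// /D Re_sub E /of_log Rp_pos// mulr1.
have DI n x : ImD Rpos (D n) x = ImD Rpos m x - of_log (fun y => c * B n y) x.
  have [x0|x0] := ltP 0 x; last by rewrite of_log_neg// subr0 !ImD_neg.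
  have [_ E] := mellin_trunc_mellin_window n x0 Lp.
  by rewrite !ImD_pos// /D Im_sub E /of_log Rp_pos// mulr1.
have sDR n : sq (ReD Rpos (D n)).
  by rewrite (_ : ReD _ _ = fun x => ReD Rpos m x - of_log (fun y => c * A n y) x); [apply: sqB => //; exact: sq_of_log|exact/funext].
have sDI n : sq (ImD Rpos (D n)).
  by rewrite (_ : ImD _ _ = fun x => ImD Rpos m x - of_log (fun y => c * B n y) x); [apply: sqB => //; exact: sq_of_log|exact/funext].
have key n : sqnorm Rpos (D n) = (c ^+ 2 * (Int (fun y => A n y ^+ 2) + Int (fun y => B n y ^+ 2)))%:E.
  have [_ _ ->] := L2_parts measurable_Rpos (L2_of_parts measurable_Rpos (sDR n) (sDI n)).
  congr (_%:E); rewrite mulrDr -!IntZ; [|exact: (sB n).2|exact: (sA n).2].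
  congr (_ + _).
  - transitivity (Int (fun x => of_log (fun y => c * A n y) x ^+ 2)).
      apply: ae_eq_Int; [exact: itg_m (sDR n).2|exact: itg_m (sq_of_log (scA n)).2|].
      apply: aeS mz => x h; rewrite DR; have [x0|x0] := ltP 0 x; first by rewrite ReD_pos// (h x0).1 sub0r sqrrN.
      by rewrite of_log_neg// subr0 !ReD_neg.
    by rewrite Int_of_log2//; apply: eq_Int => y; rewrite exprMn.
  - transitivity (Int (fun x => of_log (fun y => c * B n y) x ^+ 2)).
      apply: ae_eq_Int; [exact: itg_m (sDI n).2|exact: itg_m (sq_of_log (scB n)).2|].
      apply: aeS mz => x h; rewrite DI; have [x0|x0] := ltP 0 x; first by rewrite ImD_pos// (h x0).1 sub0r sqrrN.
      by rewrite of_log_neg// subr0 !ImD_neg.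
    by rewrite Int_of_log2//; apply: eq_Int => y; rewrite exprMn.
have cn : (c ^+ 2 * (Int (fun y => A n y ^+ 2) + Int (fun y => B n y ^+ 2))) @[n --> \oo] --> (0 : R).
  have h : sqnorm Rpos (D n) @[n --> \oo] --> 0%E by exact: (cvg_comp _ _ (@cvg_nat_pinfty R) cm).
  by move: h; under eq_cvg do rewrite key; move/fine_cvgP => [_].
have A0 n : 0 <= Int (fun y => A n y ^+ 2) by apply: Int_ge0 => y; exact: sqr_ge0.
have B0 n : 0 <= Int (fun y => B n y ^+ 2) by apply: Int_ge0 => y; exact: sqr_ge0.
have cs : (Int (fun y => A n y ^+ 2) + Int (fun y => B n y ^+ 2)) @[n --> \oo] --> (0 : R).
  have : c ^- 2 * (c ^+ 2 * (Int (fun y => A n y ^+ 2) + Int (fun y => B n y ^+ 2))) @[n --> \oo] --> c ^- 2 * 0 by exact: cvgMr.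
  by rewrite mulr0; under eq_cvg do rewrite mulKf ?expf_neq0 ?gt_eqF//.
have cA : Int (fun y => A n y ^+ 2) @[n --> \oo] --> (0 : R).
  apply: (@squeeze_cvgr _ _ _ _ (fun=> 0) (fun n => Int (fun y => A n y ^+ 2) + Int (fun y => B n y ^+ 2))) => //.
    by apply: nearW => n; rewrite A0 lerDl B0.
  exact: cvg_cst.
have cB : Int (fun y => B n y ^+ 2) @[n --> \oo] --> (0 : R).
  apply: (@squeeze_cvgr _ _ _ _ (fun=> 0) (fun n => Int (fun y => A n y ^+ 2) + Int (fun y => B n y ^+ 2))) => //.
    by apply: nearW => n; rewrite B0 lerDr A0.
  exact: cvg_cst.
(* The imaginary part p2 is the real part of - i phi; its windows are B and
   - A. *)
have z1 := mellin_injective s1 s2 cA cB.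
have BN n : Int (fun y => mellin_window n (fun t => - p1 t) (fun t => - p2 t) y ^+ 2) = Int (fun y => A n y ^+ 2).
  apply: eq_Int => y; rewrite -[in RHS]sqrrN; congr (_ ^+ 2).
  rewrite /A /mellin_window -IntN; last exact: itg_mellin_window.
  by apply: eq_Int => t; rewrite /trunc; ring.
have cBN : Int (fun y => mellin_window n (fun t => - p1 t) (fun t => - p2 t) y ^+ 2) @[n --> \oo] --> (0 : R).
  have E : (fun n => Int (fun y => mellin_window n (fun t => - p1 t) (fun t => - p2 t) y ^+ 2)) = (fun n => Int (fun y => A n y ^+ 2)) by exact/funext.
  by rewrite E.
have z2 := mellin_injective s2 s1N cB cBN.
apply: aeS (aeI z1 z2) => t [h1 h2]; apply: complex_eqP.
- by transitivity (p1 t); [rewrite /p1 /ReD indicT mulr1|rewrite h1].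
- by transitivity (p2 t); [rewrite /p2 /ImD indicT mulr1|rewrite h2].
Qed.

Lemma Stieltjes_cintegral m x :
  complex.Re (cintegral Rpos (stieltjes_integrand m x)) = Stieltjes (ReD Rpos m) x /\
  complex.Im (cintegral Rpos (stieltjes_integrand m x)) = Stieltjes (ImD Rpos m) x.
Proof.
have [-> ->] := cintegral_parts Rpos (stieltjes_integrand m x).
have E t : stieltjes_integrand m x t = ((x + t)^-1)%:C * m t by rewrite /stieltjes_integrand real_complexV mulrC.
split; apply: eq_Int => t.
- by rewrite /ReD E Re_mul /= mul0r subr0 -[in LHS]indic2; ring.
- by rewrite /ImD E Im_mul /= mul0r addr0 -[in LHS]indic2; ring.
Qed.

Lemma stieltjes_cintegrable m (x : R) : L2 Rpos m -> 0 < x -> cintegrable Rpos (stieltjes_integrand m x).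
Proof.
move=> Lm x0; have [sR sI _] := L2_parts measurable_Rpos Lm.
have E t : stieltjes_integrand m x t = ((x + t)^-1)%:C * m t by rewrite /stieltjes_integrand real_complexV mulrC.
apply/cintegrable_parts; first exact: measurable_Rpos.
split.
- apply: eq_itg (itg_Stieltjes x0 (sq_Rp sR)) => t.
  by rewrite /ReD E Re_mul /= mul0r subr0 -[in RHS]indic2; ring.
- apply: eq_itg (itg_Stieltjes x0 (sq_Rp sI)) => t.
  by rewrite /ImD E Im_mul /= mul0r addr0 -[in RHS]indic2; ring.
Qed.

(** The equation is (lam^2 - 2) m = (2 / pi) S m. *)
Lemma sol_stieltjes_trivial lam m : L2 Rpos m -> sol_stieltjes lam m -> sqnorm Rpos m = 0%E.
Proof.
move=> Lm sol; have [sR sI _] := L2_parts measurable_Rpos Lm.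
have [zR zI] : {ae mu, forall y, to_log (ReD Rpos m) y = 0} /\ {ae mu, forall y, to_log (ImD Rpos m) y = 0}.
  apply: (@Stieltjes_unique R (complex.Re (lam ^+ 2 - 2)) (complex.Im (lam ^+ 2 - 2)) _ _ sR.1 sI.1 (sq_Rp sR) (sq_Rp sI)).
  apply: aeS sol => x h x0; have {h} E := h x0; have [<- <-] := Stieltjes_cintegral m x.
  set J := cintegral Rpos (stieltjes_integrand m x) in E *.
  rewrite !ReD_pos// !ImD_pos//.
  have {}E : (lam ^+ 2 - 2) * m x = (2 / pi)%:C * J.
    by apply/eqP; rewrite -subr_eq0 -oppr_eq0 opprB -mulNr opprB addrC; apply/eqP.
  have ER := congr1 (@complex.Re R) E; have EI := congr1 (@complex.Im R) E.
  rewrite Re_mul Re_mul Re_real Im_real mul0r subr0 in ER.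
  rewrite Im_mul Im_mul Re_real Im_real mul0r addr0 in EI.
  by split.
exact: sqnorm_of_to_log.
Qed.

Lemma sol_PV_zero (kap : R -> R -> R) lam f : (forall x, mfun (kap x)) -> L2 Rpos f -> sqnorm Rpos f = 0%E ->
  sol_PV kap lam f.
Proof.
move=> mk Lf f0; have [sR sI _] := L2_parts measurable_Rpos Lf.
have fz := sqnorm_eq0_ae Lf f0.
apply: aeS fz => x h x0; exists 0; last by rewrite (h x0).1 (h x0).2 !mulr0 addr0.
have z (e : R) := PV_parts e x (fun t => erefl ((kap x t)%:C * f t)).
have mR (e : R) : mfun (fun t => kap x t * ReD Rpos f t * \1_Rp t * cut e (t - x)).
  apply: measurable_funM; last exact: mfun_cut.
  apply: measurable_funM; last exact: mfun_Rp.
  by apply: measurable_funM; [exact: mk|exact: sR.1].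
have mI (e : R) : mfun (fun t => kap x t * ImD Rpos f t * \1_Rp t * cut e (t - x)).
  apply: measurable_funM; last exact: mfun_cut.
  apply: measurable_funM; last exact: mfun_Rp.
  by apply: measurable_funM; [exact: mk|exact: sI.1].
have fz' := sqnorm_eq0_ae Lf f0.
have zR (e : R) : {ae mu, forall t, kap x t * ReD Rpos f t * \1_Rp t * cut e (t - x) = 0}.
  apply: aeS fz' => t ht; rewrite -mulrA -[kap x t * _ * _]mulrA; have [t0|t0] := ltP 0 t.
    by rewrite ReD_pos// (ht t0).1 /= mul0r mulr0.
  by rewrite ReD_neg// mul0r mulr0.
have zI (e : R) : {ae mu, forall t, kap x t * ImD Rpos f t * \1_Rp t * cut e (t - x) = 0}.
  apply: aeS fz' => t ht; rewrite -mulrA -[kap x t * _ * _]mulrA; have [t0|t0] := ltP 0 t.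
    by rewrite ImD_pos// (ht t0).1 /= mul0r mulr0.
  by rewrite ImD_neg// mul0r mulr0.
have m0 : mfun (fun=> 0 : R) by exact: measurable_cst.
split.
- move=> e e0; apply/cintegrable_parts; first exact: measurable_PVdom.
  rewrite (funext (z e).1) (funext (z e).2); split.
  + by apply: (ae_eq_itg m0 (mR e) _ itg0); apply: aeS (zR e) => t ->.
  + by apply: (ae_eq_itg m0 (mI e) _ itg0); apply: aeS (zI e) => t ->.
- rewrite (_ : (fun e => _) = fun=> 0); first exact: cvg_cst.
  apply/funext => e; rewrite [cintegral _ _](_ : _ = 0) ?subr0; last first.
    have [E1 E2] := cintegral_parts (Rpos `&` [set t | e < `|t - x|]) (fun t => (kap x t)%:C * f t).
    apply: complex_eqP; rewrite ?E1 ?E2.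
    + by rewrite (funext (z e).1) Int_ae0.
    + by rewrite (funext (z e).2) Int_ae0.
  by rewrite /= expr0n addr0 sqrtr0.
Qed.

Lemma L2_sigma_zero : L2_sigma (fun=> 0 : R[i]) /\ antisymmetric_sigma (fun=> 0 : R[i]).
Proof.
split; last by apply: (aeW mu) => t; rewrite oppr0.
have s0 : sq (fun=> 0 : R).
  split; first exact: measurable_cst.
  by apply: eq_itg (@itg0 R) => x; rewrite expr0n.
apply: L2_of_parts => //.
- by rewrite (_ : ReD _ _ = fun=> 0); [exact: s0|apply/funext => x; rewrite /ReD mul0r].
- by rewrite (_ : ImD _ _ = fun=> 0); [exact: s0|apply/funext => x; rewrite /ImD mul0r].
Qed.

Lemma L2_zero : L2 Rpos (fun=> 0 : R[i]) /\ sqnorm Rpos (fun=> 0 : R[i]) = 0%E.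
Proof.
have s0 : sq (fun=> 0 : R).
  split; first exact: measurable_cst.
  by apply: eq_itg (@itg0 R) => x; rewrite expr0n.
have eR : ReD Rpos (fun=> 0 : R[i]) = fun=> 0 by apply/funext => x; rewrite /ReD mul0r.
have eI : ImD Rpos (fun=> 0 : R[i]) = fun=> 0 by apply/funext => x; rewrite /ImD mul0r.
have L : L2 Rpos (fun=> 0 : R[i]) by apply: L2_of_parts; rewrite ?eR ?eI//; exact: measurable_Rpos.
split => //; have [_ _ ->] := L2_parts measurable_Rpos L.
rewrite eR eI (eq_Int (g := fun=> 0)); last by move=> x; rewrite expr0n.
by rewrite Int0 addr0.
Qed.

(** Every solution f is null, hence represented by phi = 0.  In the converse
    direction phi is null, so the quotient represents exactly the null functions. *)
Lemma PV_equation_Mellin_form (s : R) (kap : R -> R -> R) lam (den : R[i] -> R[i]) : s ^+ 2 = 1 ->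
  (forall x, mfun (kap x)) ->
  (forall x t, 0 < x -> 0 < t -> t != x -> 2 * kap x t = s / (x - t) + 1 / (x + t)) ->
  (forall f, L2 Rpos f -> sol_PV kap lam f ->
      exists phi : R[i] -> R[i],
        [/\ L2_sigma phi, antisymmetric_sigma phi &
            is_inv_mellin (fun z => phi z / den z) f]) /\
   (forall (phi : R[i] -> R[i]) m,
      L2_sigma phi -> antisymmetric_sigma phi -> is_inv_mellin phi m ->
      (forall x : R, 0 < x -> cintegrable Rpos (stieltjes_integrand m x)) /\
      (sol_stieltjes lam m ->
        (exists f, is_inv_mellin (fun z => phi z / den z) f) /\
        (forall f, is_inv_mellin (fun z => phi z / den z) f -> sol_PV kap lam f))).
Proof.
move=> s2 mk kE; split=> [f Lf sol|phi m Lp _ im].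
  have [L0 A0] := L2_sigma_zero; exists (fun=> 0); split => //.
  apply/is_inv_mellin_ae0; first by apply: (aeW mu) => t; rewrite mul0r.
  by split => //; exact: sol_PV_trivial s2 Lf mk kE sol.
have Lm : L2 Rpos m := im.1; split=> [x x0|sol]; first exact: stieltjes_cintegrable.
have pz := inv_mellin_injective Lp im (sol_stieltjes_trivial Lm sol).
have qz : {ae mu, forall tau, phi (sigma_pt tau) / den (sigma_pt tau) = 0}.
  by apply: aeS pz => t ->; rewrite mul0r.
split; first by exists (fun=> 0); apply/(is_inv_mellin_ae0 _ qz); exact: L2_zero.
by move=> f /(is_inv_mellin_ae0 _ qz)[Lf f0]; exact: sol_PV_zero.
Qed.

Lemma sol_tanE lam f : sol_tan lam f = sol_PV (fun x t => x / (x ^+ 2 - t ^+ 2)) lam f.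
Proof.
rewrite /sol_tan /sol_PV; congr almost_everywhere; apply/funext => x; congr (_ -> _).
congr ex2; apply/funext => p; congr (is_PV _ _ _); apply/funext => t.
by rewrite rmorphM /= -real_complexV; ring.
Qed.

End Conclusion.

Section Kernels2.
Context {R : realType}.
Local Notation mu := (@lebesgue_measure R).
Implicit Types (lam : R[i]) (f : R -> R[i]).

Lemma sol_cotE lam f : sol_cot lam f = sol_PV (fun x t => t / (t ^+ 2 - x ^+ 2)) lam f.
Proof.
rewrite /sol_cot /sol_PV; congr almost_everywhere; apply/funext => x; congr (_ -> _).
congr ex2; apply/funext => p; congr (is_PV _ _ _); apply/funext => t.
by rewrite rmorphM /= -real_complexV; ring.
Qed.

Lemma mfun_tan_kernel (x : R) : mfun (fun t : R => x / (x ^+ 2 - t ^+ 2)).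
Proof.
have m : mfun (fun t : R => x ^+ 2 - t ^+ 2).
  by apply: measurable_funB => //; exact: measurable_funX.
by apply: measurable_funM => //; exact: mfunV.
Qed.

Lemma mfun_cot_kernel (x : R) : mfun (fun t : R => t / (t ^+ 2 - x ^+ 2)).
Proof.
have m : mfun (fun t : R => t ^+ 2 - x ^+ 2).
  by apply: measurable_funB => //; exact: measurable_funX.
by apply: measurable_funM => //; exact: mfunV.
Qed.

Lemma tan_kernelE (x t : R) : 0 < x -> 0 < t -> t != x ->
  2 * (x / (x ^+ 2 - t ^+ 2)) = 1 / (x - t) + 1 / (x + t).
Proof.
move=> x0 t0 tx; have xt : x - t != 0 by rewrite subr_eq0 eq_sym.
have xt' : x + t != 0 by rewrite gt_eqF// addr_gt0.
by rewrite subr_sqr; field; rewrite xt xt'.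
Qed.

Lemma cot_kernelE (x t : R) : 0 < x -> 0 < t -> t != x ->
  2 * (t / (t ^+ 2 - x ^+ 2)) = -1 / (x - t) + 1 / (x + t).
Proof.
move=> x0 t0 tx; have xt : x - t != 0 by rewrite subr_eq0 eq_sym.
have xt' : x + t != 0 by rewrite gt_eqF// addr_gt0.
rewrite -opprB subr_sqr; field; by rewrite xt xt'.
Qed.
End Kernels2.

Theorem theorem8 (R : realType) (lam : R[i]) (hlam : `|1 - lam| != 1) :
  ((forall f : R -> R[i], L2 Rpos f -> sol_tan lam f ->
      exists phi : R[i] -> R[i],
        [/\ L2_sigma phi, antisymmetric_sigma phi &
            is_inv_mellin (tan_quotient lam phi) f]) /\
   (forall (phi : R[i] -> R[i]) (mu : R -> R[i]),
      L2_sigma phi -> antisymmetric_sigma phi -> is_inv_mellin phi mu ->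
      (forall x : R, 0 < x -> cintegrable Rpos (stieltjes_integrand mu x)) /\
      (sol_stieltjes lam mu ->
        (exists f : R -> R[i], is_inv_mellin (tan_quotient lam phi) f) /\
        (forall f : R -> R[i],
           is_inv_mellin (tan_quotient lam phi) f -> sol_tan lam f)))) /\
  ((forall f : R -> R[i], L2 Rpos f -> sol_cot lam f ->
      exists phi : R[i] -> R[i],
        [/\ L2_sigma phi, antisymmetric_sigma phi &
            is_inv_mellin (cot_quotient lam phi) f]) /\
   (forall (phi : R[i] -> R[i]) (mu : R -> R[i]),
      L2_sigma phi -> antisymmetric_sigma phi -> is_inv_mellin phi mu ->
      (forall x : R, 0 < x -> cintegrable Rpos (stieltjes_integrand mu x)) /\
      (sol_stieltjes lam mu ->
        (exists f : R -> R[i], is_inv_mellin (cot_quotient lam phi) f) /\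
        (forall f : R -> R[i],
           is_inv_mellin (cot_quotient lam phi) f -> sol_cot lam f)))).
Proof.
have Es : (-1 : R) ^+ 2 = 1 by rewrite sqrrN expr1n.
have [t1 t2] := PV_equation_Mellin_form lam (fun z => ctan (pi%:C * z / 2) + 1 - lam) (expr1n R 2) mfun_tan_kernel tan_kernelE.
have [c1 c2] := PV_equation_Mellin_form lam (fun z => ccot (pi%:C * z / 2) + 1 - lam) Es mfun_cot_kernel cot_kernelE.
split; split.
- by move=> f Lf; rewrite sol_tanE; exact: t1.
- move=> phi m Lp ap im; have [h1 h2] := t2 phi m Lp ap im; split => // sol.
  have [e1 e2] := h2 sol; split => // f hf; rewrite sol_tanE; exact: e2.
- by move=> f Lf; rewrite sol_cotE; exact: c1.
- move=> phi m Lp ap im; have [h1 h2] := c2 phi m Lp ap im; split => // sol.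
  have [e1 e2] := h2 sol; split => // f hf; rewrite sol_cotE; exact: e2.
Qed.
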